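(* Assume $n\ge 3$. Let $(\mathcal{MS})=(Q,\nabla,g,e)$ be a mechanical control system on an $n$-dimensional configuration manifold $Q$ and let $x_0\in Q$. Then $(\mathcal{MS})$ is, locally around $x_0$, MF-linearizable to a controllable linear mechanical system $(\mathcal{LMS})$ if and only if the following four conditions hold in a neighborhood of $x_0$: (MF1) $\mathrm{rank}\,\mathcal{E}^{n-1}=n$; (MF2) $\mathcal{E}^{i}$ is involutive and of constant rank, for $0\le i\le n-2$; (MF3) $\nabla_{ad_e^i g}\,g\in\mathcal{E}^0$ for $0\le i\le n-1$; (MF4) $\nabla^2_{ad_e^k g,\,ad_e^j g}\,e\in\mathcal{E}^1$ for $0\le k,j\le n-1$.
   Context: All objects are $C^\infty$-smooth. The Einstein summation convention is used (repeated upper and lower indices are summed from $1$ to $n$). Mechanical control system. $Q$ is an $n$-dimensional manifold (or an open subset of $\mathbb{R}^n$) with a symmetric (torsion-free) affine connection $\nabla$, not necessarily metric; $e,g$ are smooth vector fields on $Q$. In local coordinates $x=(x^1,\dots,x^n)$ the covariant derivative is $\nabla_XY=\left(\frac{\partial Y^i}{\partial x^j}X^j+\Gamma^i_{jk}X^jY^k\right)\frac{\partial}{\partial x^i}$, where $\Gamma^i_{jk}=\Gamma^i_{kj}$ are the Christoffel symbols. The mechanical control system $(\mathcal{MS})=(Q,\nabla,g,e)$ with scalar control $u\in\mathbb{R}$ is the system on $TQ$ with coordinates $(x,y)$: $$\dot x^i=y^i,\qquad \dot y^i=-\Gamma^i_{jk}(x)y^jy^k+e^i(x)+g^i(x)u,\qquad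 1\le i\le n.$$ MF-linearizability. A mechanical feedback transformation $(\Phi,\alpha,\beta,\gamma)$ consists of a mechanical diffeomorphism $(\tilde x,\tilde y)=\Phi(x,y)=\left(\phi(x),\frac{\partial\phi}{\partial x}(x)y\right)$ induced by a diffeomorphism $\phi$ of the configuration space, and of a feedback $u=\gamma_{jk}(x)y^jy^k+\alpha(x)+\beta(x)\tilde u$, where $\gamma_{jk}=\gamma_{kj}$, $\alpha$, $\beta$ are smooth functions of the configuration only and $\beta$ is nowhere zero. The system $(\mathcal{MS})$ is MF-linearizable if there is such a transformation bringing it into a controllable linear mechanical system $$(\mathcal{LMS})\qquad \dot{\tilde x}^i=\tilde y^i,\qquad \dot{\tilde y}^i=E^i_j\tilde x^j+b^i\tilde u,\qquad 1\le i\le n,$$ where $E=(E^i_j)$ is a constant real $n\times n$ matrix, $b=(b^i)$ is a constant vector, and the pair $(E,b)$ is controllable, i.e. $\mathrm{rank}(b,Eb,\dots,E^{n-1}b)=n$. ''Locally around $x_0$'' means that this holds on $\bigcup_{x\in\mathcal{O}}T_xQ$ for some neighborhood $\mathcal{O}$ of $x_0$ in $Q$, with $\phi$ a diffeomorphism from $\mathcal{O}$ onto an open subset of $\mathbb{R}^n$ and $\alpha,\beta,\gamma_{jk}$ defined on $\mathcal{O}$; the transformations are global on the fibers $T_xQ$. Brackets and distributions. $[X,Y]=\frac{\partial Y}{\partial x}X-\frac{\partial X}{\partial x}Y=ad_XY$; $ad_e^0g=g$ and $ad_e^{j+1}g=[e,ad_e^jg]$. $\mathcal{E}^i=\mathrm{span}\{ad_e^jg,\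 0\le j\le i\}$ is a distribution on $Q$; in particular $\mathcal{E}^0=\mathrm{span}\{g\}$. For a vector field $X$, $X\in\mathcal{E}^i$ means $X(x)\in\mathcal{E}^i(x)$ at each point. Second covariant derivative: $\nabla^2_{X,Y}Z=\nabla_X\nabla_YZ-\nabla_{\nabla_XY}Z$. *)

(* Defs.v *)
From HB Require Import structures.
From mathcomp Require Import all_boot all_order all_algebra.
From mathcomp Require Import all_classical all_reals all_analysis.
Import Order.TTheory GRing.Theory Num.Theory.
Import numFieldNormedType.Exports.

Set Implicit Arguments.
Unset Strict Implicit.
Unset Printing Implicit Defensive.

Local Open Scope classical_set_scope.
Local Open Scope ring_scope.

(* Points and tangent vectors of R^n are row vectors. *)

Section Smooth.
Variables (R : realType) (n : nat) (V : normedModType R).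
Implicit Types (U : set 'rV[R]_n) (f : 'rV[R]_n -> V).

(* Functions are total; only their values on the open set U matter. *)
Fixpoint Ck (k : nat) U f : Prop :=
  if k is k'.+1 then
    (forall x, U x -> differentiable f x) /\
    (forall i : 'I_n, Ck k' U (fun x => 'D_(delta_mx 0 i) f x))
  else forall x, U x -> {for x, continuous f}.

Definition smooth_on U f : Prop := forall k, Ck k U f.

End Smooth.

(* A smooth n-manifold given by a (not necessarily maximal) smooth atlas.
   chart_inv i is the inverse of the chart i, relevant on its image only. *)
Record manifold (R : realType) (n : nat) := Manifold {
  carrier :> topologicalType;
  carrier_hausdorff : hausdorff_space carrier;
  carrier_second_countable : @second_countable carrier;
  atlas : Type;
  chart_dom : atlas -> set carrier;
  chart : atlas -> carrier -> 'rV[R]_n;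
  chart_inv : atlas -> 'rV[R]_n -> carrier;
  chart_dom_open : forall i, open (chart_dom i);
  chart_img_open : forall i, open (chart i @` chart_dom i);
  chartK : forall i p, chart_dom i p -> chart_inv i (chart i p) = p;
  chart_continuous : forall i, {within chart_dom i, continuous (chart i)};
  chart_inv_continuous : forall i,
    {within chart i @` chart_dom i, continuous (chart_inv i)};
  chart_cover : forall p, exists i, chart_dom i p;
  chart_compat : forall i j,
    smooth_on (chart i @` (chart_dom i `&` chart_dom j))
              (chart j \o chart_inv i) }.

Arguments atlas {R n}.
Arguments chart_dom {R n m}.
Arguments chart {R n m}.
Arguments chart_inv {R n m}.

Section Geometry.
Variables (R : realType) (n : nat) (Q : manifold R n).
Implicit Types (i j : atlas Q) (p : Q) (U : set Q).

Definition transition i j : 'rV[R]_n -> 'rV[R]_n := chart j \o chart_inv i.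

Definition chart_img i U : set 'rV[R]_n := chart i @` (U `&` chart_dom i).

(* vf i is the coordinate expression in the chart i. The coordinate formulas
   for brackets and covariant derivatives below are applied chart by chart. *)
Record vector_field := VectorField {
  vf :> atlas Q -> 'rV[R]_n -> 'rV[R]_n;
  vf_smooth : forall i, smooth_on (chart_img i setT) (vf i);
  vf_transition : forall i j p, chart_dom i p -> chart_dom j p ->
    vf j (chart j p) = 'd (transition i j) (chart i p) (vf i (chart i p)) }.

End Geometry.

Section Local.
Variables (R : realType) (n : nat).
Local Notation vec := 'rV[R]_n.
Implicit Types (X Y Z : vec -> vec) (G : 'I_n -> 'I_n -> 'I_n -> vec -> R).

(* G a b c is Gamma^a_{bc}; christoffel G x v w is Gamma^a_{bc}(x) v^b w^c. *)
Definition christoffel G (x v w : vec) : vec :=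
  \row_a \sum_b \sum_c G a b c x * v 0 b * w 0 c.

Definition cov G X Y : vec -> vec :=
  fun x => 'D_(X x) Y x + christoffel G x (X x) (Y x).

Definition cov2 G X Y Z : vec -> vec :=
  fun x => cov G X (cov G Y Z) x - cov G (cov G X Y) Z x.

Definition bracket X Y : vec -> vec :=
  fun x => 'D_(X x) Y x - 'D_(Y x) X x.

Definition ad X k Y : vec -> vec := iter k (bracket X) Y.

(* The row space of dist e g k x is E^k(x) = span {ad_e^l g (x), l <= k}. *)
Definition dist (e g : vec -> vec) (k : nat) (x : vec) : 'M[R]_(k.+1, n) :=
  \matrix_(l < k.+1) ad e l g x.

(* The right-hand side of the control system on the tangent bundle. *)
Definition mech_rhs G (e g : vec -> vec) (u : R) (z : vec * vec) : vec * vec :=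
  (z.2, - christoffel G z.1 z.2 z.2 + e z.1 + u *: g z.1).

(* E and b act on columns; states are rows, hence the transposes. *)
Definition linear_rhs (E : 'M[R]_n) (b : 'cV[R]_n) (u : R) (z : vec * vec)
  : vec * vec := (z.2, z.1 *m E^T + u *: b^T).

Definition controllable (E : 'M[R]_n) (b : 'cV[R]_n) : Prop :=
  \rank (\matrix_(r < n, k < n) (E ^+ k *m b) r 0) = n.

Definition tangent_lift (f : vec -> vec) (z : vec * vec) : vec * vec :=
  (f z.1, 'd f (fst z) z.2).

Definition quad (M : 'M[R]_n) (v w : vec) : R :=
  \sum_j \sum_k M j k * v 0 j * w 0 k.

End Local.

(* The last field is the transformation law of the Christoffel symbols,
   equivalent to coordinate independence of cov. *)
Record symmetric_connection (R : realType) (n : nat) (Q : manifold R n) :=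
  SymmetricConnection {
  Gam :> atlas Q -> 'I_n -> 'I_n -> 'I_n -> 'rV[R]_n -> R;
  Gam_smooth : forall i a b c,
    @smooth_on R n R^o (chart_img i setT) (Gam i a b c);
  Gam_sym : forall i a b c x, chart_img i setT x ->
    Gam i a b c x = Gam i a c b x;
  Gam_transition : forall i j p (v w : 'rV[R]_n),
    chart_dom i p -> chart_dom j p ->
    let x := chart i p in
    let t := transition i j in
    'd t x (christoffel (Gam i) x v w) =
      christoffel (Gam j) (t x) ('d t x v) ('d t x w)
      + 'D_v (fun z => 'D_w t z) x }.

Section MechanicalSystem.
Variables (R : realType) (n : nat) (Q : manifold R n).
Variables (nabla : symmetric_connection Q) (g e : vector_field Q).
Implicit Types (O U : set Q) (k : nat).

(* phi is a diffeomorphism from O onto the open set phi @` O of R^n. *)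
Definition diffeo_onto_open O (phi : Q -> 'rV[R]_n) : Prop :=
  exists psi : 'rV[R]_n -> Q,
  [/\ open (phi @` O),
      forall p, O p -> psi (phi p) = p,
      {within phi @` O, continuous psi},
      forall i, smooth_on (chart_img i O) (phi \o chart_inv i) &
      forall i, smooth_on (phi @` (O `&` chart_dom i)) (chart i \o psi)].

Definition smooth_fun O (a : Q -> R) : Prop :=
  forall i, @smooth_on R n R^o (chart_img i O) (a \o chart_inv i).

(* gamma i x is the matrix (gamma_{jk}(x)) in the chart i. *)
Definition smooth_sym_tensor O (gamma : atlas Q -> 'rV[R]_n -> 'M[R]_n) : Prop :=
  [/\ forall i r s, @smooth_on R n R^o (chart_img i O) (fun x => gamma i x r s),
      forall i x, chart_img i O x -> (gamma i x)^T = gamma i x &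
      forall i j p v w, O p -> chart_dom i p -> chart_dom j p ->
        let x := chart i p in
        let t := transition i j in
        quad (gamma i x) v w = quad (gamma j (t x)) ('d t x v) ('d t x w)].

Definition MF_linearizable_at (x0 : Q) : Prop :=
  exists (O : set Q) (phi : Q -> 'rV[R]_n) (alpha beta : Q -> R)
         (gamma : atlas Q -> 'rV[R]_n -> 'M[R]_n)
         (E : 'M[R]_n) (b : 'cV[R]_n),
  [/\ open O /\ O x0,
      diffeo_onto_open O phi,
      [/\ smooth_fun O alpha, smooth_fun O beta,
          forall p, O p -> beta p != 0 & smooth_sym_tensor O gamma],
      controllable E b &
      forall (i : atlas Q) (p : Q) (y : 'rV[R]_n) (u' : R),
        O p -> chart_dom i p ->
        let z := (chart i p, y) in
        let Phi := tangent_lift (phi \o chart_inv i) in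
        let u := quad (gamma i (chart i p)) y y + alpha p + beta p * u' in
        'd Phi z (mech_rhs (Gam nabla i) (e i) (g i) u z)
          = linear_rhs E b u' (Phi z)].

Definition in_dist k U (X : atlas Q -> 'rV[R]_n -> 'rV[R]_n) : Prop :=
  forall i x, chart_img i U x -> (X i x <= dist (e i) (g i) k x)%MS.

Definition dist_rank k U (r : nat) : Prop :=
  forall i x, chart_img i U x -> \rank (dist (e i) (g i) k x) = r.

(* X and Y range over smooth local sections, in coordinates. *)
Definition dist_involutive k U : Prop :=
  forall i (W : set 'rV[R]_n) (X Y : 'rV[R]_n -> 'rV[R]_n),
    open W -> W `<=` chart_img i U -> smooth_on W X -> smooth_on W Y ->
    (forall x, W x -> (X x <= dist (e i) (g i) k x)%MS) ->
    (forall x, W x -> (Y x <= dist (e i) (g i) k x)%MS) ->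
    forall x, W x -> (bracket X Y x <= dist (e i) (g i) k x)%MS.

Definition MF1 U : Prop := dist_rank n.-1 U n.

Definition MF2 U : Prop := forall k, (k <= n - 2)%N ->
  dist_involutive k U /\ exists r, dist_rank k U r.

Definition MF3 U : Prop := forall k, (k <= n.-1)%N ->
  in_dist 0 U (fun i => cov (Gam nabla i) (ad (e i) k (g i)) (g i)).

Definition MF4 U : Prop := forall k l, (k <= n.-1)%N -> (l <= n.-1)%N ->
  in_dist 1 U (fun i =>
    cov2 (Gam nabla i) (ad (e i) k (g i)) (ad (e i) l (g i)) (e i)).

End MechanicalSystem.

(* Main.v *)
(* Sufficiency. Write E^k for the span of ad_e^i g, i <= k. The identity
   ad_e^{k+1} g = nabla_e ad_e^k g - nabla_{ad_e^k g} e turns (MF3) and (MF4) into the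
   statement that every E^k is parallel, so that E^{n-2} is annihilated by a one-form
   omega with nabla omega = theta (x) omega. The function omega(e) forces theta to be
   closed (this uses n >= 3), hence a multiple of omega is parallel, and then closed,
   since nabla is torsion-free. With dh equal to this multiple, the functions
   h, L_e h, ..., L_e^{n-1} h are the linearizing coordinates: the differentials of all
   but the last are parallel by (MF4), and the feedback takes care of the last one. No
   integration of distributions is needed: the Poincare lemma and the inverse function
   theorem suffice.
   Necessity. In linear coordinates Gamma takes values in the span of b, e is linear up
   to a multiple of b, and E^k is the constant span of b, Eb, ..., E^k b. *)
From HB Require Import structures.
Require Import Defs.
From mathcomp Require Import all_boot all_order all_algebra.
From mathcomp Require Import all_classical all_reals all_analysis.
From mathcomp Require Import ring lra.
Import Order.TTheory GRing.Theory Num.Theory.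
Import numFieldNormedType.Exports.

Set Implicit Arguments.
Unset Strict Implicit.
Unset Printing Implicit Defensive.

Local Open Scope classical_set_scope.
Local Open Scope ring_scope.

(** Why parallel differentials linearize: along a trajectory the second time derivative of a
    function h is D^2h(y,y) - dh(Gamma(y,y)) + dh(e) + u dh(g), whose first two terms are (nabla
    dh)(y,y). If dh is parallel and annihilates g, only dh(e) = L_e h remains, free of velocity and
    control. The transpose of v -> nabla_v e sends a parallel form annihilating E^1 to a parallel
    form, because the error term comes from nabla^2 e, which has values in E^1. Each application
    costs one step of the flag; the last form obtained, the one that no longer annihilates g, is the
    only one that need not be parallel. The obstacle is that none of the conditions mentions
    curvature, whereas d theta is the curvature of nabla on the line bundle spanned by omega. It has
    to be extracted from the single function omega(e). For the converse, fields are written in the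
    linearizing components but stay functions of the original coordinates, so the inverse map serves
    only to show that the Jacobian is invertible. *)

Lemma near_eq_continuous (S T : topologicalType) (f g : S -> T) (x : S) :
  (\near x, f x = g x) -> {for x, continuous f} -> {for x, continuous g}.
Proof.
move=> fg cf; rewrite /prop_for /continuous_at -(nbhs_singleton fg).
by apply: cvg_trans cf; apply: near_eq_cvg.
Qed.

(** * Calculus of [Ck] and smooth maps on open sets *)

Section Differentials.
Context {R : realType} {V W : normedModType R}.
Implicit Types (f g : V -> W) (x v : V).

(** Proves differentiability and identifies the differential at once; it serves wherever the
    candidate [L] is known beforehand: matrix-valued maps, primitives of one-forms, local
    inverses. *)
Lemma is_diff_eps f x (L : {linear V -> W}) : continuous L ->
  (forall e, 0 < e -> \forall h \near (0 : V), `|f (h + x) - f x - L h| <= e * `|h|) ->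
  is_diff x f L.
Proof.
move=> cL H.
have E : f \o shift x = cst (f x) + L +o_ (0 : V) id.
  apply/eqaddoE/eqaddoP => e e0; near=> h.
  rewrite /= !fctE /= opprD addrA; near: h; exact: H.
have D := diff_unique cL E.
by apply: DiffDef => //; apply/diff_locallyP; rewrite D.
Unshelve. all: by end_near. Qed.

Lemma differentiable_eps f x e : differentiable f x -> 0 < e ->
  \forall h \near (0 : V), `|f (h + x) - f x - 'd f x h| <= e * `|h|.
Proof.
move=> /diff_locally/eqaddoP df e0; have := df e e0.
by apply: filterS => h; rewrite /= !fctE /= opprD addrA.
Qed.

Lemma near_eq_is_diff f g x : (\near x, f x = g x) -> differentiable f x ->
  is_diff x g ('d f x).
Proof.
move=> fg df; apply: is_diff_eps => [|e e0]; first exact: diff_continuous.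
have fgx : f x = g x := nbhs_singleton fg.
have fg0 : \forall h \near (0 : V), f (h + x) = g (h + x).
  by move: fg; rewrite (near_shift 0) ; apply: filterS => h /=; rewrite subr0.
near=> h.
rewrite -fgx -(near fg0 h); last by [].
by near: h; exact: differentiable_eps.
Unshelve. all: by end_near. Qed.

Lemma near_eq_differentiable f g x : (\near x, f x = g x) ->
  differentiable f x -> differentiable g x.
Proof. by move=> fg df; case: (near_eq_is_diff fg df). Qed.

Lemma open_near (U : set V) x : open U -> U x -> \forall y \near x, U y.
Proof. by move=> oU Ux; apply: open_nbhs_nbhs. Qed.

Lemma derive_lin f x a v w : differentiable f x ->
  'D_(a *: v + w) f x = a *: 'D_v f x + 'D_w f x.
Proof. by move=> df; rewrite !deriveE// linearP. Qed.

End Differentials.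

Section Ck.
Context {R : realType} {n : nat}.
Local Notation vec := 'rV[R]_n.
Implicit Types (U : set vec).

Lemma deriveE_sum {V : normedModType R} (f : vec -> V) x v : differentiable f x ->
  'D_v f x = \sum_i v 0 i *: 'D_(delta_mx 0 i) f x.
Proof.
move=> df; rewrite deriveE// {1}[v]row_sum_delta linear_sum.
by apply: eq_bigr => i _; rewrite linearZ -deriveE.
Qed.

(** Openness turns equality on [U] into equality of germs, which passes to derivatives of every
    order. *)
Lemma Ck_ext {V : normedModType R} k U (f g : vec -> V) :
  open U -> (forall x, U x -> f x = g x) -> Ck k U f -> Ck k U g.
Proof.
move=> oU; elim: k f g => [|k IH] f g fg /=.
  move=> cf x Ux; apply: near_eq_continuous (cf x Ux).
  by apply: filterS (open_near oU Ux) => z; exact: fg.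
have ng x : U x -> \near x, f x = g x.
  by move=> Ux; apply: filterS (open_near oU Ux) => z; exact: fg.
move=> [df Df]; split=> [x Ux|i].
  by apply: near_eq_differentiable (df x Ux); exact: ng.
by apply: IH (Df i) => x Ux; apply: near_eq_derive; exact: ng.
Qed.

Lemma Ck_sub {V : normedModType R} k U U' (f : vec -> V) :
  U' `<=` U -> Ck k U f -> Ck k U' f.
Proof.
move=> sU; elim: k f => [|k IH] f /= => [cf x /sU|[df Df]]; first exact: cf.
by split=> [x /sU|i]; [exact: df|exact: IH].
Qed.

Lemma CkW {V : normedModType R} k U (f : vec -> V) : Ck k.+1 U f -> Ck k U f.
Proof.
elim: k f => [|k IH] f.
  by move=> [df _] x Ux; apply: differentiable_continuous; exact: df.
by move=> [df Df]; split=> // i; apply: IH; exact: Df.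
Qed.

Lemma Ck_cst {V : normedModType R} k U (a : V) : Ck k U (fun=> a).
Proof.
elim: k a => [|k IH] a /=; first by move=> x _; exact: cst_continuous.
split=> [x _|i]; first exact: differentiable_cst.
have -> : 'D_(delta_mx 0 i : vec) (fun=> a) = fun=> (0 : V).
  by apply/funext => x; exact: derive_cst.
exact: IH.
Qed.

Lemma CkD {V : normedModType R} k U (f g : vec -> V) : open U ->
  Ck k U f -> Ck k U g -> Ck k U (fun x => f x + g x).
Proof.
move=> oU; elim: k f g => [|k IH] f g /=.
  by move=> cf cg x Ux; apply: continuousD; [exact: cf|exact: cg].
move=> [df Df] [dg Dg]; split=> [x Ux|i].
  by apply: differentiableD; [exact: df|exact: dg].
apply: (Ck_ext oU _ (IH _ _ (Df i) (Dg i))) => x Ux.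
by rewrite -deriveD//; apply: diff_derivable; [exact: df|exact: dg].
Qed.

Lemma CkN {V : normedModType R} k U (f : vec -> V) : open U ->
  Ck k U f -> Ck k U (fun x => - f x).
Proof.
move=> oU; elim: k f => [|k IH] f /=.
  by move=> cf x Ux; apply: continuousN; exact: cf.
move=> [df Df]; split=> [x Ux|i]; first by apply: differentiableN; exact: df.
apply: (Ck_ext oU _ (IH _ (Df i))) => x Ux.
by rewrite -deriveN//; apply: diff_derivable; exact: df.
Qed.

Lemma Ck_sum {V : normedModType R} k U (I : Type) (r : seq I) (P : pred I)
    (F : I -> vec -> V) : open U ->
  (forall i, P i -> Ck k U (F i)) -> Ck k U (fun x => \sum_(i <- r | P i) F i x).
Proof.
move=> oU CF; elim: r => [|i r IH].
  by apply: Ck_ext (Ck_cst k U 0) => // x _; rewrite big_nil.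
case Pi: (P i).
  by apply: Ck_ext (CkD oU (CF i Pi) IH) => // x _; rewrite big_cons Pi.
by apply: Ck_ext IH => // x _; rewrite big_cons Pi.
Qed.

Local Notation CR := (@Ck R n R^o).

Lemma CkM k U (f g : vec -> R) : open U ->
  CR k U f -> CR k U g -> CR k U (fun x => f x * g x).
Proof.
move=> oU; elim: k f g => [|k IH] f g.
  by move=> cf cg x Ux; apply: continuousM; [exact: cf|exact: cg].
move=> Cf Cg; have [df Df] := Cf; have [dg Dg] := Cg.
split=> [x Ux|i]; first by apply: differentiableM; [exact: df|exact: dg].
have := CkD oU (IH _ _ (CkW Cf) (Dg i)) (IH _ _ (CkW Cg) (Df i)).
apply: Ck_ext => // x Ux.
by rewrite (deriveM (diff_derivable (df x Ux)) (diff_derivable (dg x Ux))).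
Qed.

(** The derivative - f' / f^2 contains 1/f only at the lower order, where the induction hypothesis
    applies. *)
Lemma CkV k U (f : vec -> R) : open U -> (forall x, U x -> f x != 0) ->
  CR k U f -> CR k U (fun x => (f x)^-1).
Proof.
move=> oU f0; elim: k => [|k IH].
  by move=> cf x Ux; apply: continuousV; [exact: f0|exact: cf].
move=> Cf; have [df Df] := Cf.
split=> [x Ux|i]; first by apply: differentiableV; [exact: df|exact: f0].
have IV := IH (CkW Cf).
have := CkN oU (CkM oU (CkM oU IV IV) (Df i)).
apply: Ck_ext => // x Ux.
rewrite (deriveV (f0 x Ux) (diff_derivable (df x Ux))).
by rewrite /GRing.scale/= -exprVn expr2 mulNr.
Qed.

Lemma Ck_prod k U (I : Type) (r : seq I) (P : pred I)
    (F : I -> vec -> R) : open U ->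
  (forall i, P i -> CR k U (F i)) -> CR k U (fun x => \prod_(i <- r | P i) F i x).
Proof.
move=> oU CF; elim: r => [|i r IH].
  by apply: (@Ck_ext R^o) (Ck_cst k U (1 : R^o)) => // x _; rewrite big_nil.
case Pi: (P i).
  by apply: Ck_ext (CkM oU (CF i Pi) IH) => // x _; rewrite big_cons Pi.
by apply: Ck_ext IH => // x _; rewrite big_cons Pi.
Qed.

Lemma mx_norm_entry p q (M : 'M[R]_(p, q)) i j : `|M i j| <= `|M|.
Proof.
rewrite [leRHS]/Num.Def.normr/= mx_normrE.
exact: (@le_bigmax _ _ _ _ (fun ij : 'I_p * 'I_q => `|M ij.1 ij.2|) (i, j)).
Qed.

Lemma mx_norm_le p q (M : 'M[R]_(p, q)) e : 0 <= e ->
  (forall i j, `|M i j| <= e) -> `|M| <= e.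
Proof.
move=> e0 H; rewrite [leLHS]/Num.Def.normr/= mx_normrE.
by apply: bigmax_le => // -[i j] _; exact: H.
Qed.

Lemma continuous_mxP (T : topologicalType) p q (M : T -> 'M[R]_(p, q)) (x : T) :
  {for x, continuous M} <-> forall i j, {for x, continuous (fun z => M z i j : R^o)}.
Proof.
split=> [cM i j|cM].
  exact: (continuous_comp cM (@coord_continuous _ _ _ i j _)).
  apply/cvgrPdist_le => e e0; near=> z.
  apply: mx_norm_le => [|i j]; first exact: ltW.
  rewrite !mxE; move: i j; near: z.
  apply: filter_forall => i; apply: filter_forall => j.
  by have /cvgrPdist_le := cM i j; exact.
Unshelve. all: by end_near. Qed.

(** The norm is the maximum over finitely many entries, so the entrywise remainder estimates hold
    simultaneously near the point. *)
Lemma differentiable_mxP {V : normedModType R} p q (M : V -> 'M[R]_(p, q)) x :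
  differentiable M x <-> forall i j, differentiable (fun z => M z i j : R^o) x.
Proof.
split=> [dM i j|dM].
  apply: (@differentiable_comp _ _ _ _ M (fun N : 'M[R]_(p, q) => N i j : R^o)) => //.
  exact: differentiable_coord.
pose L v : 'M[R]_(p, q) := \matrix_(i, j) 'd (fun z => M z i j : R^o) x v.
have lL : linear L by move=> a u v; apply/matrixP=> i j; rewrite !mxE linearP.
pose LL : {linear V -> 'M[R]_(p, q)} :=
  HB.pack L (GRing.isLinear.Build _ _ _ _ _ lL).
have key e : 0 < e -> \forall h \near (0 : V),
    `|M (h + x) - M x - LL h| <= e * `|h|.
  move=> e0; near=> h.
  apply: mx_norm_le => [|i j]; first by rewrite mulr_ge0// ltW.
  rewrite !mxE; move: i j; near: h.
  apply: filter_forall => i; apply: filter_forall => j.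
  exact: differentiable_eps (dM i j) e0.
have cL : continuous LL.
  move=> v; apply/cvgrPdist_le => e e0; near=> w.
  apply: mx_norm_le => [|i j]; first exact: ltW.
  rewrite !mxE; move: i j; near: w.
  apply: filter_forall => i; apply: filter_forall => j.
  have /(_ v)/cvgrPdist_le := diff_continuous (dM i j).
  exact.
by case: (is_diff_eps cL key).
Unshelve. all: by end_near. Qed.

Lemma derive_mxE {V : normedModType R} p q (M : V -> 'M[R]_(p, q)) x v i j :
  differentiable M x -> ('D_v M x) i j = 'D_v (fun z => M z i j : R^o) x.
Proof. by move=> dM; rewrite derive_mx ?mxE//; exact: diff_derivable. Qed.

Lemma Ck_mxP k U p q (M : vec -> 'M[R]_(p, q)) : open U ->
  Ck k U M <-> forall i j, CR k U (fun x => M x i j).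
Proof.
move=> oU; elim: k M => [|k IH] M /=.
  split=> [cM i j x Ux|cM x Ux]; first by move/continuous_mxP: (cM x Ux).
  by apply/continuous_mxP => i j; exact: cM.
split=> [[dM DM] i j|CM].
  split=> [x Ux|l]; first by move/differentiable_mxP: (dM x Ux); exact.
  have /(IH _) /(_ i j) := DM l.
  apply: Ck_ext => // x Ux; rewrite derive_mxE//; exact: dM.
have dM x : U x -> differentiable M x.
  by move=> Ux; apply/differentiable_mxP => i j; case: (CM i j) => + _; exact.
split=> // l; apply/IH => i j; case: (CM i j) => _ /(_ l).
by apply: Ck_ext => // x Ux; rewrite derive_mxE//; exact: dM.
Qed.

End Ck.

Section Rules.
Context {R : realType} {V : normedModType R}.
Implicit Types (x v : V).

Lemma diffable_sum (I : Type) (r : seq I) (P : pred I) {W : normedModType R}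
    (F : I -> V -> W) x :
  (forall i, P i -> differentiable (F i) x) ->
  differentiable (fun z => \sum_(i <- r | P i) F i z) x.
Proof.
move=> dF; elim: r => [|i r IH].
  apply: near_eq_differentiable (differentiable_cst (0 : W) x).
  by apply: nearW => z; rewrite big_nil.
case Pi: (P i).
  apply: near_eq_differentiable (differentiableD (dF i Pi) IH).
  by apply: nearW => z; rewrite big_cons Pi.
apply: near_eq_differentiable IH.
by apply: nearW => z; rewrite big_cons Pi.
Qed.

Lemma derive_bigsum (I : Type) (r : seq I) (P : pred I) {W : normedModType R}
    (F : I -> V -> W) x v :
  (forall i, P i -> differentiable (F i) x) ->
  'D_v (fun z => \sum_(i <- r | P i) F i z) x = \sum_(i <- r | P i) 'D_v (F i) x.
Proof.
move=> dF; elim: r => [|i r IH].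
  have -> : (fun z => \sum_(i <- [::] | P i) F i z) = fun=> (0 : W).
    by apply/funext => z; rewrite big_nil.
  by rewrite big_nil; exact: derive_cst.
rewrite big_cons; case Pi: (P i); last first.
  rewrite -IH; congr (derive _ x v).
  by apply/funext => z; rewrite big_cons Pi.
have dr := @diffable_sum _ r P _ _ _ dF.
rewrite -IH -deriveD; [|exact/diff_derivable/dF|exact/diff_derivable].
by congr (derive _ x v); apply/funext => z; rewrite big_cons Pi.
Qed.

Lemma derive_add {W : normedModType R} (f g : V -> W) x v :
  differentiable f x -> differentiable g x ->
  'D_v (fun z => f z + g z) x = 'D_v f x + 'D_v g x.
Proof. by move=> df dg; rewrite -deriveD//; exact: diff_derivable. Qed.

Lemma derive_sub {W : normedModType R} (f g : V -> W) x v :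
  differentiable f x -> differentiable g x ->
  'D_v (fun z => f z - g z) x = 'D_v f x - 'D_v g x.
Proof. by move=> df dg; rewrite -deriveB//; exact: diff_derivable. Qed.

Lemma derive_opp {W : normedModType R} (f : V -> W) x v :
  differentiable f x -> 'D_v (fun z => - f z) x = - 'D_v f x.
Proof. by move=> df; rewrite -deriveN//; exact: diff_derivable. Qed.

Lemma derive_mul (f g : V -> R) x v :
  differentiable (f : V -> R^o) x -> differentiable (g : V -> R^o) x ->
  'D_v (fun z => f z * g z : R^o) x
  = f x * 'D_v (g : V -> R^o) x + g x * 'D_v (f : V -> R^o) x.
Proof.
by move=> df dg; rewrite (deriveM (diff_derivable df) (diff_derivable dg)).
Qed.

Lemma diffable_mulmx p q r (M : V -> 'M[R]_(p, q)) (N : V -> 'M[R]_(q, r)) x :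
  differentiable M x -> differentiable N x ->
  differentiable (fun z => M z *m N z) x.
Proof.
move=> /differentiable_mxP dM /differentiable_mxP dN.
apply/differentiable_mxP => i j.
under eq_fun do rewrite mxE.
by apply: diffable_sum => k _; apply: differentiableM.
Qed.

Lemma derive_mulmx p q r (M : V -> 'M[R]_(p, q)) (N : V -> 'M[R]_(q, r)) x v :
  differentiable M x -> differentiable N x ->
  'D_v (fun z => M z *m N z) x = 'D_v M x *m N x + M x *m 'D_v N x.
Proof.
move=> dM dN; apply/matrixP => i j.
rewrite derive_mxE; last exact: diffable_mulmx.
under eq_fun do rewrite mxE.
have dM' := (differentiable_mxP _ _).1 dM.
have dN' := (differentiable_mxP _ _).1 dN.
rewrite derive_bigsum; last by move=> k _; apply: differentiableM.
rewrite !mxE -big_split/=; apply: eq_bigr => k _.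
rewrite derive_mul// !derive_mxE// addrC; congr (_ + _); exact: mulrC.
Qed.

Lemma derive_mulmxl p q r (M : V -> 'M[R]_(p, q)) (B : 'M[R]_(q, r)) x v :
  differentiable M x -> 'D_v (fun z => M z *m B) x = 'D_v M x *m B.
Proof.
move=> dM; rewrite (derive_mulmx (N := fun=> B))//.
by rewrite (derive_cst B x v) mulmx0 addr0.
Qed.

Lemma derive_mulmxr p q r (B : 'M[R]_(p, q)) (M : V -> 'M[R]_(q, r)) x v :
  differentiable M x -> 'D_v (fun z => B *m M z) x = B *m 'D_v M x.
Proof.
move=> dM; rewrite (derive_mulmx (M := fun=> B))//.
by rewrite (derive_cst B x v) mul0mx add0r.
Qed.

Lemma diffable_scal p q (a : V -> R) (M : V -> 'M[R]_(p, q)) x :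
  differentiable (a : V -> R^o) x -> differentiable M x ->
  differentiable (fun z => a z *: M z) x.
Proof.
move=> da /differentiable_mxP dM; apply/differentiable_mxP => i j.
by under eq_fun do rewrite mxE; apply: differentiableM.
Qed.

Lemma derive_scal p q (a : V -> R) (M : V -> 'M[R]_(p, q)) x v :
  differentiable (a : V -> R^o) x -> differentiable M x ->
  'D_v (fun z => a z *: M z) x = 'D_v (a : V -> R^o) x *: M x + a x *: 'D_v M x.
Proof.
move=> da dM; apply/matrixP => i j.
rewrite derive_mxE; last exact: diffable_scal.
under eq_fun do rewrite mxE.
rewrite derive_mul//; last by move/differentiable_mxP : dM; exact.
by rewrite !mxE derive_mxE// addrC [M x i j * _]mulrC.
Qed.

Lemma derive_comp {V' W : normedModType R} (f : V -> V') (g : V' -> W) x v :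
  differentiable f x -> differentiable g (f x) ->
  'D_v (g \o f) x = 'D_('D_v f x) g (f x).
Proof.
move=> df dg; rewrite !deriveE//; last exact: differentiable_comp.
by rewrite diff_comp.
Qed.

End Rules.

Section Smooth.
Context {R : realType} {n : nat}.
Local Notation vec := 'rV[R]_n.
Local Notation CR := (@Ck R n R^o).
Local Notation smoothR := (@smooth_on R n R^o).
Implicit Types (U : set vec).

Lemma Ck_id k U : open U -> Ck k U (fun x : vec => x).
Proof.
move=> oU; case: k => [|k]; first by move=> x _; exact: cvg_id.
split=> [x _|i]; first exact: ex_diff.
by apply: Ck_ext (Ck_cst k U (delta_mx 0 i : vec)) => // x _; rewrite derive_id.
Qed.

Lemma CkZ_cst {V : normedModType R} k U (a : R) (h : vec -> V) : open U ->
  Ck k U h -> Ck k U (fun x => a *: h x).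
Proof.
move=> oU; elim: k h => [|k IH] h.
  move=> ch x Ux; apply: (continuous_comp (g := fun y => a *: y) (ch x Ux)).
  exact: scaler_continuous.
move=> Ch; have [dh Dh] := Ch; split=> [x Ux|j].
  by apply: differentiableZ; exact: dh.
have := IH _ (Dh j); apply: Ck_ext => // x Ux.
by rewrite -deriveZ//; apply: diff_derivable; exact: dh.
Qed.

(** By the chain rule the partial derivatives of g o f are sums of products of those of f with those
    of g composed with f; hence the induction is over all [g], for a fixed [f]. *)
Lemma Ck_comp k U W (f : vec -> vec) (g : vec -> R) : open U ->
  (forall x, U x -> W (f x)) -> Ck k U f -> CR k W g -> CR k U (g \o f).
Proof.
move=> oU fW; elim: k g => [|k IH] g.
  by move=> cf cg x Ux; apply: continuous_comp; [exact: cf|exact/cg/fW].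
move=> Cf Cg; have [df Df] := Cf; have [dg Dg] := Cg.
have dfg x : U x -> differentiable (g \o f : vec -> R^o) x.
  by move=> Ux; apply: differentiable_comp; [exact: df|exact/dg/fW].
split=> // i.
have H : CR k U (fun x => \sum_j ('D_(delta_mx 0 i) f x) 0 j *
    ('D_(delta_mx 0 j) (g : vec -> R^o) \o f) x).
  apply: Ck_sum => // j _; apply: CkM => //.
    by have /Ck_mxP := Df i; exact.
  by apply: IH (Dg j); exact: CkW.
apply: Ck_ext H => // x Ux.
rewrite (derive_comp _ (df x Ux) (dg _ (fW x Ux))).
by rewrite [RHS](deriveE_sum _ (dg _ (fW x Ux))).
Qed.

Lemma smooth_ext {V : normedModType R} U (f g : vec -> V) :
  open U -> (forall x, U x -> f x = g x) -> smooth_on U f -> smooth_on U g.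
Proof. by move=> oU fg sf k; exact: Ck_ext (sf k). Qed.

Lemma smooth_sub {V : normedModType R} U U' (f : vec -> V) :
  U' `<=` U -> smooth_on U f -> smooth_on U' f.
Proof. by move=> sU sf k; exact: Ck_sub (sf k). Qed.

Lemma smooth_diff {V : normedModType R} U (f : vec -> V) x :
  smooth_on U f -> U x -> differentiable f x.
Proof. by move=> /(_ 1%N) [df _]; exact: df. Qed.

Lemma smooth_cont {V : normedModType R} U (f : vec -> V) x :
  smooth_on U f -> U x -> {for x, continuous f}.
Proof. by move=> /(_ 0%N) cf /cf. Qed.

Lemma smooth_cst {V : normedModType R} U (a : V) : smooth_on U (fun=> a).
Proof. by move=> k; exact: Ck_cst. Qed.

Lemma smooth_id U : open U -> smooth_on U (fun x : vec => x).
Proof. by move=> oU k; exact: Ck_id. Qed.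

Lemma smoothD {V : normedModType R} U (f g : vec -> V) : open U ->
  smooth_on U f -> smooth_on U g -> smooth_on U (fun x => f x + g x).
Proof. by move=> oU sf sg k; exact: CkD. Qed.

Lemma smoothN {V : normedModType R} U (f : vec -> V) : open U ->
  smooth_on U f -> smooth_on U (fun x => - f x).
Proof. by move=> oU sf k; exact: CkN. Qed.

Lemma smoothB {V : normedModType R} U (f g : vec -> V) : open U ->
  smooth_on U f -> smooth_on U g -> smooth_on U (fun x => f x - g x).
Proof. by move=> oU sf sg; apply: smoothD => //; exact: smoothN. Qed.

Lemma smooth_sum {V : normedModType R} U (I : Type) (r : seq I) (P : pred I)
    (F : I -> vec -> V) : open U -> (forall i, P i -> smooth_on U (F i)) ->
  smooth_on U (fun x => \sum_(i <- r | P i) F i x).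
Proof. by move=> oU sF k; apply: Ck_sum => // i Pi; exact: sF. Qed.

Lemma smoothM U (f g : vec -> R) : open U ->
  smoothR U f -> smoothR U g -> smoothR U (fun x => f x * g x).
Proof. by move=> oU sf sg k; exact: CkM. Qed.

Lemma smoothV U (f : vec -> R) : open U -> (forall x, U x -> f x != 0) ->
  smoothR U f -> smoothR U (fun x => (f x)^-1).
Proof. by move=> oU f0 sf k; exact: CkV. Qed.

Lemma smooth_prod U (I : Type) (r : seq I) (P : pred I)
    (F : I -> vec -> R) : open U -> (forall i, P i -> smoothR U (F i)) ->
  smoothR U (fun x => \prod_(i <- r | P i) F i x).
Proof. by move=> oU sF k; apply: Ck_prod => // i Pi; exact: sF. Qed.

Lemma smooth_mxP U p q (M : vec -> 'M[R]_(p, q)) : open U ->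
  smooth_on U M <-> forall i j, smoothR U (fun x => M x i j).
Proof.
move=> oU; split=> [sM i j k|sM k]; first by move/Ck_mxP: (sM k); exact.
by apply/Ck_mxP => // i j; exact: sM.
Qed.

Lemma smooth_comp U W (f : vec -> vec) (g : vec -> R) : open U ->
  (forall x, U x -> W (f x)) -> smooth_on U f -> smoothR W g ->
  smoothR U (g \o f).
Proof. by move=> oU fW sf sg k; exact: (Ck_comp oU fW). Qed.

Lemma smooth_comp_mx U W p q (f : vec -> vec) (g : vec -> 'M[R]_(p, q)) :
  open U -> open W -> (forall x, U x -> W (f x)) -> smooth_on U f ->
  smooth_on W g -> smooth_on U (g \o f).
Proof.
move=> oU oW fW sf /(smooth_mxP _ oW) sg; apply/smooth_mxP => // i j.
exact: (smooth_comp oU fW sf (sg i j)).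
Qed.

Lemma smooth_scal U p q (a : vec -> R) (M : vec -> 'M[R]_(p, q)) : open U ->
  smoothR U a -> smooth_on U M -> smooth_on U (fun x => a x *: M x).
Proof.
move=> oU sa /smooth_mxP sM; apply/smooth_mxP => // i j.
by under eq_fun do rewrite mxE; apply: smoothM => //; exact: sM.
Qed.

Lemma smooth_mulmx U p q r (M : vec -> 'M[R]_(p, q)) (N : vec -> 'M[R]_(q, r)) :
  open U -> smooth_on U M -> smooth_on U N -> smooth_on U (fun x => M x *m N x).
Proof.
move=> oU /smooth_mxP sM /smooth_mxP sN; apply/smooth_mxP => // i j.
under eq_fun do rewrite mxE.
by apply: smooth_sum => // k _; apply: smoothM => //; [exact: sM|exact: sN].
Qed.

Lemma smooth_trmx U p q (M : vec -> 'M[R]_(p, q)) :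
  open U -> smooth_on U M -> smooth_on U (fun x => (M x)^T).
Proof.
move=> oU /smooth_mxP sM; apply/smooth_mxP => // i j.
by under eq_fun do rewrite mxE; exact: sM.
Qed.

Lemma smooth_det U p (M : vec -> 'M[R]_p) :
  open U -> smooth_on U M -> smoothR U (fun x => \det (M x)).
Proof.
move=> oU /smooth_mxP sM; apply: smooth_sum => // s _.
apply: smoothM => //; first exact: smooth_cst.
by apply: smooth_prod => // i _; exact: sM.
Qed.

(** Cramer's rule makes the entries of the inverse rational functions of the entries. *)
Lemma smooth_invmx U p (M : vec -> 'M[R]_p) : open U ->
  (forall x, U x -> M x \in unitmx) -> smooth_on U M ->
  smooth_on U (fun x => invmx (M x)).
Proof.
move=> oU uM sM.
have H : smooth_on U (fun x => (\det (M x))^-1 *: \adj (M x)).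
  apply: smooth_scal => //.
    apply: smoothV => //; last exact: smooth_det.
    by move=> x Ux; rewrite -unitfE -unitmxE uM.
  apply/smooth_mxP => // i j; under eq_fun do rewrite mxE.
  apply: smoothM => //; first exact: smooth_cst.
  apply: smooth_det => //; apply/smooth_mxP => // k l.
  by under eq_fun do rewrite !mxE; move/smooth_mxP: sM; exact.
by apply: smooth_ext H => // x Ux; rewrite /invmx uM.
Qed.

Lemma smooth_derive_cst {V : normedModType R} U (f : vec -> V) v : open U ->
  smooth_on U f -> smooth_on U ('D_v f).
Proof.
move=> oU sf k; have [df Df] := sf k.+1.
have H : Ck k U (fun x => \sum_i v 0 i *: 'D_(delta_mx 0 i) f x).
  by apply: Ck_sum => // i _; apply: (CkZ_cst _ oU (Df i)).
by apply: Ck_ext H => // x Ux; rewrite deriveE_sum//; exact: df.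
Qed.

Lemma smooth_derive U p q (X : vec -> vec) (M : vec -> 'M[R]_(p, q)) : open U ->
  smooth_on U X -> smooth_on U M -> smooth_on U (fun x => 'D_(X x) M x).
Proof.
move=> oU sX sM.
have H : smooth_on U (fun x => \sum_i X x 0 i *: 'D_(delta_mx 0 i) M x).
  apply: smooth_sum => // i _; apply: smooth_scal => //.
    by move/smooth_mxP: sX; exact.
  exact: smooth_derive_cst.
by apply: smooth_ext H => // x Ux; rewrite deriveE_sum//; exact: smooth_diff sM Ux.
Qed.

End Smooth.

(** * Symmetry of second derivatives *)

Section Lines.
Context {R : realType} {V W : normedModType R}.
Implicit Types (x v : V).

Lemma is_derive_line (f : V -> W) x v d (s : R) : is_derive (x + s *: v) v f d ->
  is_derive s 1 (fun t : R => f (x + t *: v)) d.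
Proof.
case=> df <-.
have E : (fun h : R => h^-1 *: (f (x + (h *: 1 + s) *: v) - f (x + s *: v)))
    = (fun h : R => h^-1 *: (f (h *: v + (x + s *: v)) - f (x + s *: v))).
  apply/funext => h; congr (_ *: (f _ - _)).
  by rewrite scalerDl [h *: 1]mulr1 addrCA.
apply: DeriveDef; last by rewrite /derive /= /shift -E.
by have := df; rewrite /derivable /= /shift -E.
Qed.

Lemma line_is_derive (f : V -> W) x v (s : R) : differentiable f (x + s *: v) ->
  is_derive s 1 (fun t : R => f (x + t *: v)) ('D_v f (x + s *: v)).
Proof. by move=> df; apply: is_derive_line; exact/derivableP/diff_derivable. Qed.

End Lines.

Lemma is_derive_mul_id {R : realType} (g : R -> R) (s d : R) :
  is_derive s (1 : R) (g : R -> R) d ->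
  is_derive s (1 : R) ((id : R -> R) * g) (g s + s * d).
Proof.
case=> dg <-; have did : derivable (id : R -> R) s 1 by exact: derivable_id.
apply: DeriveDef; first exact: (derivableM did dg).
by rewrite (deriveM did dg) derive_id addrC [_ *: 1]mulr1.
Qed.

Lemma is_derive_mulr {R : realType} (s c : R) : is_derive s 1 (fun t : R => t * c : R^o) c.
Proof.
have did : derivable (id : R -> R) s 1 by exact: derivable_id.
have dc : derivable (cst c : R -> R) s 1 by exact: derivable_cst.
apply: DeriveDef; first exact: (derivableM did dc).
by rewrite (deriveM did dc) derive_id derive_cst scaler0 add0r [_ *: _]mulr1.
Qed.

Section MeanValue.
Context {R : realType}.

Lemma mvt0 (g dg : R -> R) (h : R) : 0 < h ->
  (forall s, 0 <= s <= h -> is_derive s 1 (g : R -> R^o) (dg s)) ->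
  exists2 c, 0 <= c <= h & g h - g 0 = dg c * h.
Proof.
move=> h0 dgs; have [||c] := @MVT R g dg 0 h h0.
- move=> s; rewrite in_itv/= => /andP[s0 sh].
  by apply: dgs; rewrite !ltW.
- apply: derivable_within_continuous => s; rewrite in_itv/= => sh.
  by case: (dgs s sh).
rewrite in_itv/= => /andP[c0 ch]; rewrite subr0 => E.
by exists c; rewrite ?ltW.
Qed.

Context {n : nat}.
Local Notation vec := 'rV[R]_n.
Local Notation smoothR := (@smooth_on R n R^o).

(** Two applications of the mean value theorem: along [u] to the difference of [f] on two parallel
    segments, then along [v] to the derivative ['D_u f]. *)
Lemma second_difference (U : set vec) (f : vec -> R) x u v (h : R) : open U ->
  smoothR U f -> 0 < h ->
  (forall s t, 0 <= s <= h -> 0 <= t <= h -> U (x + s *: u + t *: v)) ->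
  exists c d, [/\ 0 <= c <= h, 0 <= d <= h &
    f (x + h *: u + h *: v) - f (x + h *: u) - (f (x + h *: v) - f x)
    = 'D_v ('D_u (f : vec -> R^o)) (x + c *: u + d *: v) * h * h].
Proof.
move=> oU sf h0 Uxuv.
have hh : 0 <= h <= h by rewrite lexx ltW.
have h00 : (0 : R) <= 0 <= h by rewrite lexx ltW.
have df s t : 0 <= s <= h -> 0 <= t <= h ->
    differentiable (f : vec -> R^o) (x + s *: u + t *: v).
  by move=> ? ?; apply: (smooth_diff sf); exact: Uxuv.
have dDf s t : 0 <= s <= h -> 0 <= t <= h ->
    differentiable ('D_u (f : vec -> R^o)) (x + s *: u + t *: v).
  move=> ? ?; apply: (@smooth_diff _ _ R^o U); last exact: Uxuv.
  exact: smooth_derive_cst.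
have lineu w s : differentiable (f : vec -> R^o) (w + s *: u) ->
    is_derive s 1 (fun s : R => f (w + s *: u) : R^o) ('D_u (f : vec -> R^o) (w + s *: u)).
  exact: line_is_derive.
have d1 s : 0 <= s <= h -> is_derive s 1
    (fun s : R => f (x + h *: v + s *: u) - f (x + s *: u) : R^o)
    ('D_u (f : vec -> R^o) (x + h *: v + s *: u) - 'D_u (f : vec -> R^o) (x + s *: u)).
  move=> sh; apply: is_deriveB; apply: lineu.
    by rewrite addrAC; exact: df.
  by have := df s 0 sh h00; rewrite scale0r addr0.
have [c ch E1] := mvt0 h0 d1.
have d2 t : 0 <= t <= h -> is_derive t 1
    (fun t : R => 'D_u (f : vec -> R^o) (x + c *: u + t *: v) : R^o)
    ('D_v ('D_u (f : vec -> R^o)) (x + c *: u + t *: v)).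
  by move=> th; apply: line_is_derive; exact: dDf.
have [d dh E2] := mvt0 h0 d2.
exists c, d; split => //; rewrite -E2 scale0r addr0.
by rewrite [x + c *: u + _]addrAC -E1 !scale0r !addr0 [x + h *: v + _]addrAC.
Qed.

(** The second difference is symmetric in [u] and [v], so the two mixed derivatives agree at two
    points arbitrarily close to [x]; continuity concludes. *)
Lemma clairaut (U : set vec) (f : vec -> R) x u v : open U -> smoothR U f -> U x ->
  'D_u ('D_v (f : vec -> R^o)) x = 'D_v ('D_u (f : vec -> R^o)) x.
Proof.
move=> oU sf Ux; apply/eqP; rewrite -subr_eq0 -normr_le0; apply/ler_addgt0Pr => e e0.
rewrite add0r.
have cD (a b : vec) : {for x, continuous ('D_a ('D_b (f : vec -> R^o)))}.
  apply: (@smooth_cont _ _ R^o U) => //.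
  by apply: smooth_derive_cst => //; exact: smooth_derive_cst.
have e2 : 0 < e / 2 by rewrite divr_gt0.
have /cvgrPdist_lt /(_ _ e2) near1 := cD u v.
have /cvgrPdist_lt /(_ _ e2) near2 := cD v u.
have near3 := open_near oU Ux.
have [r /= r0 H] := (nbhs_ballP _ _).1 (filterI near3 (filterI near1 near2)).
(* With h = r / N the parallelogram with sides h u and h v stays in the ball; the summand 1 keeps
   [N] positive when u = v = 0. *)
pose N := `|u| + `|v| + 1; have N0 : 0 < N by rewrite ltr_wpDl// addr_ge0.
pose h := r / N; have h0 : 0 < h by rewrite divr_gt0.
have inb s t : 0 <= s <= h -> 0 <= t <= h -> ball x r (x + s *: u + t *: v).
  move=> /andP[s0 sh] /andP[t0 th]; rewrite -ball_normE/= -addrA opprD addNKr normrN.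
  apply: le_lt_trans (ler_normD _ _) _; rewrite !normrZ !ger0_norm//.
  apply: (@le_lt_trans _ _ (h * (`|u| + `|v|))).
    by rewrite mulrDr lerD// ler_wpM2r.
  by rewrite -ltr_pdivlMl// /h invf_div divfK ?gt_eqF// /N ltrDl.
have [c [d [ch dh E1]]] := second_difference (x := x) (u := u) (v := v) oU sf h0
  (fun s t hs ht => (H _ (inb s t hs ht)).1).
have [d' [c' [dh' ch' E2]]] := second_difference (x := x) (u := v) (v := u) oU sf h0
  (fun s t hs ht => eq_ind _ U ((H _ (inb t s ht hs)).1) _ (addrAC _ _ _)).
have E : 'D_v ('D_u (f : vec -> R^o)) (x + c *: u + d *: v)
    = 'D_u ('D_v (f : vec -> R^o)) (x + d' *: v + c' *: u).
  apply: (mulIf (lt0r_neq0 h0)); apply: (mulIf (lt0r_neq0 h0)).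
  apply: (etrans (esym E1)); apply: (etrans _ E2).
  rewrite [x + h *: v + _]addrAC.
  by rewrite !opprB addrACA [RHS]addrACA; congr (_ + _); rewrite addrC.
have [_ [_ /= N2]] := H _ (inb _ _ ch dh).
have [_ [/= N1 _]] := H _ (inb _ _ ch' dh').
rewrite [x + c' *: u + _]addrAC -E in N1.
rewrite (splitr e); apply: ltW; apply: le_lt_trans (ltrD N1 N2).
rewrite [X in _ <= _ + X]distrC; apply: le_trans (ler_normD _ _).
by rewrite addrA subrK.
Qed.

End MeanValue.

(** * Poincare lemma on a ball *)

Section Leibniz.
Context {R : realType}.
Local Notation mu := (@lebesgue_measure R).

(** Differentiation under the integral sign, dominated by the constant [C], followed by the
    fundamental theorem of calculus: the differentiated integrand is required to be the derivative
    of [G] in t. *)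
Lemma leibniz_rule01 (f df : R -> R -> R) (G : R -> R) (e C : R) : 0 < e ->
  (forall s t : R, `|s| < e -> 0 <= t <= 1 ->
     is_derive s (1 : R) (fun s => f s t : R^o) (df s t)) ->
  (forall s t : R, `|s| < e -> 0 <= t <= 1 -> `|df s t| <= C) ->
  (forall s t : R, `|s| < e -> 0 <= t <= 1 -> {for t, continuous (f s : R -> R^o)}) ->
  (forall t : R, 0 <= t <= 1 -> is_derive t (1 : R) (G : R -> R^o) (df 0 t)) ->
  (forall t : R, 0 <= t <= 1 -> {for t, continuous (df 0 : R -> R^o)}) ->
  is_derive (0 : R) (1 : R) (fun s : R => \int[mu]_(t in `[0, 1]) f s t : R^o) (G 1 - G 0).
Proof.
move=> e0 dfd dfC fc dG dfc.
have C0 : 0 <= C by apply: le_trans (dfC 0 0 _ _); rewrite ?normr0 ?lexx ?ler01.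
have Ie s : `]-e, e[%classic s -> `|s| < e by rewrite /= in_itv/= ltr_norml.
have I0 : `]-e, e[%classic (0 : R) by rewrite /= in_itv/= oppr_lt0 e0.
have I1 t : `[0, 1]%classic t -> 0 <= t <= 1 by rewrite /= in_itv.
have intf s : `]-e, e[%classic s -> mu.-integrable `[0, 1] (EFin \o f s).
  move=> /Ie se; apply: continuous_compact_integrable; first exact: segment_compact.
  by apply: continuous_in_subspaceT => t; rewrite inE => /I1 t01; exact: fc.
have d1 s t : `]-e, e[%classic s -> `[0, 1]%classic t -> derivable (f ^~ t : R -> R^o) s 1.
  by move=> /Ie se /I1 t1; case: (dfd s t se t1).
have d1E s t : `]-e, e[%classic s -> `[0, 1]%classic t -> partial1of2 f s t = df s t.
  by move=> /Ie se /I1 t1; rewrite partial1of2E; case: (dfd s t se t1).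
have intC : mu.-integrable `[0, 1] (EFin \o (cst C)).
  apply: continuous_compact_integrable; first exact: segment_compact.
  by apply: continuous_subspaceT => t; exact: cst_continuous.
have dC s t : `]-e, e[%classic s -> `[0, 1]%classic t -> `|partial1of2 f s t| <= cst C t.
  by move=> se t1; rewrite d1E//; apply: dfC; [exact: Ie|exact: I1].
have m01 : measurable (`[0, 1]%classic : set (measurableTypeR R)) by exact: measurable_itv.
have D1 := derivable_under_integral m01 I0 intf d1 (fun=> C0) intC dC.
have D2 := differentiation_under_integral m01 I0 intf d1 (fun=> C0) intC dC.
apply: DeriveDef; first exact: D1.
rewrite -derive1E D2.
have -> : \int[mu]_(t in `[0, 1]) (partial1of2 f ^~ t) 0 = \int[mu]_(t in `[0, 1]) df 0 t.
  by apply: eq_Rintegral => t; rewrite inE => t1; exact: d1E.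
have dGc t : 0 <= t <= 1 -> {for t, continuous (G : R -> R^o)}.
  by move=> t1; apply/differentiable_continuous/derivable1_diffP; case: (dG t t1).
rewrite /Rintegral (@continuous_FTC2 _ _ G)//.
- by apply: continuous_in_subspaceT => t; rewrite inE => /I1; exact: dfc.
- split.
  + by move=> t; rewrite in_itv/= => /andP[t0 t1]; case: (dG t); rewrite ?ltW.
  + by apply: cvg_at_right_filter; apply: dGc; rewrite lexx ler01.
  + by apply: cvg_at_left_filter; apply: dGc; rewrite lexx ler01.
- move=> t; rewrite in_itv/= => /andP[t0 t1]; rewrite derive1E.
  by case: (dG t); rewrite ?ltW.
Qed.

End Leibniz.

(** One-forms are encoded as columns, so that the transpose of an endomorphism acts on them by
    multiplication on the left. *)
Definition pairing {R : realType} {n : nat} (v : 'rV[R]_n) (w : 'cV[R]_n) : R :=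
  (v *m w) 0 0.

Section Pairing.
Context {R : realType} {n : nat}.
Local Notation vec := 'rV[R]_n.
Local Notation smoothR := (@smooth_on R n R^o).

Lemma pairingDl (u v : vec) w : pairing (u + v) w = pairing u w + pairing v w.
Proof. by rewrite /pairing mulmxDl mxE. Qed.
Lemma pairingDr (u : vec) v w : pairing u (v + w) = pairing u v + pairing u w.
Proof. by rewrite /pairing mulmxDr mxE. Qed.
Lemma pairingZl a (u : vec) w : pairing (a *: u) w = a * pairing u w.
Proof. by rewrite /pairing -scalemxAl mxE. Qed.
Lemma pairingZr a (u : vec) w : pairing u (a *: w) = a * pairing u w.
Proof. by rewrite /pairing -scalemxAr mxE. Qed.
Lemma pairingNl (u : vec) w : pairing (- u) w = - pairing u w.
Proof. by rewrite /pairing mulNmx mxE. Qed.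
Lemma pairingNr (u : vec) w : pairing u (- w) = - pairing u w.
Proof. by rewrite /pairing mulmxN mxE. Qed.
Lemma pairing0l (w : 'cV[R]_n) : pairing 0 w = 0.
Proof. by rewrite /pairing mul0mx mxE. Qed.
Lemma pairingE (u : vec) w : pairing u w = \sum_i u 0 i * w i 0.
Proof. by rewrite /pairing mxE. Qed.

Lemma pairing_sumr (I : Type) (r : seq I) (P : pred I) (u : vec) F :
  pairing u (\sum_(i <- r | P i) F i) = \sum_(i <- r | P i) pairing u (F i).
Proof. by rewrite /pairing mulmx_sumr summxE. Qed.

Lemma pairing_suml (I : Type) (r : seq I) (P : pred I) (F : I -> vec) w :
  pairing (\sum_(i <- r | P i) F i) w = \sum_(i <- r | P i) pairing (F i) w.
Proof. by rewrite /pairing mulmx_suml summxE. Qed.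

Lemma pairing_bound (u : vec) w : `|pairing u w| <= n%:R * `|u| * `|w|.
Proof.
rewrite pairingE; apply: le_trans (ler_norm_sum _ _ _) _.
apply: (@le_trans _ _ (\sum_(i < n) `|u| * `|w|)).
  by apply: ler_sum => i _; rewrite normrM ler_pM// mx_norm_entry.
by rewrite sumr_const card_ord -[leLHS]mulr_natl mulrA.
Qed.

Lemma smooth_pairing U (X : vec -> vec) (w : vec -> 'cV[R]_n) : open U ->
  smooth_on U X -> smooth_on U w -> smoothR U (fun z => pairing (X z) (w z)).
Proof.
by move=> oU sX sw; have /(smooth_mxP _ oU) := smooth_mulmx oU sX sw; exact.
Qed.

Lemma diffable_pairing {V : normedModType R} (X : V -> vec) (w : V -> 'cV[R]_n) x :
  differentiable X x -> differentiable w x ->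
  differentiable (fun z => pairing (X z) (w z) : R^o) x.
Proof.
by move=> dX dw; have /differentiable_mxP := diffable_mulmx dX dw; exact.
Qed.

Lemma derive_pairing {V : normedModType R} (X : V -> vec) (w : V -> 'cV[R]_n) x v :
  differentiable X x -> differentiable w x ->
  'D_v (fun z => pairing (X z) (w z) : R^o) x
  = pairing ('D_v X x) (w x) + pairing (X x) ('D_v w x).
Proof.
move=> dX dw; rewrite -derive_mxE; last exact: diffable_mulmx.
by rewrite derive_mulmx// mxE.
Qed.

Lemma smooth_primitive U (h : vec -> R) (w : vec -> 'cV[R]_n) : open U ->
  (forall x, U x -> differentiable (h : vec -> R^o) x) ->
  (forall x v, U x -> 'D_v (h : vec -> R^o) x = pairing v (w x)) ->
  smooth_on U w -> smoothR U h.
Proof.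
move=> oU dh Dh sw [|k].
  by move=> x Ux; apply: differentiable_continuous; exact: dh.
split=> // i.
have s := smooth_pairing oU (smooth_cst U (delta_mx 0 i : vec)) sw.
by apply: Ck_ext (s k) => // x Ux; rewrite Dh.
Qed.

(** The mean value theorem on the segment from x to x + k writes the remainder as the pairing of k
    with a difference of values of [w], which is small by continuity at [x]. *)
Lemma differentiable_of_directional U (h : vec -> R) (w : vec -> 'cV[R]_n) x :
  open U -> U x -> {for x, continuous w} ->
  (forall y v, U y -> is_derive y v (h : vec -> R^o) (pairing v (w y))) ->
  differentiable (h : vec -> R^o) x.
Proof.
move=> oU Ux cw Dh.
pose L (v : vec) : R^o := pairing v (w x).
have lL : linear L by move=> a u v; rewrite /L pairingDl pairingZl.
pose LL : {linear vec -> R^o} := HB.pack L (GRing.isLinear.Build _ _ _ _ _ lL).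
have cL : continuous LL.
  move=> v; apply: (@smooth_cont _ _ R^o setT) => //.
  apply: smooth_pairing; [exact: openT|exact/smooth_id/openT|exact: smooth_cst].
suff key e : 0 < e -> \forall k \near (0 : vec),
    `|(h : vec -> R^o) (k + x) - h x - LL k| <= e * `|k|.
  by case: (is_diff_eps cL key).
(* The n is the constant of [pairing_bound]; the summand 1 keeps [N] positive when n = 0. *)
move=> e0; pose N : R := n%:R + 1; have N0 : 0 < N by rewrite ltr_wpDl.
have /cvgrPdist_lt /(_ _ (divr_gt0 e0 N0)) near1 := cw.
have [r /= r0 H] := (nbhs_ballP _ _).1 (filterI (open_near oU Ux) near1).
apply/nbhs_ballP; exists r => //= k; rewrite -ball_normE/= sub0r normrN => kr.
have inb (s : R) : 0 <= s <= 1 -> ball x r (x + s *: k).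
  move=> /andP[s0 s1]; rewrite -ball_normE/= opprD addNKr normrN normrZ ger0_norm//.
  by apply: le_lt_trans kr; rewrite ler_piMl.
pose g (s : R) : R := h (x + s *: k) - s * pairing k (w x).
have dg (s : R) : 0 <= s <= 1 -> is_derive s (1 : R) (g : R -> R^o)
    (pairing k (w (x + s *: k)) - pairing k (w x)).
  move=> s01; apply: is_deriveB.
    exact: (is_derive_line (Dh _ _ (H _ (inb s s01)).1)).
  exact: is_derive_mulr.
have [c c01] := mvt0 ltr01 dg.
rewrite /g scale1r scale0r addr0 mul1r mul0r subr0 mulr1 => E.
rewrite /LL/= /L [k + x]addrC addrAC {}E -pairingNr -pairingDr.
have [_ /= H2] := H _ (inb c c01).
apply: le_trans (pairing_bound _ _) _.
rewrite [n%:R * _]mulrC -mulrA mulrC ler_wpM2r//.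
apply: (@le_trans _ _ (N * (e / N))); last by rewrite mulrC divfK ?gt_eqF.
rewrite distrC; apply: ler_pM => //; last exact: ltW.
by rewrite /N lerDl.
Qed.

End Pairing.

Section Poincare.
Context {R : realType} {n : nat}.
Local Notation vec := 'rV[R]_n.
Local Notation smoothR := (@smooth_on R n R^o).

Lemma is_derive_of_line (f : vec -> R) x v (d : R) :
  is_derive (0 : R) (1 : R) (fun s : R => f (x + s *: v) : R^o) d ->
  is_derive x v (f : vec -> R^o) d.
Proof.
case=> df <-.
have E : (fun h : R => h^-1 *: ((f (x + (h *: 1 + 0) *: v) : R^o) - f (x + 0 *: v)))
    = (fun h : R => h^-1 *: ((f (h *: v + x) : R^o) - f x)).
  apply/funext => h; rewrite scale0r !addr0 [h *: 1]mulr1.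
  by rewrite [x + _]addrC.
apply: DeriveDef; last by rewrite /derive /= /shift -E.
by have := df; rewrite /derivable /= /shift -E.
Qed.

Lemma derive_subc (c x v : vec) : 'D_v (fun z => z - c) x = v.
Proof. by rewrite derive_sub// derive_id (derive_cst c x v) subr0. Qed.

Lemma diffable_homothety (c x : vec) (t : R) :
  differentiable (fun z => c + t *: (z - c)) x.
Proof. by apply: differentiableD => //; apply: differentiableZ. Qed.

Lemma derive_homothety (c x v : vec) (t : R) :
  'D_v (fun z => c + t *: (z - c)) x = t *: v.
Proof.
have d0 : differentiable (fun z => z - c) x by [].
have d1 : differentiable (fun z => t *: (z - c)) x by apply: differentiableZ.
rewrite derive_add// (derive_cst c x v) add0r.
by rewrite (deriveZ t (diff_derivable d0)) derive_subc.
Qed.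

(** Supplies the constants that dominate the integrand's derivative in the Poincare lemma. *)
Lemma bounded_on_closed_ball (c : vec) r p q (g : vec -> 'M[R]_(p, q)) : 0 <= r ->
  (forall z, `|z - c| <= r -> {for z, continuous g}) ->
  exists2 C, 0 <= C & forall z, `|z - c| <= r -> `|g z| <= C.
Proof.
move=> r0 cg; pose K := [set z : vec | `|z - c| <= r].
have cK : compact K.
  apply: bounded_closed_compact.
    exists (`|c| + r); split; first by rewrite num_real.
    move=> M cM z Kz; apply: le_trans (ltW cM).
    by rewrite -[z](subrK c) addrC; apply: le_trans (ler_normD _ _) _; rewrite lerD2l.
  have -> : K = (fun z : vec => `|z - c|) @^-1` [set y | y <= r] by [].
  apply: closed_comp; last exact: closed_le.
  move=> z _; apply: (@continuous_comp _ _ _ (fun z : vec => z - c) (fun z : vec => `|z| : R) z).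
    by apply: continuousB; [exact: cvg_id|exact: cst_continuous].
  exact: norm_continuous.
have K0 : K !=set0 by exists c; rewrite /K/= subrr normr0.
have cgK : {within K, continuous (fun z => `|g z| : R)}.
  apply: continuous_in_subspaceT => z; rewrite inE => Kz.
  apply: (@continuous_comp _ _ _ g (fun M : 'M[R]_(p, q) => `|M| : R) z); first exact: cg.
  exact: norm_continuous.
have [z Kz zmax] := EVT_max_rV K0 cK cgK.
by exists `|g z| => // y Ky; apply: zmax; rewrite inE.
Qed.

(* The primitive is the integral of the form along the segment from the centre. *)
Lemma poincare (c : vec) (r : R) (w : vec -> 'cV[R]_n) : 0 < r ->
  smooth_on (ball c r) w ->
  (forall x u v, ball c r x -> pairing v ('D_u w x) = pairing u ('D_v w x)) ->
  exists h : vec -> R, smoothR (ball c r) h /\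
    forall x v, ball c r x -> 'D_v (h : vec -> R^o) x = pairing v (w x).
Proof.
move=> r0 sw clw; have oB : open (ball c r) by exact: ball_open.
pose F t z := pairing (z - c) (w (c + t *: (z - c))).
pose h z := \int[@lebesgue_measure R]_(t in `[0, 1]) F t z.
(* Directional derivatives suffice: continuity of [w] upgrades them to differentiability, and then
   dh = w gives smoothness. *)
suff Dh y v : ball c r y -> is_derive y v (h : vec -> R^o) (pairing v (w y)).
  have dh x : ball c r x -> differentiable (h : vec -> R^o) x.
    by move=> bx; apply: (differentiable_of_directional oB bx _ Dh); exact: smooth_cont sw bx.
  have Dh' x v : ball c r x -> 'D_v (h : vec -> R^o) x = pairing v (w x).
    by move=> /(Dh _ v) [].
  by exists h; split=> //; exact: smooth_primitive oB dh Dh' sw.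
rewrite -ball_normE/= distrC => yr.
(* A radius strictly between |y - c| and r: the closed ball of radius [r'] is compact, lies in the
   open ball, and contains y + s v for |s| < e. *)
pose r' := (`|y - c| + r) / 2.
have yr' : `|y - c| < r' by rewrite midf_lt.
have r'r : r' < r by rewrite midf_lt.
have r'0 : 0 <= r' by apply: ltW; apply: le_lt_trans yr'.
have v0 : 0 < `|v| + 1 by rewrite ltr_wpDl.
pose e := (r' - `|y - c|) / (`|v| + 1); have e0 : 0 < e by rewrite divr_gt0// subr_gt0.
have inX (s : R) : `|s| < e -> `|y + s *: v - c| <= r'.
  move=> se; rewrite addrAC; apply: le_trans (ler_normD _ _) _.
  rewrite -lerBrDl normrZ; apply: (@le_trans _ _ (e * (`|v| + 1))).
    by rewrite ler_pM// ?ltW// ltrDl.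
  by rewrite /e divfK// gt_eqF.
have inK (s t : R) : `|s| < e -> 0 <= t <= 1 -> `|c + t *: (y + s *: v - c) - c| <= r'.
  move=> se /andP[t0 t1]; rewrite addrC addKr normrZ ger0_norm//.
  by apply: le_trans (inX s se); rewrite ler_piMl.
have inB (s t : R) : `|s| < e -> 0 <= t <= 1 -> ball c r (c + t *: (y + s *: v - c)).
  by move=> se t1; rewrite -ball_normE/= distrC; apply: le_lt_trans (inK s t se t1) r'r.
have KB z : `|z - c| <= r' -> ball c r z.
  by move=> zr; rewrite -ball_normE/= distrC; apply: le_lt_trans r'r.
have [C1 C10 wC1] := bounded_on_closed_ball r'0 (fun z zr => smooth_cont sw (KB z zr)).
have sDw := smooth_derive_cst v oB sw.
have [C2 C20 wC2] := bounded_on_closed_ball r'0 (fun z zr => smooth_cont sDw (KB z zr)).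
have dw z : ball c r z -> differentiable w z by exact: smooth_diff.
pose df s t := pairing v (w (c + t *: (y + s *: v - c)))
  + pairing (y + s *: v - c) (t *: 'D_v w (c + t *: (y + s *: v - c))).
have abs0 : `|0 : R| < e by rewrite normr0.
apply: is_derive_of_line.
have -> : pairing v (w y) = 1 * pairing v (w (c + 1 *: (y - c)))
   - 0 * pairing v (w (c + 0 *: (y - c))).
  by rewrite mul0r subr0 mul1r scale1r [c + _]addrC subrK.
(* [G] is an antiderivative of [df 0]: its derivative contains t times the pairing of v with 'D_(y -
   c) w, and closedness exchanges v and y - c. Its increment over [0, 1] is the pairing of v with w
   y. *)
pose G (t : R) := t * pairing v (w (c + t *: (y - c))).
have dF s t : `|s| < e -> 0 <= t <= 1 ->
    differentiable (F t : vec -> R^o) (y + s *: v).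
  move=> se t1; apply: diffable_pairing => //.
  apply: (differentiable_comp (diffable_homothety c _ t)).
  by apply: dw; exact: inB.
apply: (@leibniz_rule01 R (fun s t => F t (y + s *: v)) df G e
  (n%:R * `|v| * C1 + n%:R * r' * C2)) => //.
- move=> s t se t1; apply: is_derive_eq; first exact: line_is_derive (dF s t se t1).
  have dwP : differentiable w (c + t *: (y + s *: v - c)) by apply: dw; exact: inB.
  have dhP := diffable_homothety c (y + s *: v) t.
  have dcP : differentiable (fun z => z - c) (y + s *: v) by [].
  have := derive_pairing v dcP (differentiable_comp dhP dwP).
  rewrite derive_subc (derive_comp v dhP dwP) derive_homothety.
  by rewrite -[t *: v]addr0 (derive_lin _ _ _ dwP) derive0 addr0; exact.
- move=> s t se t1; apply: le_trans (ler_normD _ _) _; apply: lerD.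
    apply: le_trans (pairing_bound _ _) _; rewrite ler_wpM2l ?mulr_ge0//.
    by apply: wC1; exact: inK.
  apply: le_trans (pairing_bound _ _) _; apply: ler_pM => //.
  + by rewrite ler_wpM2l//; exact: inX.
  + rewrite normrZ; have /andP[t0 t1'] := t1; rewrite ger0_norm//.
    by apply: le_trans (wC2 _ (inK s t se t1)); rewrite ler_piMl.
- move=> s t se t1.
  have L : differentiable (fun t : R => c + t *: (y + s *: v - c)) t.
    by apply: differentiableD => //; apply: differentiableZl.
  apply: (@differentiable_continuous _ _ R^o); apply: diffable_pairing => //.
  by apply: (differentiable_comp L); apply: dw; exact: inB.
- move=> t t1.
  have dwP : differentiable w (c + t *: (y - c)).
    by apply: dw; have := inB 0 t abs0 t1; rewrite scale0r addr0.
  have dpw := diffable_pairing (differentiable_cst v (c + t *: (y - c))) dwP.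
  apply: is_derive_eq.
    exact: (is_derive_mul_id (line_is_derive (f := fun z => pairing v (w z) : R^o) dpw)).
  rewrite (derive_pairing _ (differentiable_cst v _) dwP) (derive_cst v _ _) pairing0l.
  have -> : df 0 t = pairing v (w (c + t *: (y - c)))
      + t * pairing (y - c) ('D_v w (c + t *: (y - c))).
    by rewrite /df scale0r addr0 pairingZr.
  congr (_ + _ * _); apply: (etrans (add0r _)).
  by apply: clw; have := inB 0 t abs0 t1; rewrite scale0r addr0.
- move=> t t1; rewrite /df scale0r addr0.
  have L : differentiable (fun t : R => c + t *: (y - c)) t.
    by apply: differentiableD => //; apply: differentiableZl.
  have bP : ball c r (c + t *: (y - c)).
    by have := inB 0 t abs0 t1; rewrite scale0r addr0.
  have dDwP := smooth_diff sDw bP.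
  apply: (@differentiable_continuous _ _ R^o); apply: differentiableD.
    by apply: diffable_pairing => //; apply: (differentiable_comp L); exact: dw.
  apply: diffable_pairing => //; apply: diffable_scal => //.
  exact: (differentiable_comp L dDwP).
Qed.

End Poincare.

(** * Inverse function theorem *)

Section Jacobian.
Context {R : realType} {n : nat}.
Local Notation vec := 'rV[R]_n.

Lemma mulmx_bound p q s (M : 'M[R]_(p, q)) (N : 'M[R]_(q, s)) :
  `|M *m N| <= q%:R * `|M| * `|N|.
Proof.
apply: mx_norm_le => [|i j]; first by rewrite !mulr_ge0.
rewrite mxE; apply: le_trans (ler_norm_sum _ _ _) _.
apply: (@le_trans _ _ (\sum_(k < q) `|M| * `|N|)).
  by apply: ler_sum => k _; rewrite normrM ler_pM// mx_norm_entry.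
by rewrite sumr_const card_ord -[leLHS]mulr_natl mulrA.
Qed.

Lemma derive_jac (f : vec -> vec) x v :
  differentiable f x -> 'D_v f x = v *m 'J f x.
Proof. exact: deriveEjacobian. Qed.

Lemma diff_jac (f : vec -> vec) x v : 'd f x v = v *m 'J f x.
Proof. by rewrite /jacobian mul_rV_lin1. Qed.

Lemma smooth_jac U (f : vec -> vec) : open U -> smooth_on U f ->
  smooth_on U (fun x => 'J f x).
Proof.
move=> oU sf; apply/smooth_mxP => // i j.
have /(smooth_mxP _ oU)/(_ 0 j) := smooth_derive_cst (delta_mx 0 i : vec) oU sf.
apply: smooth_ext => // x Ux.
rewrite (derive_jac _ (smooth_diff sf Ux)).
by rewrite -rowE mxE.
Qed.

(** The intermediate point depends on the entry, which is harmless for the maximum norm. *)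
Lemma mvt_norm p q (F : vec -> 'M[R]_(p, q)) (x y : vec) C : 0 <= C ->
  (forall s : R, 0 <= s <= 1 -> differentiable F (y + s *: (x - y))) ->
  (forall s : R, 0 <= s <= 1 -> `|'D_(x - y) F (y + s *: (x - y))| <= C) ->
  `|F x - F y| <= C.
Proof.
move=> C0 dF DF; apply: mx_norm_le => // i j; rewrite !mxE.
have dg (s : R) : 0 <= s <= 1 -> is_derive s (1 : R)
    (fun s : R => F (y + s *: (x - y)) i j : R^o)
    ('D_(x - y) F (y + s *: (x - y)) i j).
  move=> s01; rewrite derive_mxE; last exact: dF.
  apply: (@line_is_derive _ _ R^o (fun z => F z i j)).
  by have /differentiable_mxP := dF s s01; exact.
have [c c01] := mvt0 ltr01 dg.
rewrite scale1r scale0r addr0 mulr1 [y + _]addrC subrK => ->.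
by apply: le_trans (DF c c01); exact: mx_norm_entry.
Qed.

End Jacobian.

(* [A] inverts the differential at [x0], so [F x = x - phi x *m A] is 1/2-Lipschitz
   near [x0], and [phi x = y] is the fixed point equation [x = F x + y *m A]. *)
Section InverseFunction.
Context {R : realType} {n : nat}.
Local Notation vec := 'rV[R]_n.
Variables (V : set vec) (phi : vec -> vec) (x0 : vec) (A : 'M[R]_n).
Hypotheses (oV : open V) (Vx0 : V x0) (sphi : smooth_on V phi)
  (uJ : forall x, V x -> 'J phi x \in unitmx)
  (JA : 'J phi x0 *m A = 1%:M) (uA : A \in unitmx).

Let F x := x - phi x *m A.

Let dphi x : V x -> differentiable phi x.
Proof. exact: smooth_diff. Qed.

Let dF x : V x -> differentiable F x.
Proof.
move=> /dphi dx; apply: differentiableB => //.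
by apply: diffable_mulmx => //; exact: differentiable_cst.
Qed.

Let DF x v : V x -> 'D_v F x = v *m (1%:M - 'J phi x *m A).
Proof.
move=> /dphi dx; rewrite derive_sub//; last first.
  by apply: diffable_mulmx => //; exact: differentiable_cst.
by rewrite derive_id derive_mulmxl// derive_jac// mulmxBr mulmx1 mulmxA.
Qed.

(** The factor n is the constant of [mulmx_bound]; with it the differential of [F] is bounded by 1/2
    for the maximum norm. *)
Let contraction_radius : exists2 r, 0 < r &
  forall x, `|x - x0| <= r -> V x /\ n%:R * `|1%:M - 'J phi x *m A| <= 2^-1.
Proof.
have [G GE] : exists G, G = fun x => 1%:M - 'J phi x *m A by eexists.
have G0 : G x0 = 0 by rewrite GE JA subrr.
have cG : {for x0, continuous G}.
  rewrite GE; apply: (@smooth_cont _ _ _ V) => //; apply: smoothB => //; first exact: smooth_cst.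
  by apply: smooth_mulmx => //; [exact: smooth_jac|exact: smooth_cst].
pose N : R := n%:R + 1; have N0 : 0 < N by rewrite ltr_wpDl.
have e0 : 0 < 2^-1 / N by rewrite divr_gt0.
have /cvgrPdist_lt /(_ _ e0) near1 := cG.
have [r /= r0 H] := (nbhs_ballP _ _).1 (filterI (open_near oV Vx0) near1).
exists (r / 2) => [|x xr]; first by rewrite divr_gt0.
have [|Vx /=] := H x.
  rewrite -ball_normE/= distrC; apply: le_lt_trans xr _.
  by rewrite ltr_pdivrMr// mulr_natr mulr2n ltrDl.
rewrite G0 sub0r normrN GE => /ltW Jx; split=> //.
apply: (@le_trans _ _ (N * (2^-1 / N))); last by rewrite mulrC divfK ?gt_eqF.
by apply: ler_pM => //; rewrite /N lerDl.
Qed.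

Lemma inverse_function_aux : exists (O : set vec) (psi : vec -> vec),
  [/\ open O, O x0, O `<=` V, open (phi @` O) &
   (forall x, O x -> psi (phi x) = x) /\ smooth_on (phi @` O) psi].
Proof.
have [r r0 rP] := contraction_radius.
pose K := [set x | `|x - x0| <= r].
have Kconv x y (s : R) : K x -> K y -> 0 <= s <= 1 -> K (y + s *: (x - y)).
  move=> Kx Ky /andP[s0 s1]; rewrite /K/=.
  have -> : y + s *: (x - y) - x0 = (1 - s) *: (y - x0) + s *: (x - x0).
    by apply/rowP => j; rewrite !mxE; ring.
  apply: le_trans (ler_normD _ _) _; rewrite !normrZ ger0_norm ?subr_ge0//.
  rewrite (ger0_norm s0).
  have -> : r = (1 - s) * r + s * r by rewrite -mulrDl subrK mul1r.
  by rewrite lerD// ler_wpM2l// subr_ge0.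
have Flip x y : K x -> K y -> `|F x - F y| <= 2^-1 * `|x - y|.
  move=> Kx Ky; apply: mvt_norm => [|s s01|s s01].
  - by rewrite mulr_ge0.
  - by apply: dF; have [] := rP _ (Kconv x y s Kx Ky s01).
  have [Vz Jz] := rP _ (Kconv x y s Kx Ky s01).
  rewrite DF//; apply: le_trans (mulmx_bound _ _) _.
  by rewrite mulrAC ler_wpM2r.
have FE x : x = F x + phi x *m A by rewrite subrK.
have Kx0 : K x0 by rewrite /K/= subrr normr0 ltW.
(* For y in [W] the map x -> F x + y A sends [K] into the open ball: its distance to x0 is at most
   |F x - F x0| + |(y - phi x0) A| < r/2 + r/2. *)
pose W := [set y | `|(y - phi x0) *m A| < r / 2].
have oW : open W.
  have -> : W = (fun y : vec => `|(y - phi x0) *m A| : R) @^-1` [set t : R | t < r / 2] by [].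
  apply: open_comp; last exact: open_lt.
  move=> y _; apply: (@continuous_comp vec vec R (fun y : vec => (y - phi x0) *m A)
    (fun M : vec => `|M| : R) y); last exact: norm_continuous.
  apply: differentiable_continuous; apply: diffable_mulmx => //.
have sol y : W y -> exists2 p, `|p - x0| < r & phi p = y.
  move=> Wy; pose T x := F x + y *m A.
  have Tball x : K x -> `|T x - x0| < r.
    move=> Kx; have -> : T x - x0 = (F x - F x0) + (y - phi x0) *m A.
      by rewrite [in LHS](FE x0) /T mulmxBl addrACA opprD.
    rewrite (splitr r); apply: le_lt_trans (ler_normD _ _) _; apply: ler_ltD => //.
    by apply: le_trans (Flip x x0 Kx Kx0) _; rewrite mulrC ler_wpM2r.
  have TK : {homo T : x / K x >-> K x} by move=> x Kx; apply/ltW/Tball.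
  have cT : is_contraction (mkfun_fun TK).
    exists 2^-1%:nng; split; first by rewrite /= invf_lt1// ltr1n.
    move=> [x z] [/= Kx Kz]; rewrite /mkfun/T/= opprD addrACA subrr addr0.
    exact: Flip.
  have clK : closed K.
    have -> : K = (fun z : vec => `|z - x0|) @^-1` [set t | t <= r] by [].
    apply: closed_comp; last exact: closed_le.
    move=> z _; apply: (@continuous_comp _ _ _ (fun z : vec => z - x0) (fun z : vec => `|z| : R) z).
      by apply: continuousB; [exact: cvg_id|exact: cst_continuous].
    exact: norm_continuous.
  pose X : completeNormedModType R :=
    HB.pack vec (Uniform_isComplete.Build vec (@cauchy_cvg _)).
  have [p Kp pE] := @banach_fixed_point R X K (mkfun_fun TK) cT clK (ex_intro _ x0 Kx0).
  have {}pE : p = T p by [].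
  exists p; first by rewrite pE; exact: Tball.
  have : phi p *m A = y *m A by apply: (addrI (F p)); rewrite -FE.
  by move/(congr1 (mulmx ^~ (invmx A))); rewrite !mulmxK.
have KV x : K x -> V x by move=> Kx; have [] := rP _ Kx.
(* Intersecting with the preimage of [W] makes the image exactly [W], already known to be open. *)
pose O := [set x | `|x - x0| < r /\ W (phi x)].
have OK x : O x -> K x by case=> xr _; exact: ltW.
have imO : phi @` O = W.
  apply/seteqP; split=> [_ [x [_ Wx] <-]//|y Wy].
  by have [p pr py] := sol y Wy; exists p => //; split; rewrite ?py.
have injO x y : O x -> O y -> phi x = phi y -> x = y.
  move=> /OK Kx /OK Ky pxy; have := Flip x y Kx Ky.
  rewrite /F pxy opprB addrA subrK => H; apply/eqP; rewrite -subr_eq0 -normr_le0.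
  by lra.
have OV x : O x -> V x by move=> /OK/KV.
have oO : open O.
  rewrite openE => x [xr Wx]; rewrite /interior; apply: filterI.
    apply/nbhs_ballP; exists (r - `|x - x0|); first by rewrite /= subr_gt0.
    move=> y; rewrite -ball_normE/= => xy.
    rewrite -[y](subrK x) -addrA; apply: le_lt_trans (ler_normD _ _) _.
    by rewrite -ltrBrDr distrC.
  have cp : {for x, continuous phi}.
    by apply: smooth_cont sphi _; apply: KV; exact: ltW.
  exact: (cp _ (open_near oW Wx)).
pose psi y := xget x0 [set x | O x /\ phi x = y].
have psiP y : W y -> O (psi y) /\ phi (psi y) = y.
  rewrite -imO => -[x Ox xy].
  by apply: (@xgetPex _ x0 [set x | O x /\ phi x = y]); exists x.
have psiK x : O x -> psi (phi x) = x.
  move=> Ox; have [|O' E] := psiP (phi x); first by case: Ox.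
  exact: injO.
(* Subtract x = F x + phi x A at the two points and absorb half of the left-hand side. *)
have psi_lip y z : W y -> W z -> `|psi y - psi z| <= 2 * `|(y - z) *m A|.
  move=> /psiP[Oy py] /psiP[Oz pz]; have := Flip _ _ (OK _ Oy) (OK _ Oz).
  have : `|psi y - psi z| <= `|F (psi y) - F (psi z)| + `|(y - z) *m A|.
    by rewrite {1}(FE (psi y)) {1}(FE (psi z)) py pz opprD addrACA -mulmxBl ler_normD.
  by lra.
have psi_diff y : W y -> differentiable psi y /\
    (forall v, 'D_v psi y = v *m invmx ('J phi (psi y))).
  move=> Wy; have [Ox pxy] := psiP y Wy; set x := psi y.
  have dx := dphi (OV _ Ox); have ux := uJ (OV _ Ox).
  pose B := invmx ('J phi x).
  have cB : continuous (mulmxr B : vec -> vec).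
    move=> v; apply: (@smooth_cont _ _ _ setT) => //; apply: smooth_mulmx.
    - exact: openT.
    - exact/smooth_id/openT.
    - exact: smooth_cst.
  have key e : 0 < e -> \forall k \near (0 : vec),
      `|psi (k + y) - psi y - mulmxr B k| <= e * `|k|.
    (* [C] is a Lipschitz constant of [psi]. A remainder of [phi] of relative size e / D becomes one
       of [psi] of relative size at most (e / D) C n |B|, which is at most e by the choice of
       [D]. *)
    move=> e0; pose C : R := 2 * (n%:R * `|A|); have C0 : 0 <= C by rewrite !mulr_ge0.
    pose D : R := C * (n%:R * `|B|) + 1; have D0 : 0 < D by rewrite ltr_wpDl// !mulr_ge0.
    have [d /= d0 dP] := (nbhs_ballP _ _).1 (differentiable_eps dx (divr_gt0 e0 D0)).
    have nW : \forall k \near (0 : vec), W (k + y).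
      have := open_near oW Wy; rewrite (near_shift 0).
      by apply: filterS => k /=; rewrite subr0.
    have nd : \forall k \near (0 : vec), C * `|k| < d.
      apply/nbhs_ballP; exists (d / (C + 1)); first by rewrite /= divr_gt0// ltr_wpDl.
      move=> k; rewrite -ball_normE/= sub0r normrN ltr_pdivlMr ?ltr_wpDl// => kd.
      by apply: le_lt_trans kd; rewrite mulrC ler_wpM2l// lerDl.
    near=> k; have Wk : W (k + y) by near: k.
    set h := psi (k + y) - x.
    have hk : `|h| <= C * `|k|.
      apply: le_trans (psi_lip _ _ Wk Wy) _; rewrite addrK /C -mulrA ler_wpM2l//.
      by apply: le_trans (mulmx_bound _ _) _; rewrite mulrAC.
    have hx : h + x = psi (k + y) by rewrite subrK.
    have hd : `|h| < d by apply: le_lt_trans hk _; near: k.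
    have := dP h; rewrite -ball_normE/= sub0r normrN => /(_ hd).
    have [_ pk] := psiP _ Wk.
    rewrite hx pk pxy addrK diff_jac => H.
    have -> : h - k *m B = - ((k - h *m 'J phi x) *m B).
      by rewrite mulmxBl mulmxK// opprB.
    rewrite normrN; apply: le_trans (mulmx_bound _ _) _.
    rewrite mulrAC; apply: (@le_trans _ _ (n%:R * `|B| * (e / D * (C * `|k|)))).
      rewrite ler_wpM2l ?mulr_ge0//; apply: le_trans H _.
      by rewrite ler_wpM2l// divr_ge0// ltW.
    have CD : C * (n%:R * `|B|) / D <= 1 by rewrite ler_pdivrMr// mul1r /D lerDl.
    have -> : n%:R * `|B| * (e / D * (C * `|k|)) = C * (n%:R * `|B|) / D * (e * `|k|).
      by ring.
    by rewrite ler_piMl// mulr_ge0// ltW.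
  have [dpsi Dpsi] := is_diff_eps cB key.
  by split=> // v; rewrite deriveE// Dpsi.
have oW' : open (phi @` O) by rewrite imO.
exists O, psi; split=> //.
  by split; rewrite ?/W/= subrr ?mul0mx normr0// divr_gt0.
(* Bootstrap: every partial derivative of [psi] is a smooth function composed with [psi], so order k
   yields order k + 1. *)
split=> //; rewrite imO; elim=> [|k IH].
  by move=> y Wy; apply: differentiable_continuous; have [] := psi_diff y Wy.
split=> [y Wy|i]; first by have [] := psi_diff y Wy.
have sB : smooth_on O (fun x => (delta_mx 0 i : vec) *m invmx ('J phi x)).
  apply: smooth_mulmx => //; first exact: smooth_cst.
  apply: smooth_invmx => //; first by move=> x /OV/uJ.
  by apply: smooth_jac => //; exact: smooth_sub sphi.
have CB : Ck k W ((fun x => (delta_mx 0 i : vec) *m invmx ('J phi x)) \o psi).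
  apply/Ck_mxP => // a b.
  apply: (@Ck_comp _ _ k W O psi (fun x => ((delta_mx 0 i : vec) *m invmx ('J phi x)) a b)) => //.
    by move=> y /psiP[].
  by move/(smooth_mxP _ oO): sB; exact.
apply: Ck_ext CB => // y Wy.
by have [_ ->] := psi_diff y Wy.
Unshelve. all: by end_near. Qed.

End InverseFunction.

Lemma inverse_function {R : realType} {n : nat} (V : set 'rV[R]_n)
    (phi : 'rV[R]_n -> 'rV[R]_n) x0 : open V -> V x0 -> smooth_on V phi ->
  (forall x, V x -> 'J phi x \in unitmx) ->
  exists (O : set 'rV[R]_n) (psi : 'rV[R]_n -> 'rV[R]_n),
  [/\ open O, O x0, O `<=` V, open (phi @` O) &
   (forall x, O x -> psi (phi x) = x) /\ smooth_on (phi @` O) psi].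
Proof.
move=> oV Vx0 sphi uJ; have u0 := uJ x0 Vx0.
apply: (inverse_function_aux (A := invmx ('J phi x0)) oV Vx0 sphi uJ).
  exact: mulmxV.
by rewrite unitmx_inv.
Qed.

(** * Integrating factors *)

Section ExpPrimitive.
Context {R : realType} {n : nat}.
Local Notation vec := 'rV[R]_n.
Local Notation smoothR := (@smooth_on R n R^o).

(** The equation ds = s q bootstraps: if s is of order k, so is the right-hand side, and s gains one
    order. *)
Lemma smooth_log_derivative U (s : vec -> R) (q : vec -> 'cV[R]_n) : open U ->
  (forall x, U x -> differentiable (s : vec -> R^o) x) ->
  (forall x v, U x -> 'D_v (s : vec -> R^o) x = s x * pairing v (q x)) ->
  smooth_on U q -> smoothR U s.
Proof.
move=> oU ds Ds sq; elim=> [|k IH].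
  by move=> x Ux; apply: differentiable_continuous; exact: ds.
split=> // i.
have C : @Ck R n R^o k U (fun x => s x * pairing (delta_mx 0 i) (q x)).
  apply: CkM => //; exact: (smooth_pairing oU (smooth_cst U (delta_mx 0 i : vec)) sq).
by apply: Ck_ext C => // x Ux; rewrite Ds.
Qed.

(** The exponential of the primitive is a nowhere zero solution of ds = s q; it is what rescales
    [omega] to a parallel form. *)
Lemma exp_primitive U (k : vec -> R) (q : vec -> 'cV[R]_n) : open U ->
  smoothR U k -> smooth_on U q ->
  (forall x v, U x -> 'D_v (k : vec -> R^o) x = pairing v (q x)) ->
  exists s : vec -> R, [/\ smoothR U s, (forall x, s x != 0) &
    forall x v, U x -> 'D_v (s : vec -> R^o) x = s x * pairing v (q x)].
Proof.
move=> oU sk sq Dk; pose s x := expR (k x).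
have dE (y : R) : differentiable (expR : R^o -> R^o) y.
  by apply/derivable1_diffP; exact: derivable_expR.
have ds x : U x -> differentiable (s : vec -> R^o) x.
  by move=> Ux; apply: (differentiable_comp (smooth_diff sk Ux)); exact: dE.
have Ds x v : U x -> 'D_v (s : vec -> R^o) x = s x * pairing v (q x).
  move=> Ux; rewrite (derive_comp v (smooth_diff sk Ux) (dE (k x))) Dk//.
  set a := pairing _ _; have -> : a = a *: (1 : R^o) by rewrite [_ *: _]mulr1.
  rewrite deriveE; last exact: dE.
  rewrite linearZ -deriveE; last exact: dE.
  have -> : 'D_1 (expR : R^o -> R^o) (k x) = expR (k x).
    exact: (congr1 (fun f : R -> R => f (k x)) (derive_expR R)).
  by rewrite mulrC [a *: (1 : R^o)]mulr1.
exists s; split=> //; first exact: smooth_log_derivative Ds sq.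
by move=> x; rewrite gt_eqF// expR_gt0.
Qed.

End ExpPrimitive.

(** * The flag of distributions is parallel *)

(* [w *m Gm x v] is Gamma(v, w) at [x]. *)
Section ParallelFlag.
Context {R : realType} {m : nat}.
Local Notation n := m.+1.
Local Notation vec := 'rV[R]_n.
Variables (V : set vec) (Gm : vec -> vec -> 'M[R]_n) (e g : vec -> vec).
Hypotheses (oV : open V) (se : smooth_on V e) (sg : smooth_on V g).
Hypothesis Gm_sym : forall x v w, V x -> w *m Gm x v = v *m Gm x w.
Hypothesis Gm_smooth : forall Y, smooth_on V Y -> smooth_on V (fun x => Gm x (Y x)).

Let X k := ad e k g.
Let M x : 'M[R]_n := \matrix_(i < n) X i x.
Let N x := invmx (M x).
Hypothesis unit_frame : forall x, V x -> M x \in unitmx.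

Definition covd (v : vec) (Y : vec -> vec) x := 'D_v Y x + Y x *m Gm x v.

(* [v *m A x] is nabla_v e. *)
Let A x := 'J e x + Gm x (e x).

(* The vector [u] lies in E^k(x), read off its coordinates in the frame ad_e^i g. *)
Definition flagged k x (u : vec) := forall j : 'I_n, (k < j)%N -> (u *m N x) 0 j = 0.

(* nabla^2_{v,w} e. *)
Let cov2e x (v w : vec) := w *m 'D_v A x + w *m A x *m Gm x v - w *m Gm x v *m A x.

Hypothesis covd_g_flagged : forall x v, V x -> flagged 0 x (covd v (X 0) x).
Hypothesis cov2_e_flagged : forall x v w, V x -> flagged 1 x (cov2e x v w).

Lemma flaggedD k x u v : flagged k x u -> flagged k x v -> flagged k x (u + v).
Proof. by move=> fu fv j kj; rewrite mulmxDl mxE fu// fv// addr0. Qed.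

Lemma flaggedZ k x a u : flagged k x u -> flagged k x (a *: u).
Proof. by move=> fu j kj; rewrite -scalemxAl mxE fu// mulr0. Qed.

Lemma flaggedN k x u : flagged k x u -> flagged k x (- u).
Proof. by move=> fu; rewrite -scaleN1r; exact: flaggedZ. Qed.

Lemma flagged0 k x : flagged k x 0.
Proof. by move=> j kj; rewrite mul0mx mxE. Qed.

Lemma flagged_sum k x (I : Type) (r : seq I) (P : pred I) (F : I -> vec) :
  (forall i, P i -> flagged k x (F i)) -> flagged k x (\sum_(i <- r | P i) F i).
Proof. by move=> FP; elim/big_ind: _ => //; [exact: flagged0|exact: flaggedD]. Qed.

Lemma flaggedW k l x u : (k <= l)%N -> flagged k x u -> flagged l x u.
Proof. by move=> kl fu j lj; apply: fu; exact: leq_ltn_trans lj. Qed.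

Lemma row_frame (i : 'I_n) x : row i (M x) = X i x.
Proof. by apply/rowP => j; rewrite !mxE. Qed.

Lemma ad_coframe (i j : 'I_n) x : V x -> (X i x *m N x) 0 j = (i == j)%:R.
Proof. by move=> Vx; rewrite -row_frame -row_mul mulmxV ?unit_frame// !mxE. Qed.

Lemma flaggedX k l x : V x -> (k <= l)%N -> (k < n)%N -> flagged l x (X k x).
Proof.
move=> Vx kl kn j lj; rewrite (ad_coframe (Ordinal kn))// -val_eqE/=.
by rewrite ltn_eqF// (leq_ltn_trans kl).
Qed.

Lemma frame_decomp x u : V x -> u = \sum_(i < n) (u *m N x) 0 i *: X i x.
Proof.
move=> Vx; rewrite -{1}[u]mulmx1 -(mulVmx (unit_frame Vx)) mulmxA mulmx_sum_row.
by apply: eq_bigr => i _; rewrite row_frame.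
Qed.

Lemma smooth_ad k : smooth_on V (X k).
Proof.
elim: k => [//|k IH]; rewrite /X/ad iterS -/(X k).
by apply: smoothB => //; apply: smooth_derive.
Qed.

Lemma smooth_frame : smooth_on V M.
Proof.
apply/smooth_mxP => // i j; have /(smooth_mxP _ oV)/(_ 0 j) := smooth_ad i.
by apply: smooth_ext => // x Vx; rewrite !mxE.
Qed.

Lemma smooth_coframe : smooth_on V N.
Proof. by apply: smooth_invmx => //; exact: smooth_frame. Qed.

Lemma smooth_A : smooth_on V A.
Proof. by apply: smoothD => //; [exact: smooth_jac|exact: Gm_smooth]. Qed.

Lemma smooth_covd Y Z : smooth_on V Y -> smooth_on V Z ->
  smooth_on V (fun x => covd (Y x) Z x).
Proof.
move=> sY sZ; apply: smoothD => //; first exact: smooth_derive.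
by apply: smooth_mulmx => //; exact: Gm_smooth.
Qed.

(** Symmetry of the connection moves [v] out of [Gm], which exhibits nabla_v Y as linear in [v]. *)
Lemma covdE v Y x : V x -> differentiable Y x ->
  covd v Y x = v *m ('J Y x + Gm x (Y x)).
Proof. by move=> Vx dY; rewrite /covd derive_jac// mulmxDr Gm_sym. Qed.

Lemma covd_e x v : V x -> v *m A x = covd v e x.
Proof. by move=> Vx; rewrite covdE//; exact: smooth_diff se Vx. Qed.

Lemma ad_covd k x : V x -> X k.+1 x = covd (e x) (X k) x - X k x *m A x.
Proof.
move=> Vx; rewrite covd_e// /X/ad iterS -/(X k) /bracket /covd.
by rewrite [e x *m _]Gm_sym// opprD addrACA subrr addr0.
Qed.

Lemma covd_frame_row x v (i : 'I_n) : V x ->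
  row i ('D_v M x + M x *m Gm x v) = covd v (X i) x.
Proof.
move=> Vx; rewrite linearD/= row_mul row_frame; congr (_ + _).
have dM := smooth_diff smooth_frame Vx; have dX := smooth_diff (smooth_ad i) Vx.
apply/rowP => j; rewrite mxE !derive_mxE//; congr (derive _ x v).
by apply/funext => z; rewrite !mxE.
Qed.

(** E^k is parallel as soon as its spanning fields satisfy the flag condition: the frame coordinates
    of [Y] beyond k vanish on all of [V], hence so do their derivatives. *)
Lemma flagged_covd k x v Y : V x ->
  (forall l, (l <= k)%N -> (l < n)%N -> flagged l x (covd v (X l) x)) ->
  smooth_on V Y -> (forall z, V z -> flagged k z (Y z)) -> flagged k x (covd v Y x).
Proof.
move=> Vx Pk sY fY.
pose y z := Y z *m N z.
have sy : smooth_on V y by apply: smooth_mulmx => //; exact: smooth_coframe.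
have dy := smooth_diff sy Vx; have dM := smooth_diff smooth_frame Vx.
have YE z : V z -> y z *m M z = Y z.
  by move=> Vz; rewrite /y -mulmxA mulVmx ?unit_frame// mulmx1.
have DY : 'D_v Y x = 'D_v y x *m M x + y x *m 'D_v M x.
  rewrite -derive_mulmx//; apply/esym; apply: near_eq_derive.
  by apply: filterS (open_near oV Vx) => z /YE.
(* Leibniz rule in the frame: the derivatives of the coordinates, plus the coordinates times the
   covariant derivatives of the frame. *)
have -> : covd v Y x = 'D_v y x *m M x + y x *m ('D_v M x + M x *m Gm x v).
  by rewrite /covd DY -{1}(YE x Vx) mulmxDr -!mulmxA addrA.
have y0 z (j : 'I_n) : V z -> (k < j)%N -> y z 0 j = 0 by move=> Vz; exact: fY.
have Dy0 (j : 'I_n) : (k < j)%N -> ('D_v y x) 0 j = 0.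
  move=> kj; rewrite derive_mxE//.
  have -> : 'D_v (fun z => y z 0 j : R^o) x = 'D_v (fun=> 0 : R^o) x.
    apply: near_eq_derive; apply: filterS (open_near oV Vx) => z Vz.
    exact: y0.
  exact: (derive_cst (0 : R^o) x v).
apply: flaggedD; rewrite mulmx_sum_row; apply: flagged_sum => i _.
  case: (leqP i k) => [ik|ki]; last by rewrite Dy0// scale0r; exact: flagged0.
  by rewrite row_frame; apply: flaggedZ; exact: flaggedX.
case: (leqP i k) => [ik|ki]; last by rewrite y0// scale0r; exact: flagged0.
rewrite covd_frame_row//; apply: flaggedZ; apply: (flaggedW ik); exact: Pk.
Qed.

(** On the frame, nabla_{ad_e^i g} e = nabla_e ad_e^i g - ad_e^{i+1} g, so v -> nabla_v e raises the
    flag by exactly one step. *)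
Lemma flagged_mulmx_A k x u : V x -> (k.+1 < n)%N ->
  (forall l v, (l <= k)%N -> flagged l x (covd v (X l) x)) ->
  flagged k x u -> flagged k.+1 x (u *m A x).
Proof.
move=> Vx kn Pk fu; rewrite (frame_decomp u Vx) mulmx_suml; apply: flagged_sum => i _.
rewrite -scalemxAl; case: (leqP i k) => [ik|ki]; last first.
  by rewrite fu// scale0r; exact: flagged0.
apply: flaggedZ; have -> : X i x *m A x = covd (e x) (X i) x - X i.+1 x.
  by rewrite ad_covd// opprB addrC subrK.
apply: flaggedD; first by apply: (@flaggedW i); [exact: leqW|exact: Pk].
by apply: flaggedN; apply: flaggedX => //; exact: leq_ltn_trans kn.
Qed.

(** The defining relation nabla_v nabla_Y e = nabla^2_{v,Y} e + nabla_{nabla_v Y} e; only the value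
    of [Y] at [x] enters the first term. *)
Lemma covd_mulmx_A x v Y : V x -> differentiable Y x ->
  covd v (fun z => Y z *m A z) x = cov2e x v (Y x) + covd v Y x *m A x.
Proof.
move=> Vx dY; have dA := smooth_diff smooth_A Vx.
rewrite /covd /cov2e derive_mulmx// mulmxDl [X in _ = _ + X]addrC [RHS]addrA subrK.
by rewrite -addrA addrC.
Qed.

(* Since ad_e^{k+1} g = nabla_e ad_e^k g - nabla_{ad_e^k g} e, differentiating the last
   term produces a second covariant derivative of [e], which lies in E^1. *)
Lemma parallel_flag k x v : V x -> (k < n)%N -> flagged k x (covd v (X k) x).
Proof.
elim/ltn_ind: k x v => -[_ x v Vx _|k IH x v Vx kn]; first exact: covd_g_flagged.
have IH' l z w : V z -> (l <= k)%N -> flagged l z (covd w (X l) z).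
  by move=> Vz lk; apply: IH => //; exact: leq_ltn_trans (ltnW kn).
pose C z := covd (e z) (X k) z.
have sC : smooth_on V C by apply: smooth_covd => //; exact: smooth_ad.
have sXA : smooth_on V (fun z => X k z *m A z).
  by apply: smooth_mulmx => //; [exact: smooth_ad|exact: smooth_A].
have dX := smooth_diff (smooth_ad k) Vx.
have -> : covd v (X k.+1) x = covd v C x - covd v (fun z => X k z *m A z) x.
  rewrite {1}/covd (near_eq_derive (g := fun z => C z - X k z *m A z)); last first.
    by apply: filterS (open_near oV Vx) => z; exact: ad_covd.
  rewrite (derive_sub v (smooth_diff sC Vx) (smooth_diff sXA Vx)).
  by rewrite ad_covd// -/(C x) mulmxBl /covd opprD addrACA.
apply: flaggedD.
  apply: (flaggedW (leqnSn k)); apply: flagged_covd => //.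
    by move=> l lk _; exact: IH'.
  by move=> z Vz; exact: IH'.
apply: flaggedN; rewrite covd_mulmx_A//; apply: flaggedD.
  by apply: (@flaggedW 1); [|exact: cov2_e_flagged].
apply: flagged_mulmx_A => //; first by move=> l w lk; exact: IH'.
exact: IH'.
Qed.

Lemma pairing_ext (a b : 'cV[R]_n) : (forall u, pairing u a = pairing u b) -> a = b.
Proof.
move=> ab; apply/colP => i; have := ab (delta_mx 0 i).
by rewrite /pairing -!rowE !mxE.
Qed.

Lemma pairing_mulmx (u : vec) (B : 'M[R]_n) w : pairing (u *m B) w = pairing u (B *m w).
Proof. by rewrite /pairing mulmxA. Qed.

Lemma frame_ext x (a b : 'cV[R]_n) : V x ->
  (forall i : 'I_n, pairing (X i x) a = pairing (X i x) b) -> a = b.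
Proof.
move=> Vx ab; apply: pairing_ext => u; rewrite (frame_decomp u Vx) !pairingE.
under eq_bigr do rewrite summxE mulr_suml.
under [RHS]eq_bigr do rewrite summxE mulr_suml.
rewrite exchange_big [RHS]exchange_big/=; apply: eq_bigr => i _.
under eq_bigr do rewrite mxE -mulrA.
under [RHS]eq_bigr do rewrite mxE -mulrA.
by rewrite -!mulr_sumr -!pairingE ab.
Qed.

(** The columns of [N] form the coframe dual to the fields ad_e^i g; the last one is normalized by
    the value 1 on ad_e^m g. *)
Let omega x : 'cV[R]_n := col ord_max (N x).

Lemma pairing_omega x u : pairing u (omega x) = (u *m N x) 0 ord_max.
Proof. by rewrite /pairing /omega colE mulmxA -colE mxE. Qed.

Lemma flagged_omega k x u : (k < m)%N -> flagged k x u -> pairing u (omega x) = 0.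
Proof. by move=> km fu; rewrite pairing_omega fu. Qed.

Lemma pairing_ad_omega (i : 'I_n) x : V x -> pairing (X i x) (omega x) = (i == ord_max)%:R.
Proof. by move=> Vx; rewrite pairing_omega ad_coframe. Qed.

Lemma smooth_omega : smooth_on V omega.
Proof.
apply/smooth_mxP => // i j; have /(smooth_mxP _ oV)/(_ i ord_max) := smooth_coframe.
by apply: smooth_ext => // x Vx; rewrite mxE.
Qed.

(* [omega] annihilates E^{m-1}, a parallel distribution of corank one; [theta] is the
   connection form of the induced connection on the line bundle spanned by [omega]. *)
Let theta x : 'cV[R]_n := - (('J (X m) x + Gm x (X m x)) *m omega x).

Lemma smooth_theta : smooth_on V theta.
Proof.
apply: smoothN => //; apply: smooth_mulmx => //; last exact: smooth_omega.
apply: smoothD => //; first by apply: smooth_jac => //; exact: smooth_ad.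
by apply: Gm_smooth; exact: smooth_ad.
Qed.

Lemma pairing_theta x v : V x -> pairing v (theta x) = - pairing (covd v (X m) x) (omega x).
Proof.
move=> Vx; rewrite pairingNr -pairing_mulmx -covdE//.
exact: smooth_diff (smooth_ad m) Vx.
Qed.

(** This reads nabla_v omega = theta(v) omega. It is tested on the frame: for i < m the field
    nabla_v ad_e^i g stays in E^i, which [omega] annihilates, and i = m is the definition of
    [theta]. *)
Lemma derive_omega x v : V x ->
  'D_v omega x = Gm x v *m omega x + pairing v (theta x) *: omega x.
Proof.
move=> Vx; apply: (frame_ext Vx) => i.
have dX := smooth_diff (smooth_ad i) Vx; have dom := smooth_diff smooth_omega Vx.
have : 'D_v (fun z => pairing (X i z) (omega z) : R^o) x = 0.
  rewrite -(derive_cst ((i == ord_max)%:R : R^o) x v); apply: near_eq_derive.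
  by apply: filterS (open_near oV Vx) => z Vz; rewrite pairing_ad_omega.
rewrite derive_pairing// => /eqP; rewrite addrC addr_eq0 => /eqP ->.
rewrite pairingDr -pairing_mulmx pairingZr pairing_ad_omega// pairing_theta//.
have E : 'D_v (X i) x = covd v (X i) x - X i x *m Gm x v by rewrite /covd addrK.
rewrite E pairingDl pairingNl opprD opprK addrC; congr (_ + _).
have [im|im] := eqVneq i ord_max; first by rewrite im mulr1.
rewrite mulr0 (@flagged_omega i) ?oppr0//.
  by rewrite ltn_neqAle -ltnS ltn_ord andbT; apply: contraNneq im => im; apply/eqP/val_inj.
exact: parallel_flag.
Qed.

(** If nabla_v w = t w, the same holds for the form u -> w(nabla_u e): the extra term is w composed
    with nabla^2 e, and [w] annihilates E^1. *)
Lemma derive_mulmx_A x v (w : vec -> 'cV[R]_n) t : V x -> differentiable w x ->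
  (forall u, flagged 1 x u -> pairing u (w x) = 0) ->
  'D_v w x = Gm x v *m w x + t *: w x ->
  'D_v (fun z => A z *m w z) x = Gm x v *m (A x *m w x) + t *: (A x *m w x).
Proof.
move=> Vx dw w0 Dw; have dA := smooth_diff smooth_A Vx.
rewrite derive_mulmx// Dw mulmxDr -scalemxAr addrA; congr (_ + _).
apply: pairing_ext => u; have := w0 _ (cov2_e_flagged v u Vx).
rewrite /cov2e !pairingDl pairingNl !pairing_mulmx !pairingDr.
by move/eqP; rewrite subr_eq0 => /eqP.
Qed.

Lemma gradient_closed (f : vec -> R) (q : vec -> 'cV[R]_n) x u v :
  @smooth_on R n R^o V f -> smooth_on V q ->
  (forall z v, V z -> 'D_v (f : vec -> R^o) z = pairing v (q z)) -> V x ->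
  pairing v ('D_u q x) = pairing u ('D_v q x).
Proof.
move=> sf sq Df Vx; have dq := smooth_diff sq Vx.
suff E a b : 'D_a ('D_b (f : vec -> R^o)) x = pairing b ('D_a q x).
  by rewrite -!E (clairaut _ _ oV sf Vx).
have -> : pairing b ('D_a q x) = 'D_a (fun z => pairing b (q z) : R^o) x.
  rewrite (derive_pairing a (differentiable_cst b x) dq) (derive_cst b x a).
  by rewrite pairing0l add0r.
by apply: near_eq_derive; apply: filterS (open_near oV Vx) => z Vz; rewrite Df.
Qed.

Hypothesis m2 : (1 < m)%N.

(* With f = omega(e), closedness of df reads f dtheta = 0. Where dtheta is nonzero, f
   vanishes identically, so that the derivative of f along ad_e^{m-1} g would be
   both 0 and -1. *)
Lemma theta_closed x u v : V x -> pairing v ('D_u theta x) = pairing u ('D_v theta x).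
Proof.
move=> Vx0.
pose f z := pairing (e z) (omega z).
(* The differential of [f]: one term from nabla e, one from nabla omega = theta (x) omega. *)
pose q z := A z *m omega z + f z *: theta z.
have sf : @smooth_on R n R^o V f by apply: smooth_pairing => //; exact: smooth_omega.
have sAo : smooth_on V (fun z => A z *m omega z).
  by apply: smooth_mulmx => //; [exact: smooth_A|exact: smooth_omega].
have sfv : smooth_on V (fun z => f z *: theta z).
  by apply: smooth_scal => //; exact: smooth_theta.
have sq : smooth_on V q by exact: smoothD.
have Df z w : V z -> 'D_w (f : vec -> R^o) z = pairing w (q z).
  move=> Vz; rewrite (derive_pairing w (smooth_diff se Vz) (smooth_diff smooth_omega Vz)).
  rewrite derive_omega// pairingDr pairingZr addrA -pairing_mulmx -pairingDl -/(covd w e z).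
  by rewrite -covd_e// pairing_mulmx mulrC /q pairingDr pairingZr.
have DAo z w : V z -> 'D_w (fun z => A z *m omega z) z
    = Gm z w *m (A z *m omega z) + pairing w (theta z) *: (A z *m omega z).
  move=> Vz; apply: derive_mulmx_A => //.
  - exact: smooth_diff smooth_omega Vz.
  (* Here [omega] has to annihilate E^1, which is 1 < m. *)
  - by move=> a; exact: flagged_omega.
  - exact: derive_omega.
(* Antisymmetrizing the derivative of [q], the Christoffel terms cancel by symmetry, and the
   products of [theta] with A omega and with f theta are symmetric in u and v; f d theta is left. *)
have fd z : V z -> f z * (pairing v ('D_u theta z) - pairing u ('D_v theta z)) = 0.
  move=> Vz; have := gradient_closed u v sf sq Df Vz.
  have dAo := smooth_diff sAo Vz; have dfv := smooth_diff sfv Vz.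
  have df := smooth_diff sf Vz; have dvth := smooth_diff smooth_theta Vz.
  have Dq a : 'D_a q z = (Gm z a *m (A z *m omega z) + pairing a (theta z) *: (A z *m omega z))
      + (pairing a (q z) *: theta z + f z *: 'D_a theta z).
    by rewrite (derive_add a dAo dfv) (DAo z a Vz) (derive_scal a df dvth) (Df z a Vz).
  rewrite !Dq /q !pairingDr !pairingZr.
  rewrite -[pairing v (Gm z u *m _)]pairing_mulmx -[pairing u (Gm z v *m _)]pairing_mulmx.
  rewrite (Gm_sym u v Vz) => H.
  move: H; move: (pairing v (A z *m omega z)) (pairing u (A z *m omega z)) (pairing v (theta z))
    (pairing u (theta z)) (pairing v ('D_u theta z)) (pairing u ('D_v theta z)) (f z)
    (pairing (u *m Gm z v) (A z *m omega z)) => a1 a2 a3 a4 a5 a6 a7 a8 H.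
  have -> : a7 * (a5 - a6) = a8 + a4 * a1 + ((a2 + a7 * a4) * a3 + a7 * a5)
      - (a8 + a3 * a2 + ((a1 + a7 * a3) * a4 + a7 * a6)) by ring.
  by rewrite H subrr.
move: {Vx0} x Vx0 fd => x Vx fd.
pose d z := pairing v ('D_u theta z) - pairing u ('D_v theta z).
have [->//|vu] := eqVneq (pairing v ('D_u theta x)) (pairing u ('D_v theta x)).
have dx : d x != 0 by rewrite subr_eq0.
have sD (a b : vec) : @smooth_on R n R^o V (fun z => pairing a ('D_b theta z)).
  apply: smooth_pairing => //; first exact: smooth_cst.
  by apply: smooth_derive_cst => //; exact: smooth_theta.
have cd : {for x, continuous (d : vec -> R^o)}.
  by apply: continuousB; apply: smooth_cont (sD _ _) Vx.
have nf : \forall z \near x, f z = 0.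
  have : \forall z \near x, d z != 0.
    by have := cvgr_neq0 _ cd; apply.
  apply: filterS2 (open_near oV Vx) => z Vz dz.
  by apply/eqP; rewrite -(mulIr_eq0 _ (mulIf dz)); apply/eqP; exact: fd.
have fx : f x = 0 := nbhs_singleton nf.
have := Df x (X m.-1 x) Vx.
have -> : 'D_(X m.-1 x) (f : vec -> R^o) x = 0.
  by rewrite -(derive_cst (0 : R^o) x (X m.-1 x)); exact: near_eq_derive.
have m1 : (m.-1 < m)%N by rewrite prednK// ltnW.
rewrite /q fx scale0r addr0 -pairing_mulmx.
have -> : X m.-1 x *m A x = covd (e x) (X m.-1) x - X m x.
  by have := ad_covd m.-1 Vx; rewrite prednK ?(ltnW m2)// => ->; rewrite opprB addrC subrK.
have E1 : pairing (X m x) (omega x) = 1 by have := pairing_ad_omega ord_max Vx; rewrite eqxx.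
have E0 : pairing (covd (e x) (X m.-1) x) (omega x) = 0.
  by apply: (flagged_omega m1); apply: parallel_flag => //; exact: ltnW.
rewrite pairingDl pairingNl E0 E1 add0r => H; exfalso.
by have := oner_neq0 R; rewrite -oppr_eq0 -H eqxx.
Qed.

(** * Linearizing coordinates and feedback *)

Section Coordinates.
Variables (s : vec -> R) (h0 : vec -> R).
Hypotheses (ss : @smooth_on R n R^o V s) (s0 : forall x, s x != 0)
  (Ds : forall x v, V x -> 'D_v (s : vec -> R^o) x = s x * pairing v (- theta x)).

(* The factor [s] makes [s *: omega] parallel; its images under the transpose of [A] are
   parallel as well, except for the last one. *)
Fixpoint omega_iter j x : 'cV[R]_n := if j is j'.+1 then A x *m omega_iter j' x else s x *: omega x.

Lemma smooth_omega_iter j : smooth_on V (omega_iter j).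
Proof.
elim: j => [|j IH].
  by apply: smooth_scal => //; exact: smooth_omega.
by apply: smooth_mulmx => //; exact: smooth_A.
Qed.

(** Moved to the vector, each factor [A] raises the flag by one, and [omega] annihilates E^{m-1}. *)
Lemma flagged_omega_iter j k x u : V x -> (k + j < m)%N -> flagged k x u -> pairing u (omega_iter j x) = 0.
Proof.
move=> Vx; elim: j k u => [|j IH] k u kj fu.
  by rewrite pairingZr (@flagged_omega k) ?mulr0// -[k]addn0.
rewrite /= -pairing_mulmx; apply: (IH k.+1); first by rewrite addSnnS.
apply: flagged_mulmx_A => //.
  by rewrite ltnS; apply: leq_ltn_trans kj; rewrite leq_addr.
move=> l v lk; apply: parallel_flag => //; rewrite ltnS (leq_trans lk)//.
by rewrite ltnW// (leq_ltn_trans _ kj)// leq_addr.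
Qed.

(** Moving one [A] to the vector turns ad_e^k g into nabla_e ad_e^k g - ad_e^{k+1} g; the first term
    stays in E^k and is annihilated, the second costs a sign. *)
Lemma ad_omega_iter j k x : V x -> (k + j = m)%N -> pairing (X k x) (omega_iter j x) = (-1) ^+ j * s x.
Proof.
move=> Vx; elim: j k => [|j IH] k kj.
  have E1 : pairing (X m x) (omega x) = 1 by have := pairing_ad_omega ord_max Vx; rewrite eqxx.
  by move: kj; rewrite addn0 => ->; rewrite /= pairingZr E1 expr0 mul1r mulr1.
have kn : (k < n)%N by rewrite -kj ltnS leq_addr.
have -> : pairing (X k x) (omega_iter j.+1 x) = pairing (X k x *m A x) (omega_iter j x).
  by rewrite pairing_mulmx.
have -> : X k x *m A x = covd (e x) (X k) x - X k.+1 x.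
  by rewrite ad_covd// opprB addrC subrK.
rewrite pairingDl pairingNl (IH k.+1) ?addSnnS// (@flagged_omega_iter _ k)//.
- by rewrite exprS mulN1r mulNr add0r.
- by rewrite -kj ltn_add2l.
- exact: parallel_flag.
Qed.

(** For j = 0 the derivative of [s] cancels [theta]. The step from j to j + 1 needs [omega_iter j]
    to annihilate E^1, that is 1 + j < m, whence the bound on j. *)
Lemma derive_omega_iter j x v : (j < m)%N -> V x -> 'D_v (omega_iter j) x = Gm x v *m omega_iter j x.
Proof.
move=> jm Vx; elim: j jm => [|j IH] jm.
  have ds := smooth_diff ss Vx; have dom := smooth_diff smooth_omega Vx.
  rewrite (derive_scal v ds dom) derive_omega// Ds// pairingNr mulrN scaleNr.
  by rewrite scalerDr scalerA addrC -addrA subrr addr0 -scalemxAr.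
have := @derive_mulmx_A x v (omega_iter j) 0 Vx (smooth_diff (smooth_omega_iter j) Vx).
rewrite !scale0r !addr0; apply; last by apply: IH; exact: ltnW.
by move=> u; exact: flagged_omega_iter.
Qed.

Lemma omega_iter0_closed x u v : V x -> pairing v ('D_u (omega_iter 0) x) = pairing u ('D_v (omega_iter 0) x).
Proof.
move=> Vx; rewrite !derive_omega_iter//; try exact: ltnW.
by rewrite -!pairing_mulmx Gm_sym.
Qed.

Hypotheses (sh0 : @smooth_on R n R^o V h0)
  (Dh0 : forall x v, V x -> 'D_v (h0 : vec -> R^o) x = pairing v (omega_iter 0 x)).

(** For j <= m this is L_e^j h, written as a pairing because the differential of L_e^{j-1} h is
    [omega_iter (j-1)]. *)
Definition potential j : vec -> R := if j is j'.+1 then fun x => pairing (e x) (omega_iter j' x) else h0.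

Lemma smooth_potential j : @smooth_on R n R^o V (potential j).
Proof. by case: j => // j; apply: smooth_pairing => //; exact: smooth_omega_iter. Qed.

(** For a parallel form w the differential of w(e) is v -> w(nabla_v e), the next form in the
    sequence. *)
Lemma derive_potential j x v : (j <= m)%N -> V x ->
  'D_v (potential j : vec -> R^o) x = pairing v (omega_iter j x).
Proof.
move=> jm Vx; case: j jm => [_|j jm]; first exact: Dh0.
have de := smooth_diff se Vx; have doj := smooth_diff (smooth_omega_iter j) Vx.
rewrite [LHS](derive_pairing v de doj) derive_omega_iter// -pairing_mulmx -pairingDl.
by rewrite -/(covd v e x) -covd_e// pairing_mulmx.
Qed.

(* The potentials h, L_e h, ..., L_e^m h in reverse order: the chain of integrators then
   is the lower shift driven through the first coordinate. *)
Definition flag_chart x : vec := \row_(j < n) potential (m - j) x.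

Lemma smooth_flag_chart : smooth_on V flag_chart.
Proof.
apply/smooth_mxP => // i j; apply: smooth_ext (smooth_potential (m - j)) => // x Vx.
by rewrite mxE.
Qed.

Lemma derive_flag_chart x v (j : 'I_n) : V x -> ('D_v flag_chart x) 0 j = pairing v (omega_iter (m - j) x).
Proof.
move=> Vx; rewrite (derive_mxE _ _ _ (smooth_diff smooth_flag_chart Vx)).
rewrite -derive_potential ?leq_subr//; congr (derive _ x v).
by apply/funext => z; rewrite mxE.
Qed.

(** In the frame ad_e^i g the Jacobian is lower triangular, with diagonal entries s up to sign. *)
Lemma unit_jac_flag_chart x : V x -> 'J flag_chart x \in unitmx.
Proof.
move=> Vx; have MJ (i j : 'I_n) : (M x *m 'J flag_chart x) i j = pairing (X i x) (omega_iter (m - j) x).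
  rewrite -derive_flag_chart// (derive_jac _ (smooth_diff smooth_flag_chart Vx)) -row_frame -row_mul.
  by rewrite [RHS]mxE.
have tr : is_trig_mx (M x *m 'J flag_chart x).
  apply/is_trig_mxP => i j ij; rewrite MJ (@flagged_omega_iter _ i)//; last exact: flaggedX.
  have jm : (j <= m)%N by rewrite -ltnS.
  by rewrite addnC -ltn_subRL subKn.
have : M x *m 'J flag_chart x \in unitmx.
  rewrite unitmxE (det_trig tr) unitfE; apply/prodf_neq0 => i _.
  have im : (i <= m)%N by rewrite -ltnS.
  by rewrite MJ ad_omega_iter ?subnKC// mulf_neq0// expf_neq0// oppr_eq0 oner_eq0.
by rewrite unitmx_mul => /andP[].
Qed.

(** The coefficient of the control in the second derivative of the top potential; it equals s up to
    sign. *)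
Let gain x := pairing (X 0 x) (omega_iter m x).

(** The second time derivative of the top potential is (nabla omega_m)(y,y) + omega_m(e) + gain u,
    with omega_m for [omega_iter m]. The three feedback functions solve the equation that it be u'
    for u. *)
Definition feedback_alpha x := - (pairing (e x) (omega_iter m x) / gain x).

Definition feedback_beta x := (gain x)^-1.

(** The matrix of nabla omega_m; its column index is the direction of differentiation. *)
Let P x : 'M[R]_n :=
  \matrix_(j, k) ('D_(delta_mx 0 k : vec) (omega_iter m) x - Gm x (delta_mx 0 k) *m omega_iter m x) j 0.

(** Only the quadratic form on the diagonal matters, so [P] is replaced by its symmetric part, which
    brings in the factor 2. *)
Definition feedback_gamma x : 'M[R]_n := - (2 * gain x)^-1 *: (P x + (P x)^T).

Lemma gain_neq0 x : V x -> gain x != 0.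
Proof. by move=> Vx; rewrite /gain ad_omega_iter// mulf_neq0// expf_neq0// oppr_eq0 oner_eq0. Qed.

Lemma smooth_gain : @smooth_on R n R^o V gain.
Proof. by apply: smooth_pairing => //; exact: smooth_omega_iter. Qed.

Lemma smooth_feedback_beta : @smooth_on R n R^o V feedback_beta.
Proof. by apply: smoothV => //; [exact: gain_neq0|exact: smooth_gain]. Qed.

Lemma smooth_feedback_alpha : @smooth_on R n R^o V feedback_alpha.
Proof.
apply: smoothN => //; apply: smoothM => //; last exact: smooth_feedback_beta.
by apply: smooth_pairing => //; exact: smooth_omega_iter.
Qed.

Lemma smooth_feedback_gamma : smooth_on V feedback_gamma.
Proof.
have sP : smooth_on V P.
  apply/smooth_mxP => // j k.
  have s1 : smooth_on V (fun x => 'D_(delta_mx 0 k : vec) (omega_iter m) x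
      - Gm x (delta_mx 0 k) *m omega_iter m x).
    apply: smoothB => //; first by apply: smooth_derive_cst => //; exact: smooth_omega_iter.
    apply: smooth_mulmx => //; last exact: smooth_omega_iter.
    by apply: (Gm_smooth (Y := fun=> delta_mx 0 k)); exact: smooth_cst.
  have /(smooth_mxP _ oV)/(_ j 0) := s1.
  by apply: smooth_ext => // x Vx; rewrite [RHS]mxE.
apply: smooth_scal => //; last by apply: smoothD => //; exact: smooth_trmx.
apply: smoothN => //; apply: smoothV => //.
  by move=> x Vx; rewrite mulf_neq0 ?pnatr_eq0// gain_neq0.
by apply: smoothM => //; [exact: smooth_cst|exact: smooth_gain].
Qed.

Lemma feedback_gamma_sym x : (feedback_gamma x)^T = feedback_gamma x.
Proof. by rewrite /feedback_gamma linearZ/= linearD/= trmxK addrC. Qed.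

Lemma quadE (B : 'M[R]_n) v w : quad B v w = (v *m B *m w^T) 0 0.
Proof.
rewrite mxE /quad exchange_big/=; apply: eq_bigr => k _.
by rewrite !mxE mulr_suml; apply: eq_bigr => j _; rewrite [v 0 j * _]mulrC.
Qed.

Lemma quad_feedback_gamma x y : V x -> quad (feedback_gamma x) y y =
  - (gain x)^-1 * (pairing y ('D_y (omega_iter m) x) - pairing (y *m Gm x y) (omega_iter m x)).
Proof.
move=> Vx; have doj := smooth_diff (smooth_omega_iter m) Vx.
have tr : (y *m (P x)^T *m y^T) 0 0 = (y *m P x *m y^T) 0 0.
  by rewrite -[in LHS](trmxK (y *m (P x)^T *m y^T)) mxE !trmx_mul !trmxK mulmxA.
have PE : (y *m P x *m y^T) 0 0
    = pairing y ('D_y (omega_iter m) x) - pairing (y *m Gm x y) (omega_iter m x).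
  (* Linearity of [Gm] in its second argument is obtained from symmetry. *)
  have -> : y *m Gm x y = \sum_k y 0 k *: (y *m Gm x (delta_mx 0 k)).
    transitivity ((\sum_k y 0 k *: (delta_mx 0 k : vec)) *m Gm x y).
      by rewrite -row_sum_delta.
    rewrite mulmx_suml; apply: eq_bigr => k _.
    by rewrite -scalemxAl (Gm_sym y (delta_mx 0 k) Vx).
  have yP k : (y *m P x) 0 k = pairing y ('D_(delta_mx 0 k : vec) (omega_iter m) x)
      - pairing (y *m Gm x (delta_mx 0 k)) (omega_iter m x).
    rewrite pairing_mulmx -pairingNr -pairingDr pairingE mxE.
    by apply: eq_bigr => j _; rewrite !mxE.
  rewrite (deriveE_sum y doj) pairing_sumr pairing_suml -sumrB mxE.
  by apply: eq_bigr => k _; rewrite yP mxE pairingZl pairingZr mulrC mulrBr.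
rewrite quadE /feedback_gamma -scalemxAr -scalemxAl mxE mulmxDr mulmxDl mxE tr PE.
rewrite invfM; set q := (_ - _); rewrite -[q + q]mulr2n -[q *+ 2]mulr_natl.
by rewrite mulrA mulNr -mulrA [_ * 2]mulrC mulrA mulVf ?pnatr_eq0// mul1r.
Qed.

Definition shift_mx : 'M[R]_n := \matrix_(i, j) (i == j.+1 :> nat)%:R.

Definition unit_col : 'cV[R]_n := delta_mx 0 0.

(** For j > 0 the form [omega_iter (m - j)] is parallel and annihilates g, so only its value on e
    remains, which is coordinate j - 1. Coordinate 0 is the top potential, where the feedback
    acts. *)
Lemma normal_form x y u' : V x ->
  let u := quad (feedback_gamma x) y y + feedback_alpha x + feedback_beta x * u' in
  'D_y ('D_y flag_chart) x + 'D_(- (y *m Gm x y) + e x + u *: g x) flag_chart x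
  = flag_chart x *m shift_mx^T + u' *: unit_col^T.
Proof.
move=> Vx u; apply/rowP => j.
have sDphi : smooth_on V ('D_y flag_chart) by apply: smooth_derive_cst => //; exact: smooth_flag_chart.
have mj : (m - j <= m)%N by exact: leq_subr.
have doj := smooth_diff (smooth_omega_iter (m - j)) Vx.
have D2 : ('D_y ('D_y flag_chart) x) 0 j = pairing y ('D_y (omega_iter (m - j)) x).
  rewrite (derive_mxE _ _ _ (smooth_diff sDphi Vx)).
  have -> : 'D_y (fun z => 'D_y flag_chart z 0 j : R^o) x = 'D_y (fun z => pairing y (omega_iter (m - j) z) : R^o) x.
    by apply: near_eq_derive; apply: filterS (open_near oV Vx) => z Vz; exact: derive_flag_chart.
  by rewrite (derive_pairing _ (differentiable_cst y x) doj) (derive_cst y x y) pairing0l add0r.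
rewrite mxE D2 derive_flag_chart// !pairingDl pairingNl pairingZl -/(X 0 x).
have -> : (flag_chart x *m shift_mx^T + u' *: unit_col^T) 0 j
    = (\sum_i flag_chart x 0 i * (j == i.+1 :> nat)%:R) + u' * (j == 0)%:R.
  rewrite mxE mxE; congr (_ + _); last by rewrite /unit_col !mxE eqxx andbT.
  by apply: eq_bigr => i _; rewrite !mxE.
have [j00|jn0] := eqVneq j 0.
  rewrite j00 subn0 -/(gain x).
  rewrite big1 ?add0r; last by move=> i _; rewrite mulr0.
  have c0n := gain_neq0 Vx; rewrite /u quad_feedback_gamma// /feedback_alpha /feedback_beta.
  move: (gain x) c0n (pairing y _) (pairing (y *m _) _) (pairing (e x) _) => a a0 p1 p2 p3.
  by rewrite mulr1; field.
have jpos : (0 < j)%N by rewrite lt0n.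
have mjm : (m - j < m)%N by rewrite ltn_subrL jpos ltnW.
have X0 : pairing (X 0 x) (omega_iter (m - j) x) = 0.
  by apply: (@flagged_omega_iter _ 0) => //; exact: flaggedX.
rewrite derive_omega_iter// -pairing_mulmx X0 !mulr0 !addr0 addrA subrr add0r.
have jm : (j.-1 < n)%N by rewrite prednK// ltnW.
rewrite (bigD1 (Ordinal jm))//= big1 ?addr0.
  have E : (m - j.-1 = (m - j).+1)%N.
    have jm' : (j.-1 < m)%N by rewrite prednK// -ltnS.
    by rewrite -(subnSK jm') prednK.
  by rewrite mxE /= prednK// eqxx mulr1 E.
move=> i ij; case: eqP => [ji|]; last by rewrite mulr0.
by case/eqP: ij; apply: val_inj; rewrite /= ji.
Qed.

End Coordinates.

(** The shift carries the first basis vector through the standard basis, so the controllability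
    matrix is the identity. *)
Lemma shift_pow (k : 'I_n) (i : 'I_n) : (shift_mx ^+ k *m unit_col) i 0 = (i == k)%:R.
Proof.
case: k => k kn; elim: k kn i => [|k IH] kn i.
  by rewrite expr0 mul1mx !mxE eqxx andbT.
rewrite exprS -mulmxA mxE (bigD1 (Ordinal (ltnW kn)))//= big1 ?addr0.
  by rewrite (IH (ltnW kn)) eqxx mulr1 !mxE.
by move=> j jk; rewrite (IH (ltnW kn)) (negbTE jk) mulr0.
Qed.

Lemma controllable_shift : controllable shift_mx unit_col.
Proof.
rewrite /controllable -[RHS](mxrank1 R n); congr (\rank _).
by apply/matrixP => i k; rewrite mxE shift_pow mxE.
Qed.

(** The ball serves the Poincare lemma, applied to [- theta], whose primitive is the logarithm of
    [s], and then to the parallel form [omega_iter s 0]. *)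
Lemma local_linearization (c : vec) (r : R) : 0 < r -> V = ball c r ->
  exists (phi : vec -> vec) (alpha beta : vec -> R) (gamma : vec -> 'M[R]_n)
         (E : 'M[R]_n) (b : 'cV[R]_n),
  [/\ smooth_on V phi /\ forall x, V x -> 'J phi x \in unitmx,
      [/\ @smooth_on R n R^o V alpha, @smooth_on R n R^o V beta &
          forall x, V x -> beta x != 0],
      smooth_on V gamma /\ forall x, (gamma x)^T = gamma x,
      controllable E b &
      forall x y u', V x ->
        let u := quad (gamma x) y y + alpha x + beta x * u' in
        'D_y ('D_y phi) x + 'D_(- (y *m Gm x y) + e x + u *: g x) phi x
        = phi x *m E^T + u' *: b^T].
Proof.
move=> r0 VB.
have [k [sk Dk]] : exists k : vec -> R, @smooth_on R n R^o V k /\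
    forall x v, V x -> 'D_v (k : vec -> R^o) x = pairing v (- theta x).
  rewrite VB; apply: (@poincare _ _ c r (fun x => - theta x) r0).
    by rewrite -VB; apply: smoothN => //; exact: smooth_theta.
  rewrite -VB => x u v Vx; have dv := smooth_diff smooth_theta Vx.
  have Dn a : 'D_a (fun z => - theta z) x = - 'D_a theta x by exact: derive_opp.
  rewrite (Dn u).
  rewrite (Dn v).
  rewrite pairingNr.
  rewrite pairingNr.
  have H := theta_closed u v Vx.
  exact: (congr1 -%R H).
have svN : smooth_on V (fun x => - theta x) by apply: smoothN => //; exact: smooth_theta.
have [s [ss s0 Ds]] := exp_primitive oV sk svN Dk.
have [h0 [sh0 Dh0]] : exists h0 : vec -> R, @smooth_on R n R^o V h0 /\
    forall x v, V x -> 'D_v (h0 : vec -> R^o) x = pairing v (omega_iter s 0 x).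
  rewrite VB; apply: (@poincare _ _ c r (omega_iter s 0) r0); rewrite -VB.
    exact: smooth_omega_iter.
  by move=> x u v Vx; exact: omega_iter0_closed.
exists (flag_chart s h0), (feedback_alpha s), (feedback_beta s), (feedback_gamma s), shift_mx, unit_col.
split.
- by split; [exact: smooth_flag_chart|move=> x Vx; exact: unit_jac_flag_chart].
- split; [exact: smooth_feedback_alpha|exact: smooth_feedback_beta|].
  by move=> x Vx; rewrite /feedback_beta invr_eq0; exact: gain_neq0.
- by split; [exact: smooth_feedback_gamma|exact: feedback_gamma_sym].
- exact: controllable_shift.
- by move=> x y u' Vx; exact: normal_form.
Qed.

End ParallelFlag.

(** * Linearization in a chart *)

Section ChartLinearization.
Context {R : realType} {m : nat}.
Local Notation n := m.+1.
Local Notation vec := 'rV[R]_n.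
Variables (V : set vec) (G : 'I_n -> 'I_n -> 'I_n -> vec -> R) (e g : vec -> vec).
Hypotheses (oV : open V) (se : smooth_on V e) (sg : smooth_on V g).
Hypothesis sG : forall a b c, @smooth_on R n R^o V (G a b c).
Hypothesis G_sym : forall a b c x, V x -> G a b c x = G a c b x.

Definition christoffel_mx x (v : vec) : 'M[R]_n := \matrix_(c, a) \sum_b G a b c x * v 0 b.

Lemma christoffelE x v w : christoffel G x v w = w *m christoffel_mx x v.
Proof.
apply/rowP => a; rewrite !mxE exchange_big/=; apply: eq_bigr => c _.
by rewrite mxE mulr_sumr; apply: eq_bigr => b _; rewrite mulrC.
Qed.

Lemma christoffel_mx_sym x v w : V x -> w *m christoffel_mx x v = v *m christoffel_mx x w.
Proof.
move=> Vx; rewrite -!christoffelE; apply/rowP => a; rewrite !mxE exchange_big/=.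
apply: eq_bigr => b _; apply: eq_bigr => c _.
by rewrite G_sym// mulrAC.
Qed.

Lemma smooth_christoffel_mx Y : smooth_on V Y -> smooth_on V (fun x => christoffel_mx x (Y x)).
Proof.
move=> /(smooth_mxP _ oV) sY; apply/smooth_mxP => // c a.
under eq_fun do rewrite mxE.
by apply: smooth_sum => // b _; apply: smoothM => //; exact: sY.
Qed.

Hypothesis m2 : (1 < m)%N.
Hypothesis rk : forall x, V x -> \rank (dist e g m x) = n.
Hypothesis mf3 : forall k x, (k <= m)%N -> V x ->
  (cov G (ad e k g) g x <= dist e g 0 x)%MS.
Hypothesis mf4 : forall k l x, (k <= m)%N -> (l <= m)%N -> V x ->
  (cov2 G (ad e k g) (ad e l g) e x <= dist e g 1 x)%MS.

Let unit_frame x : V x -> (\matrix_(i < n) ad e i g x) \in unitmx.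
Proof. by move=> Vx; rewrite -row_free_unit; apply/eqP; exact: rk. Qed.

Lemma sub_dist_flagged k x u : V x -> (k <= m)%N -> (u <= dist e g k x)%MS ->
  flagged e g k x u.
Proof.
move=> Vx km /submxP[D ->]; rewrite mulmx_sum_row; apply: flagged_sum => l _.
apply: flaggedZ; rewrite rowK; apply: (flaggedX unit_frame) => //.
- by rewrite -ltnS.
- by apply: leq_trans (ltn_ord l) _.
Qed.

(** (MF3) and (MF4) speak of the frame fields only; by tensoriality this extends them to all
    vectors. *)
Lemma flagged_linear k x (F : vec -> vec) : V x -> linear F ->
  (forall i : 'I_n, flagged e g k x (F (ad e i g x))) ->
  forall v, flagged e g k x (F v).
Proof.
move=> Vx lF fF v.
pose FL : {linear vec -> vec} := HB.pack F (GRing.isLinear.Build _ _ _ _ _ lF).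
rewrite (frame_decomp unit_frame v Vx) -[F _]/(FL _) linear_sum; apply: flagged_sum => i _.
by rewrite linearZ; apply: flaggedZ; exact: fF.
Qed.

Lemma covE X Y x : cov G X Y x = covd christoffel_mx (X x) Y x.
Proof. by rewrite /cov christoffelE. Qed.

Lemma flagged_covd_g x v : V x -> flagged e g 0 x (covd christoffel_mx v g x).
Proof.
move=> Vx; have dg := smooth_diff sg Vx.
rewrite (covdE christoffel_mx_sym v Vx dg).
apply: (@flagged_linear 0 x (fun v => v *m ('J g x + christoffel_mx x (g x)))) => //.
  by move=> a u w; rewrite mulmxDl scalemxAl.
move=> i; rewrite -(covdE christoffel_mx_sym _ Vx dg) -covE.
by apply: sub_dist_flagged => //; apply: mf3 => //; rewrite -ltnS.
Qed.

Let A x := 'J e x + christoffel_mx x (e x).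

Let cov2e x (v w : vec) := w *m 'D_v A x + w *m A x *m christoffel_mx x v - w *m christoffel_mx x v *m A x.

(** The derivative of [Y] cancels between the two terms of [cov2], which leaves an expression in the
    values at [x]. *)
Lemma cov2_cov2e X Y x : V x -> smooth_on V Y -> cov2 G X Y e x = cov2e x (X x) (Y x).
Proof.
move=> Vx sY; rewrite /cov2 !covE.
have E z : V z -> cov G Y e z = Y z *m A z.
  by move=> Vz; rewrite covE (covd_e se christoffel_mx_sym).
rewrite -(covd_e se christoffel_mx_sym)// {1}/covd.
have -> : 'D_(X x) (cov G Y e) x = 'D_(X x) (fun z => Y z *m A z) x.
  by apply: near_eq_derive; apply: filterS (open_near oV Vx) => z; exact: E.
have := covd_mulmx_A oV se smooth_christoffel_mx (X x) Vx (smooth_diff sY Vx).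
by rewrite {1}/covd E// => ->; rewrite addrK.
Qed.

Lemma flagged_cov2e x v w : V x -> flagged e g 1 x (cov2e x v w).
Proof.
move=> Vx.
have dA : differentiable A x by apply: smooth_diff (smooth_A oV se smooth_christoffel_mx) Vx.
apply: (@flagged_linear 1 x (cov2e x v)) => //.
  have BE u : cov2e x v u = u *m ('D_v A x + A x *m christoffel_mx x v - christoffel_mx x v *m A x).
    by rewrite /cov2e [in RHS]mulmxBr [in RHS]mulmxDr !mulmxA.
  by move=> a u1 u2; rewrite !BE mulmxDl scalemxAl.
move=> i {w}; set w := ad e i g x.
apply: (@flagged_linear 1 x (fun v => cov2e x v w)) => //.
  (* Linearity in the first direction is visible only after symmetry has moved [u] out of the
     Christoffel matrices. *)
  have [K BE] : exists K, forall u, cov2e x u w = w *m 'D_u A x + u *m K.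
    exists (christoffel_mx x (w *m A x) - christoffel_mx x w *m A x) => u.
    rewrite /cov2e (christoffel_mx_sym u (w *m A x) Vx) (christoffel_mx_sym u w Vx).
    by rewrite [in RHS]mulmxBr [in RHS]mulmxA addrA.
  move=> a u1 u2; rewrite (BE u1) (BE u2) (BE (a *: u1 + u2)) (derive_lin a u1 u2 dA).
  move: ('D_u1 A x) ('D_u2 A x) => d1 d2.
  by rewrite mulmxDr mulmxDl scalerDr addrACA -scalemxAr -scalemxAl.
move=> j; rewrite -(@cov2_cov2e (ad e j g) (ad e i g))//; last exact: smooth_ad.
by apply: sub_dist_flagged => //; [exact: ltnW|apply: mf4 => //; rewrite -ltnS].
Qed.

Lemma chart_linearization c r : 0 < r -> V = ball c r ->
  exists (phi : vec -> vec) (alpha beta : vec -> R) (gamma : vec -> 'M[R]_n)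
         (E : 'M[R]_n) (b : 'cV[R]_n),
  [/\ smooth_on V phi /\ forall x, V x -> 'J phi x \in unitmx,
      [/\ @smooth_on R n R^o V alpha, @smooth_on R n R^o V beta &
          forall x, V x -> beta x != 0],
      smooth_on V gamma /\ forall x, (gamma x)^T = gamma x,
      controllable E b &
      forall x y u', V x ->
        let u := quad (gamma x) y y + alpha x + beta x * u' in
        'D_y ('D_y phi) x + 'D_((mech_rhs G e g u (x, y)).2) phi x
        = phi x *m E^T + u' *: b^T].
Proof.
move=> r0 VB.
have [phi [al [be [ga [E [b [H1 H2 H3 H4 H5]]]]]]] := local_linearization oV se sg
  christoffel_mx_sym smooth_christoffel_mx unit_frame (fun x v => @flagged_covd_g x v) (fun x v w => @flagged_cov2e x v w) m2 r0 VB.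
exists phi, al, be, ga, E, b; split; [exact: H1|exact: H2|exact: H3|exact: H4|].
move=> x y u' Vx u.
have -> : (mech_rhs G e g u (x, y)).2 = - (y *m christoffel_mx x y) + e x + u *: g x.
  by rewrite -christoffelE.
exact: H5.
Qed.

End ChartLinearization.

(** * Tangent lifts and change of chart *)

Section TangentLift.
Context {R : realType} {n : nat}.
Local Notation vec := 'rV[R]_n.
Implicit Types (U W : set vec) (x y v w : vec).

Lemma diffable_fst (p : vec * vec) : differentiable (fst : vec * vec -> vec) p.
Proof.
pose f : {linear (vec * vec)%type -> vec} := fst.
by apply: (@linear_differentiable _ _ _ f) => z; exact: cvg_fst.
Qed.

Lemma diffable_snd (p : vec * vec) : differentiable (snd : vec * vec -> vec) p.
Proof.
pose f : {linear (vec * vec)%type -> vec} := snd.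
by apply: (@linear_differentiable _ _ _ f) => z; exact: cvg_snd.
Qed.

Lemma derive_fst (p u : vec * vec) : 'D_u (fst : vec * vec -> vec) p = u.1.
Proof.
pose f : {linear (vec * vec)%type -> vec} := fst.
rewrite deriveE; last exact: diffable_fst.
by rewrite (@diff_lin _ _ _ f) => // z; exact: cvg_fst.
Qed.

Lemma derive_snd (p u : vec * vec) : 'D_u (snd : vec * vec -> vec) p = u.2.
Proof.
pose f : {linear (vec * vec)%type -> vec} := snd.
rewrite deriveE; last exact: diffable_snd.
by rewrite (@diff_lin _ _ _ f) => // z; exact: cvg_snd.
Qed.

Lemma derive_mul_jac U (f : vec -> vec) x y v : open U -> smooth_on U f -> U x ->
  y *m 'D_v (fun z => 'J f z) x = 'D_v ('D_y f) x.
Proof.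
move=> oU sf Ux; have dJ := smooth_diff (smooth_jac oU sf) Ux.
rewrite -(derive_mulmxr y v dJ); apply: near_eq_derive.
apply: filterS (open_near oU Ux) => z Uz.
by rewrite (derive_jac _ (smooth_diff sf Uz)).
Qed.

Lemma diff_tangent_lift U (f : vec -> vec) x y v w : open U -> smooth_on U f -> U x ->
  'd (tangent_lift f) (x, y) (v, w) = ('D_v f x, 'D_v ('D_y f) x + 'D_w f x).
Proof.
move=> oU sf Ux; have df := smooth_diff sf Ux.
have dJ := smooth_diff (smooth_jac oU sf) Ux.
have d1 : differentiable (f \o fst : vec * vec -> vec) (x, y).
  by apply: differentiable_comp => //; exact: diffable_fst.
have dJ1 : differentiable ((fun z => 'J f z) \o fst : vec * vec -> _) (x, y).
  by apply: differentiable_comp => //; exact: diffable_fst.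
have d2 : differentiable (fun z : vec * vec => z.2 *m 'J f z.1) (x, y).
  by apply: diffable_mulmx => //; exact: diffable_snd.
have -> : tangent_lift f = fun z => ((f \o fst) z, z.2 *m 'J f z.1).
  by apply/funext => -[a b]; rewrite /tangent_lift/= diff_jac.
rewrite (diff_pair d1 d2); congr pair.
  by rewrite -deriveE// (derive_comp _ (diffable_fst (x, y)) df) derive_fst.
rewrite -deriveE// (derive_mulmx _ (diffable_snd (x, y)) dJ1) derive_snd/=.
rewrite (derive_comp _ (diffable_fst (x, y)) dJ).
rewrite derive_fst (derive_jac w df) -(derive_mul_jac y v oU sf Ux).
exact: addrC.
Qed.

(** The position components agree automatically for a tangent lift; only the acceleration equation
    remains. *)
Lemma lift_linear_rhsP U (f : vec -> vec) G e g u u' E b x y :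
  open U -> smooth_on U f -> U x ->
  'd (tangent_lift f) (x, y) (mech_rhs G e g u (x, y)) = linear_rhs E b u' (tangent_lift f (x, y))
  <-> 'D_y ('D_y f) x + 'D_((mech_rhs G e g u (x, y)).2) f x = f x *m E^T + u' *: b^T.
Proof.
move=> oU sf Ux; have df := smooth_diff sf Ux.
rewrite [mech_rhs _ _ _ _ _]surjective_pairing (diff_tangent_lift _ _ _ oU sf Ux).
by rewrite /linear_rhs/tangent_lift/= -deriveE//; split=> [[]|->].
Qed.

Lemma derive2_comp U W (t f : vec -> vec) x y v : open U -> open W ->
  smooth_on U t -> smooth_on W f -> (forall z, U z -> W (t z)) -> U x ->
  'D_v ('D_y (f \o t)) x =
  'D_('D_v t x) ('D_('D_y t x) f) (t x) + 'D_('D_v ('D_y t) x) f (t x).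
Proof.
move=> oU oW st sf tW Ux; have Wx := tW x Ux.
have dt := smooth_diff st Ux; have dft := smooth_diff sf Wx.
have dDt := smooth_diff (smooth_derive_cst y oU st) Ux.
have dJ := smooth_diff (smooth_jac oW sf) Wx.
have dJt : differentiable ((fun z => 'J f z) \o t) x by exact: differentiable_comp.
have -> : 'D_v ('D_y (f \o t)) x = 'D_v (fun z => 'D_y t z *m ((fun z => 'J f z) \o t) z) x.
  apply: near_eq_derive; apply: filterS (open_near oU Ux) => z Uz.
  have dfz := smooth_diff sf (tW z Uz).
  by rewrite (derive_comp _ (smooth_diff st Uz) dfz) derive_jac.
rewrite (derive_mulmx _ dDt dJt) (derive_comp _ dt dJ) (derive_mul_jac _ _ oW sf Wx).
by rewrite addrC; congr (_ + _); rewrite (derive_jac _ dft).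
Qed.

(** The inhomogeneous term in the transformation law of the Christoffel symbols cancels the second
    derivative of the transition in the chain rule. *)
Lemma rhs_change_of_chart U W (t f : vec -> vec) Gi ei gi Gj ej gj u x y :
  open U -> open W -> smooth_on U t -> smooth_on W f ->
  (forall z, U z -> W (t z)) -> U x ->
  'D_y t x = 'd t x y ->
  'd t x (christoffel Gi x y y) = christoffel Gj (t x) ('d t x y) ('d t x y)
    + 'D_y (fun z => 'D_y t z) x ->
  'd t x (ei x) = ej (t x) -> 'd t x (gi x) = gj (t x) ->
  'D_y ('D_y (f \o t)) x + 'D_((mech_rhs Gi ei gi u (x, y)).2) (f \o t) x =
  'D_('d t x y) ('D_('d t x y) f) (t x) +
  'D_((mech_rhs Gj ej gj u (t x, 'd t x y)).2) f (t x).
Proof.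
move=> oU oW st sf tW Ux tE tG te tg.
have dt := smooth_diff st Ux; have df := smooth_diff sf (tW x Ux).
rewrite (derive2_comp y y oU oW st sf tW Ux) tE -addrA; congr (_ + _).
have da : 'd t x (mech_rhs Gi ei gi u (x, y)).2
    = (mech_rhs Gj ej gj u (t x, 'd t x y)).2 - 'D_y ('D_y t) x.
  rewrite /mech_rhs/= 2!linearD linearN linearZ /= tG te tg.
  by rewrite opprD -!addrA; congr (_ + _); rewrite addrCA; congr (_ + _); rewrite addrC.
rewrite (derive_comp _ dt df) (deriveE _ dt) da !(deriveE _ df) -linearD.
by rewrite addrC subrK.
Qed.

End TangentLift.

Section Charts.
Context {R : realType} {n : nat} {Q : manifold R n}.
Implicit Types (i j : atlas Q) (O : set Q).

Lemma open_chart_img i O : open O -> open (chart_img i O).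
Proof.
move=> oO; have oI := @chart_img_open _ _ Q i.
have -> : chart_img i O = (chart i @` chart_dom i) `&` chart_inv i @^-1` O.
  apply/seteqP; split=> [_ [p [Op ip] <-]|_ [[p ip <-]]] /=.
    by rewrite chartK//; split=> //; exists p.
  by rewrite chartK// => Op; exists p.
move: oO; apply: (continuous_inP _ oI).1.
by rewrite -continuous_open_subspace//; exact: chart_inv_continuous.
Qed.

Lemma open_chart_preimage i (W : set 'rV[R]_n) : open W ->
  open (chart_dom i `&` chart i @^-1` W).
Proof.
have oI := @chart_dom_open _ _ Q i; apply: (continuous_inP _ oI).1.
by rewrite -continuous_open_subspace//; exact: chart_continuous.
Qed.

Lemma chart_img_mem i O p : O p -> chart_dom i p -> chart_img i O (chart i p).
Proof. by move=> Op ip; exists p. Qed.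

Lemma transition_chart i j p : chart_dom i p -> transition i j (chart i p) = chart j p.
Proof. by move=> ip; rewrite /transition/= chartK. Qed.

Lemma smooth_transition i j : smooth_on (chart_img i (chart_dom j)) (transition i j).
Proof. by rewrite /chart_img setIC; exact: chart_compat. Qed.

End Charts.

(** * From one chart to the manifold *)

Section Sufficiency.
Context {R : realType} {m : nat} {Q : manifold R m.+1}.
Local Notation n := m.+1.
Local Notation vec := 'rV[R]_n.
Variables (nabla : symmetric_connection Q) (g e : vector_field Q) (x0 : Q).

(** A linearization found in the single chart [i0] is read in any other chart by composing with the
    transition to [i0]. *)
Lemma chart_linearizable_MF (i0 : atlas Q) (O' : set vec) (phi0 psi0 : vec -> vec)
    (al be : vec -> R) (ga : vec -> 'M[R]_n) E b :
  chart_dom i0 x0 -> open O' -> O' (chart i0 x0) -> O' `<=` chart_img i0 setT ->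
  smooth_on O' phi0 -> open (phi0 @` O') ->
  (forall x, O' x -> psi0 (phi0 x) = x) -> smooth_on (phi0 @` O') psi0 ->
  @smooth_on R n R^o O' al -> @smooth_on R n R^o O' be ->
  (forall x, O' x -> be x != 0) ->
  smooth_on O' ga -> (forall x, (ga x)^T = ga x) -> controllable E b ->
  (forall x y u', O' x ->
     let u := quad (ga x) y y + al x + be x * u' in
     'D_y ('D_y phi0) x + 'D_((mech_rhs (Gam nabla i0) (e i0) (g i0) u (x, y)).2) phi0 x
     = phi0 x *m E^T + u' *: b^T) ->
  MF_linearizable_at nabla g e x0.
Proof.
move=> ix0 oO' O'x0 O'i sphi oW psiK spsi sal sbe be0 sga ga_sym cEb nf.
pose O : set Q := chart_dom i0 `&` chart i0 @^-1` O'.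
have oO : open O by exact: open_chart_preimage.
have Ox0 : O x0 by [].
have imO : chart i0 @` O = O'.
  apply/seteqP; split=> [_ [p [_ O'p] <-]//|x O'x].
  have [p [_ ip] px] := O'i x O'x.
  by exists p => //; split=> //=; rewrite px.
have Oi i : chart_img i O `<=` chart_img i (chart_dom i0).
  by move=> _ [p [[i0p _] ip] <-]; exact: chart_img_mem.
have tO i x : chart_img i O x -> O' (transition i i0 x).
  by move=> [p [[i0p O'p] ip] <-]; rewrite transition_chart.
have oOi i : open (chart_img i O) by exact: open_chart_img.
have st i : smooth_on (chart_img i O) (transition i i0).
  exact: smooth_sub (@Oi i) (smooth_transition i i0).
pose J i x := 'J (transition i i0) x.
have sJ i : smooth_on (chart_img i O) (J i) by apply: smooth_jac.
(* Pulling [ga] back along the transition to [i0] makes [gamma] a tensor. *)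
pose gamma i x := J i x *m ga (transition i i0 x) *m (J i x)^T.
have quad_gamma i x v w : chart_img i O x -> quad (gamma i x) v w
    = quad (ga (transition i i0 x)) ('d (transition i i0) x v) ('d (transition i i0) x w).
  move=> Oix; rewrite (quadE (gamma i x)) (quadE (ga _)).
  by rewrite (diff_jac _ _ v) (diff_jac _ _ w) trmx_mul /gamma !mulmxA.
pose psi := chart_inv i0 \o psi0.
have imphi : (phi0 \o chart i0) @` O = phi0 @` O' by rewrite -image_comp imO.
exists O, (phi0 \o chart i0), (al \o chart i0), (be \o chart i0), gamma, E, b.
split.
- by [].
- exists psi; split.
  + by rewrite imphi.
  + by move=> p [i0p O'p]; rewrite /psi/= psiK// chartK.
  + rewrite imphi continuous_open_subspace// => y; rewrite inE => Wy.
    have [x O'x xy] := Wy.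
    apply: continuous_comp; first exact: smooth_cont spsi Wy.
    have := @chart_inv_continuous _ _ Q i0.
    rewrite (continuous_open_subspace _ (@chart_img_open _ _ Q i0)); apply.
    rewrite inE -xy psiK//; have [p [_ i0p] <-] := O'i x O'x.
    by exists p.
  + move=> i; apply: (smooth_comp_mx (f := transition i i0) (g := phi0) (oOi i) oO') => //.
    exact: tO.
  + move=> i.
    (* On this set the coordinate expression of the inverse is a transition composed with [psi0]; it
       is open because [psi0] is continuous. *)
    pose W' := (phi0 @` O') `&` psi0 @^-1` (chart_img i0 (chart_dom i)).
    have oW' : open W'.
      have := @open_chart_img _ _ Q i0 _ (@chart_dom_open _ _ Q i).
      apply: (continuous_inP _ oW).1 => y; rewrite inE => Wy.
      exact: smooth_cont spsi Wy.
    have : smooth_on W' (transition i0 i \o psi0).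
      apply: (smooth_comp_mx (f := psi0) (g := transition i0 i) oW'
        (@open_chart_img _ _ Q i0 _ (@chart_dom_open _ _ Q i))).
      * by move=> y [].
      * by apply: smooth_sub spsi => y [].
      * exact: smooth_transition.
    apply: smooth_sub => _ [p [[i0p O'p] ip] <-]; split; first by exists (chart i0 p).
    by rewrite /= psiK//; exact: chart_img_mem.
- split.
  + by move=> i; apply: (smooth_comp (oOi i) (@tO i)).
  + by move=> i; apply: (smooth_comp (oOi i) (@tO i)).
  + by move=> p [i0p O'p]; exact: be0.
  + split.
    * move=> i r s; have : smooth_on (chart_img i O) (gamma i).
        apply: smooth_mulmx => //; last exact: smooth_trmx.
        apply: smooth_mulmx => //.
        exact: (smooth_comp_mx (oOi i) oO' (@tO i)).
      by move/(smooth_mxP _ (oOi i)); exact.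
    * by move=> i x _; rewrite /gamma !trmx_mul trmxK ga_sym mulmxA.
    * move=> i j p v w Op ip jp x t.
      have Oix : chart_img i O x by exact: chart_img_mem.
      have tx : t x = chart j p by exact: transition_chart.
      have Ojx : chart_img j O (t x) by rewrite tx; exact: chart_img_mem.
      have [i0p O'p] := Op.
      have ijx : chart_img i (chart_dom j) x by exact: chart_img_mem.
      have dt : differentiable t x := smooth_diff (smooth_transition i j) ijx.
      have dtj : differentiable (transition j i0) (t x) := smooth_diff (st j) Ojx.
      have E1 : transition j i0 (t x) = transition i i0 x.
        by rewrite tx !transition_chart.
      have dti : differentiable (transition i i0) x := smooth_diff (st i) Oix.
      have oij : open (chart_img i (O `&` chart_dom j)).
        by apply: open_chart_img; apply: openI => //; exact: chart_dom_open.
      have ijOx : chart_img i (O `&` chart_dom j) x by exact: chart_img_mem.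
      (* The cocycle identity of transitions holds only where the three charts overlap, so it is
         differentiated as an identity of germs. *)
      have E2 a : 'D_a (transition i i0) x = 'D_a (transition j i0 \o t) x.
        apply: near_eq_derive; apply: filterS (open_near oij ijOx) => _ [q [[Oq jq] iq] <-].
        have tq : t (chart i q) = chart j q by exact: transition_chart.
        by rewrite [RHS]/= tq !transition_chart.
      have E3 a : 'd (transition i i0) x a = 'd (transition j i0) (t x) ('d t x a).
        have := E2 a; rewrite (derive_comp a dt dtj).
        by rewrite (deriveE a dti) (deriveE a dt) (deriveE _ dtj).
      have Q2 := quad_gamma j (t x) ('d t x v) ('d t x w) Ojx.
      apply: (etrans (quad_gamma i x v w Oix)); apply: esym; apply: (etrans Q2).
      have H (G1 G2 : 'M[R]_n) v1 v2 w1 w2 : G1 = G2 -> v1 = v2 -> w1 = w2 ->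
        quad G1 v1 w1 = quad G2 v2 w2 by move=> -> -> ->.
      by apply: H; [exact: (congr1 ga E1)|exact: (esym (E3 v))|exact: (esym (E3 w))].
- by [].
- move=> i p y u' Op ip z Phi u.
  have Oix : chart_img i O (chart i p) by exact: chart_img_mem.
  have [i0p O'p] := Op.
  have tx : transition i i0 (chart i p) = chart i0 p by exact: transition_chart.
  have sf : smooth_on (chart_img i O) (phi0 \o transition i i0).
    exact: (smooth_comp_mx (oOi i) oO' (@tO i)).
  have dt := smooth_diff (st i) Oix.
  apply: (lift_linear_rhsP (Gam nabla i) (e i) (g i) u u' E b y (oOi i) sf Oix).2.
  rewrite (rhs_change_of_chart (Gj := Gam nabla i0) (ej := e i0) (gj := g i0)
    u (oOi i) oO' (st i) sphi (@tO i) Oix).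
  + set v := 'd (transition i i0) (chart i p) y.
    have uE : u = quad (ga (chart i0 p)) v v + al (chart i0 p) + be (chart i0 p) * u'.
      by rewrite /u (quad_gamma i _ _ _ Oix) tx.
    have fE : (phi0 \o transition i i0) (chart i p) = phi0 (chart i0 p).
      by rewrite [LHS]/= tx.
    by rewrite fE tx uE; exact: nf.
  + exact: deriveE.
  + exact: Gam_transition.
  + by rewrite tx (vf_transition e ip i0p).
  + by rewrite tx (vf_transition g ip i0p).
Qed.

Lemma MF_conditions_sufficient (U : set Q) : (1 < m)%N -> open U -> U x0 ->
  MF1 g e U -> MF3 nabla g e U -> MF4 nabla g e U -> MF_linearizable_at nabla g e x0.
Proof.
move=> m2 oU Ux0 mf1 mf3 mf4; have [i0 ix0] := chart_cover x0.
set c := chart i0 x0.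
have oI : open (chart_img i0 U) by exact: open_chart_img.
have Ic : chart_img i0 U c by exact: chart_img_mem.
have [r /= r0 VU] := (nbhs_ballP _ _).1 (open_near oI Ic).
have VT : ball c r `<=` chart_img i0 setT.
  by move=> x /VU [p [_ ip] <-]; exact: chart_img_mem.
have oV : open (ball c r) by exact: ball_open.
have Vc : ball c r c by exact: ballxx.
have se : smooth_on (ball c r) (e i0) by exact: smooth_sub VT (vf_smooth e i0).
have sg : smooth_on (ball c r) (g i0) by exact: smooth_sub VT (vf_smooth g i0).
have sG a1 b1 d1 : @smooth_on R n R^o (ball c r) (Gam nabla i0 a1 b1 d1).
  exact: smooth_sub VT (Gam_smooth nabla i0 a1 b1 d1).
have Gs a b d x : ball c r x -> Gam nabla i0 a b d x = Gam nabla i0 a d b x.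
  by move=> /VT; exact: Gam_sym.
have rk x : ball c r x -> \rank (dist (e i0) (g i0) m x) = n.
  by move=> /VU; exact: mf1.
have m3 k x : (k <= m)%N -> ball c r x ->
    (cov (Gam nabla i0) (ad (e i0) k (g i0)) (g i0) x <= dist (e i0) (g i0) 0 x)%MS.
  by move=> km /VU; exact: (mf3 k km i0 x).
have m4 k l x : (k <= m)%N -> (l <= m)%N -> ball c r x ->
    (cov2 (Gam nabla i0) (ad (e i0) k (g i0)) (ad (e i0) l (g i0)) (e i0) x
     <= dist (e i0) (g i0) 1 x)%MS.
  by move=> km lm /VU; exact: (mf4 k l km lm i0 x).
have [phi0 [al [be [ga [E [b [[sphi uJ] [sal sbe be0] [sga ga_sym] cEb nf]]]]]]] :=
  chart_linearization oV se sg sG Gs m2 rk m3 m4 r0 erefl.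
(* Invertible Jacobians give a diffeomorphism only after the ball is shrunk to [P]. *)
have [P [psi0 [oP Pc PV oW [psiK spsi]]]] := inverse_function oV Vc sphi uJ.
apply: (@chart_linearizable_MF i0 P phi0 psi0 al be ga E b) => //.
- by move=> x /PV/VT.
- exact: smooth_sub sphi.
- exact: smooth_sub sal.
- exact: smooth_sub sbe.
- by move=> x /PV; exact: be0.
- exact: smooth_sub sga.
- by move=> x y u' /PV; exact: nf.
Qed.

End Sufficiency.

(** * Necessity of the conditions *)

(* In the linearizing coordinates the fields ad_e^l g, l < k, span the constant subspace
   [krylov k], and nabla differs from the flat connection by a multiple of [b]. *)
Section LinearizedChart.
Context {R : realType} {m : nat}.
Local Notation n := m.+1.
Local Notation vec := 'rV[R]_n.
Variables (V : set vec) (G : 'I_n -> 'I_n -> 'I_n -> vec -> R) (e g f : vec -> vec).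
Variables (al be : vec -> R) (ga : vec -> 'M[R]_n) (E : 'M[R]_n) (b : 'cV[R]_n).
Hypotheses (oV : open V) (se : smooth_on V e) (sg : smooth_on V g) (sf : smooth_on V f).
Hypothesis sG : forall a b c, @smooth_on R n R^o V (G a b c).
Hypothesis G_sym : forall a b c x, V x -> G a b c x = G a c b x.
Hypothesis uJ : forall x, V x -> 'J f x \in unitmx.
Hypothesis be0 : forall x, V x -> be x != 0.
Hypothesis lin : forall x y u', V x ->
  let u := quad (ga x) y y + al x + be x * u' in
  'D_y ('D_y f) x + 'D_((mech_rhs G e g u (x, y)).2) f x = f x *m E^T + u' *: b^T.

(** The components of [X] in the linearizing coordinates, kept as functions of the original
    point. *)
Let push (X : vec -> vec) x := X x *m 'J f x.

(** The index counts vectors: E^k corresponds to [krylov k.+1]. *)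
Definition krylov k : 'M[R]_(k, n) := \matrix_(l < k) (E ^+ l *m b)^T.

Lemma krylov_mem k l : (l < k)%N -> ((E ^+ l *m b)^T <= krylov k)%MS.
Proof. by move=> lk; have := row_sub (Ordinal lk) (krylov k); rewrite rowK. Qed.

Lemma krylovP p k (B : 'M[R]_(p, n)) :
  (forall l, (l < k)%N -> ((E ^+ l *m b)^T <= B)%MS) -> (krylov k <= B)%MS.
Proof. by move=> H; apply/row_subP => l; rewrite rowK; exact: H. Qed.

Lemma krylovS k l : (k <= l)%N -> (krylov k <= krylov l)%MS.
Proof. by move=> kl; apply: krylovP => i ik; apply: krylov_mem; exact: leq_trans kl. Qed.

Lemma krylovE p k (u : 'M[R]_(p, n)) : (u <= krylov k)%MS -> (u *m E^T <= krylov k.+1)%MS.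
Proof.
move=> uk; apply: submx_trans (submxMr _ uk) _; apply/row_subP => l.
rewrite row_mul rowK -trmx_mul mulmxA (_ : E *m E ^+ l = E ^+ l.+1); last by rewrite exprS.
by apply: krylov_mem; rewrite ltnS.
Qed.

Lemma b_krylov k (a : R) : (0 < k)%N -> (a *: b^T <= krylov k)%MS.
Proof.
by move=> k0; apply: scalemx_sub; have := krylov_mem k0; rewrite expr0 mul1mx.
Qed.

(** Membership in a constant subspace is a system of linear equations with constant coefficients,
    which can be differentiated. *)
Lemma derive_submx (W : set vec) p (K : 'M[R]_(p, n)) (Z : vec -> vec) x v :
  open W -> W x -> differentiable Z x -> (forall z, W z -> (Z z <= K)%MS) ->
  ('D_v Z x <= K)%MS.
Proof.
move=> oW Wx dZ ZK; rewrite submxE -(derive_mulmxl _ v dZ); apply/eqP.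
rewrite -(derive_cst (0 : vec) x v); apply: near_eq_derive.
by apply: filterS (open_near oW Wx) => z /ZK; rewrite submxE => /eqP.
Qed.

Lemma smooth_push (W : set vec) X : open W -> W `<=` V -> smooth_on W X ->
  smooth_on W (push X).
Proof.
move=> oW WV sX; apply: smooth_mulmx => //.
by apply: smooth_jac => //; exact: smooth_sub sf.
Qed.

(** The equations of motion at velocity 0, for u' = 0 and u' = 1: their difference isolates g, and
    then the first gives e. *)
Lemma push_g_e x : V x ->
  push g x = (be x)^-1 *: b^T /\ push e x = f x *m E^T - (al x / be x) *: b^T.
Proof.
move=> Vx; have df := smooth_diff sf Vx.
have H u' : push e x + (al x + be x * u') *: push g x = f x *m E^T + u' *: b^T.
  have L : 'D_0 ('D_0 f) x
      + 'D_((mech_rhs G e g (quad (ga x) 0 0 + al x + be x * u') (x, 0)).2) f x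
    = f x *m E^T + u' *: b^T := lin 0 u' Vx.
  rewrite -L derive0 add0r (derive_jac _ df).
  have -> : (mech_rhs G e g (quad (ga x) 0 0 + al x + be x * u') (x, 0)).2
      = e x + (al x + be x * u') *: g x.
    transitivity (- christoffel G x 0 0 + e x
      + (quad (ga x) 0 0 + al x + be x * u') *: g x); first by [].
    have -> : quad (ga x) 0 0 = 0 by rewrite quadE mul0mx mul0mx mxE.
    have -> : christoffel G x 0 0 = 0 by rewrite christoffelE mul0mx.
    by rewrite oppr0 !add0r.
  by rewrite mulmxDl -scalemxAl.
have H0 := H 0; have H1 := H 1.
have E1 : be x *: push g x = b^T.
  have : (push e x + (al x + be x * 1) *: push g x) - (push e x + (al x + be x * 0) *: push g x) = b^T.
    by rewrite H0 H1 scale1r scale0r addr0 addrC addKr.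
  by rewrite mulr1 mulr0 addr0 opprD addrACA subrr add0r scalerDl addrC addKr.
have Eg : push g x = (be x)^-1 *: b^T by rewrite -E1 scalerA mulVf ?be0// scale1r.
split=> //; move: H0; rewrite mulr0 addr0 scale0r addr0 => <-.
by rewrite Eg scalerA addrK.
Qed.

(** Minus the Christoffel symbols of nabla in the linearizing coordinates, by their transformation
    law. *)
Let hess x v w := 'D_v ('D_w f) x - christoffel G x v w *m 'J f x.

Lemma derive2_sym x v w : V x -> 'D_v ('D_w f) x = 'D_w ('D_v f) x.
Proof.
move=> Vx; apply/rowP => j.
have sfj : @smooth_on R n R^o V (fun z => f z 0 j) by move/(smooth_mxP _ oV): sf; exact.
have H a c : ('D_a ('D_c f) x) 0 j = 'D_a ('D_c (fun z => f z 0 j : R^o)) x.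
  have dDf := smooth_diff (smooth_derive_cst c oV sf) Vx.
  rewrite (derive_mxE _ _ _ dDf); apply: near_eq_derive.
  apply: filterS (open_near oV Vx) => z Vz.
  by rewrite (derive_mxE _ _ _ (smooth_diff sf Vz)).
apply: (etrans (H v w)); apply: esym; apply: (etrans (H w v)).
exact: (clairaut w v oV sfj Vx).
Qed.

(* The equations of motion give the diagonal values; the rest is polarization. *)
Lemma hess_sub x v w : V x -> (hess x v w <= krylov 1)%MS.
Proof.
move=> Vx.
have dJ := smooth_diff (smooth_jac oV sf) Vx; have df := smooth_diff sf Vx.
have hessE a c : hess x a c = c *m ('D_a (fun z => 'J f z) x - christoffel_mx G x a *m 'J f x).
  by rewrite /hess -(derive_mul_jac c a oV sf Vx) christoffelE mulmxBr mulmxA.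
have hessC a c : hess x a c = hess x c a.
  by rewrite /hess (derive2_sym a c Vx) !christoffelE (christoffel_mx_sym G_sym _ _ Vx).
have hessDl a c d : hess x (a + c) d = hess x a d + hess x c d.
  by rewrite hessC hessE mulmxDl -!hessE !(hessC d).
have hessDr a c d : hess x d (a + c) = hess x d a + hess x d c.
  by rewrite hessE mulmxDl -!hessE.
have diag y : (hess x y y <= krylov 1)%MS.
  (* The equation at velocity y with u' = 0; the terms without velocity are known from [push_g_e],
     so only the contribution of [ga] is left. *)
  have [Eg Ee] := push_g_e Vx; pose q := quad (ga x) y y.
  have L : 'D_y ('D_y f) x + 'D_(- christoffel G x y y + e x
      + (q + al x + be x * 0) *: g x) f x = f x *m E^T + 0 *: b^T := lin y 0 Vx.
  move: L; rewrite (derive_jac _ df) mulr0 addr0 scale0r addr0 !mulmxDl mulNmx.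
  rewrite -[e x *m _]/(push e x) -scalemxAl -[g x *m _]/(push g x) Eg Ee !addrA.
  rewrite -/(hess x y y) => L.
  have -> : hess x y y = (- (q / be x)) *: b^T.
    apply: (addIr (f x *m E^T)); rewrite -{2}L.
    move: (hess x y y) (f x *m E^T) => h0 h1.
    by apply/rowP => j; rewrite !mxE; ring.
  exact: b_krylov.
have -> : hess x v w = 2^-1 *: (hess x (v + w) (v + w) - hess x v v - hess x w w).
  rewrite hessDl !hessDr (hessC w v).
  move: (hess x v v) (hess x v w) (hess x w w) => h1 h2 h3.
  by apply/rowP => j; rewrite !mxE; field.
apply: scalemx_sub; apply: addmx_sub; last by rewrite eqmx_opp.
by apply: addmx_sub => //; rewrite eqmx_opp.
Qed.

Lemma derive_push Y x v : V x -> differentiable Y x ->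
  'D_v (push Y) x = 'D_v Y x *m 'J f x + 'D_v ('D_(Y x) f) x.
Proof.
move=> Vx dY; have dJ := smooth_diff (smooth_jac oV sf) Vx.
by rewrite (derive_mulmx v dY dJ) (derive_mul_jac (Y x) v oV sf Vx).
Qed.

Lemma push_cov X Y x : V x -> differentiable Y x ->
  (push (cov G X Y) x - 'D_(X x) (push Y) x <= krylov 1)%MS.
Proof.
move=> Vx dY; have -> : push (cov G X Y) x - 'D_(X x) (push Y) x = - hess x (X x) (Y x).
  rewrite (derive_push _ Vx dY) /push /cov mulmxDl /hess opprB opprD.
  by rewrite addrACA subrr add0r.
by rewrite eqmx_opp; exact: hess_sub.
Qed.

Lemma push_bracket X Y x : V x -> differentiable X x -> differentiable Y x ->
  push (bracket X Y) x = 'D_(X x) (push Y) x - 'D_(Y x) (push X) x.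
Proof.
move=> Vx dX dY; rewrite (derive_push _ Vx dX) (derive_push _ Vx dY).
have aux (p q h1 h2 : vec) : h1 = h2 -> p - q = (p + h1) - (q + h2).
  by move=> ->; rewrite opprD addrACA subrr addr0.
by rewrite /push /bracket mulmxBl; apply: aux; exact: derive2_sym.
Qed.

Lemma smooth_push_e : smooth_on V (push e).
Proof. by apply: smooth_push se. Qed.

(** The difference between [push e] and the linear field takes values in the line of b, hence so
    does its derivative. *)
Lemma derive_push_e x v : V x ->
  ('D_v (push e) x - v *m 'J f x *m E^T <= krylov 1)%MS.
Proof.
move=> Vx; have dpe := smooth_diff smooth_push_e Vx; have df := smooth_diff sf Vx.
have dfE : differentiable (fun z => f z *m E^T) x.
  by apply: diffable_mulmx => //; exact: differentiable_cst.
rewrite -(derive_jac v df) -(derive_mulmxl E^T v df) -(derive_sub v dpe dfE).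
apply: (derive_submx v oV Vx) => [|z Vz]; first exact: differentiableB.
have [_ ->] := push_g_e Vz; rewrite addrC addKr -scaleNr; exact: b_krylov.
Qed.

(** Modulo earlier Krylov vectors, bracketing with e acts as - E. The explicit nonzero leading
    coefficient is what later gives equality of spans and not just inclusion. *)
Lemma push_ad k x : V x ->
  (push (ad e k g) x - ((-1) ^+ k * (be x)^-1) *: (E ^+ k *m b)^T <= krylov k)%MS.
Proof.
elim: k x => [|k IH] x Vx.
  have [Eg _] := push_g_e Vx.
  by rewrite expr0 mul1r mul1mx Eg subrr sub0mx.
have in_krylov z : V z -> (push (ad e k g) z <= krylov k.+1)%MS.
  move=> Vz; rewrite -[push _ z](subrK (((-1) ^+ k * (be z)^-1) *: (E ^+ k *m b)^T)).
  apply: addmx_sub; first by apply: submx_trans (IH z Vz) _; exact: krylovS.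
  by apply: scalemx_sub; exact: krylov_mem.
have dX := smooth_diff (smooth_ad oV se sg k) Vx; have de := smooth_diff se Vx.
have -> : push (ad e k.+1 g) x
    = 'D_(e x) (push (ad e k g)) x - 'D_(ad e k g x) (push e) x.
  by rewrite -(push_bracket Vx de dX).
have dpX := smooth_diff (smooth_push oV (fun _ => id) (smooth_ad oV se sg k)) Vx.
set c := (-1) ^+ k * (be x)^-1; set w := (E ^+ k *m b)^T.
have -> : ((-1) ^+ k.+1 * (be x)^-1) *: (E ^+ k.+1 *m b)^T = - (c *: (w *m E^T)).
  rewrite /w -trmx_mul mulmxA (_ : E *m E ^+ k = E ^+ k.+1); last by rewrite exprS.
  by rewrite /c exprS -scaleNr mulN1r mulNr.
set p := push (ad e k g) x.
have pE : p = ad e k g x *m 'J f x by [].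
(* Each summand lies in [krylov k.+1]: a derivative of a map with values there, an error in the line
   of b, and E applied to the remainder in [krylov k]. *)
have -> : 'D_(e x) (push (ad e k g)) x - 'D_(ad e k g x) (push e) x - - (c *: (w *m E^T))
    = 'D_(e x) (push (ad e k g)) x
      - ('D_(ad e k g x) (push e) x - ad e k g x *m 'J f x *m E^T) - (p - c *: w) *m E^T.
  rewrite -pE mulmxBl -scalemxAl.
  move: ('D_(e x) _ x) ('D_(ad e k g x) _ x) (p *m E^T) (c *: _) => a1 a2 a3 a4.
  by apply/rowP => j; rewrite !mxE; ring.
apply: addmx_sub; last by rewrite eqmx_opp; apply: krylovE; exact: IH.
apply: addmx_sub; first exact: (derive_submx (e x) oV Vx dpX in_krylov).
rewrite eqmx_opp; apply: submx_trans (derive_push_e _ Vx) _.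
exact: krylovS.
Qed.

Lemma push_ad_krylov k x : V x -> (push (ad e k g) x <= krylov k.+1)%MS.
Proof.
move=> Vz; rewrite -[push _ x](subrK (((-1) ^+ k * (be x)^-1) *: (E ^+ k *m b)^T)).
apply: addmx_sub; first by apply: submx_trans (push_ad k Vz) _; exact: krylovS.
by apply: scalemx_sub; exact: krylov_mem.
Qed.

Lemma push_dist k x : V x -> (dist e g k x *m 'J f x :=: krylov k.+1)%MS.
Proof.
move=> Vx; apply/eqmxP/andP; split.
  apply/row_subP => l; rewrite row_mul rowK.
  by apply: submx_trans (push_ad_krylov l Vx) _; apply: krylovS.
(* Triangular inversion: E^l b is a multiple of the image of ad_e^l g, up to vectors already
   treated. *)
apply: krylovP => l; elim/ltn_ind: l => l IH lk.
have c0 : (-1) ^+ l * (be x)^-1 != 0.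
  by rewrite mulf_neq0 ?invr_eq0 ?be0// expf_neq0// oppr_eq0 oner_eq0.
rewrite -(eqmx_scale _ c0) -[_ *: _](subKr (push (ad e l g) x)).
apply: addmx_sub.
  have := row_sub (Ordinal lk) (dist e g k x *m 'J f x).
  by rewrite row_mul rowK.
rewrite eqmx_opp; apply: submx_trans (push_ad l Vx) _.
by apply: krylovP => i il; apply: IH => //; exact: ltn_trans lk.
Qed.

Lemma sub_distE k x (u : vec) : V x ->
  (u <= dist e g k x)%MS = (u *m 'J f x <= krylov k.+1)%MS.
Proof.
move=> Vx; rewrite -(push_dist k Vx) submxMfree// row_free_unit.
exact: uJ.
Qed.

Lemma rank_dist k x : V x -> \rank (dist e g k x) = \rank (krylov k.+1).
Proof.
by move=> Vx; rewrite -(push_dist k Vx) mxrankMfree// row_free_unit; exact: uJ.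
Qed.

Lemma involutive_dist k (W : set vec) X Y : open W -> W `<=` V ->
  smooth_on W X -> smooth_on W Y ->
  (forall x, W x -> (X x <= dist e g k x)%MS) ->
  (forall x, W x -> (Y x <= dist e g k x)%MS) ->
  forall x, W x -> (bracket X Y x <= dist e g k x)%MS.
Proof.
move=> oW WV sX sY Xk Yk x Wx; have Vx := WV x Wx.
have pX z : W z -> (push X z <= krylov k.+1)%MS.
  by move=> Wz; have := Xk z Wz; rewrite (sub_distE _ _ (WV z Wz)).
have pY z : W z -> (push Y z <= krylov k.+1)%MS.
  by move=> Wz; have := Yk z Wz; rewrite (sub_distE _ _ (WV z Wz)).
rewrite (sub_distE _ _ Vx) -[_ *m _]/(push (bracket X Y) x).
rewrite (push_bracket Vx (smooth_diff sX Wx) (smooth_diff sY Wx)).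
apply: addmx_sub.
  exact: (derive_submx _ oW Wx (smooth_diff (smooth_push oW WV sY) Wx) pY).
rewrite eqmx_opp.
exact: (derive_submx _ oW Wx (smooth_diff (smooth_push oW WV sX) Wx) pX).
Qed.

Lemma cov_g_dist X x : V x -> (cov G X g x <= dist e g 0 x)%MS.
Proof.
move=> Vx; rewrite (sub_distE _ _ Vx) -[_ *m _]/(push (cov G X g) x).
rewrite -[push _ x](subrK ('D_(X x) (push g) x)).
apply: addmx_sub; first exact: push_cov (smooth_diff sg Vx).
apply: (derive_submx _ oV Vx); first exact: smooth_diff (smooth_push oV (fun _ => id) sg) Vx.
by move=> z Vz; exact: (push_ad_krylov 0 Vz).
Qed.

Lemma smooth_cov X Y : smooth_on V X -> smooth_on V Y -> smooth_on V (cov G X Y).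
Proof.
move=> sX sY; apply: smoothD => //; first exact: smooth_derive.
have : smooth_on V (fun x => Y x *m christoffel_mx G x (X x)).
  by apply: smooth_mulmx => //; exact: smooth_christoffel_mx.
by apply: smooth_ext => // x Vx; rewrite christoffelE.
Qed.

Lemma push_cov_e Y x : V x -> (push (cov G Y e) x - push Y x *m E^T <= krylov 1)%MS.
Proof.
move=> Vx; have -> : push (cov G Y e) x - push Y x *m E^T
    = (push (cov G Y e) x - 'D_(Y x) (push e) x) + ('D_(Y x) (push e) x - push Y x *m E^T).
  by rewrite addrA subrK.
apply: addmx_sub; first exact: push_cov (smooth_diff se Vx).
exact: derive_push_e.
Qed.

(** Each of the two terms of [cov2] becomes a derivative of the components of [Y], multiplied by E,
    up to multiples of b. The terms multiplied by E differ by a multiple of E b, so the result lies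
    in E^1. *)
Lemma cov2_e_dist X Y x : V x -> smooth_on V X -> smooth_on V Y ->
  (cov2 G X Y e x <= dist e g 1 x)%MS.
Proof.
move=> Vx sX sY; rewrite (sub_distE _ _ Vx).
have sYe := smooth_cov sY se.
have dpY := smooth_diff (smooth_push oV (fun _ => id) sY) Vx.
have dpYe := smooth_diff (smooth_push oV (fun _ => id) sYe) Vx.
have k12 p (u : 'M[R]_(p, n)) : (u <= krylov 1)%MS -> (u <= krylov 2)%MS.
  by move=> u1; apply: submx_trans u1 _; exact: krylovS.
have P1 := k12 _ _ (push_cov X Vx (smooth_diff sYe Vx)).
have P3 := k12 _ _ (push_cov_e (cov G X Y) Vx).
have P4 := krylovE (push_cov X Vx (smooth_diff sY Vx)).
have dpYE : differentiable (fun z => push Y z *m E^T) x.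
  by apply: diffable_mulmx => //; exact: differentiable_cst.
have P2 : ('D_(X x) (push (cov G Y e)) x - 'D_(X x) (push Y) x *m E^T <= krylov 2)%MS.
  rewrite -(derive_mulmxl E^T _ dpY) -(derive_sub _ dpYe dpYE); apply: k12.
  apply: (derive_submx _ oV Vx) => [|z Vz]; first exact: differentiableB.
  exact: push_cov_e.
(* The four groups are controlled by [P1], [P2], [P4] and [P3], in this order. *)
have -> : cov2 G X Y e x *m 'J f x
    = (push (cov G X (cov G Y e)) x - 'D_(X x) (push (cov G Y e)) x)
    + ('D_(X x) (push (cov G Y e)) x - 'D_(X x) (push Y) x *m E^T)
    - (push (cov G X Y) x - 'D_(X x) (push Y) x) *m E^T
    - (push (cov G (cov G X Y) e) x - push (cov G X Y) x *m E^T).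
  rewrite /cov2 mulmxBl -[cov G X (cov G Y e) x *m _]/(push (cov G X (cov G Y e)) x).
  rewrite -[cov G (cov G X Y) e x *m _]/(push (cov G (cov G X Y) e) x) [in RHS]mulmxBl.
  move: (push _ x) ('D_(X x) (push (cov G Y e)) x) ('D_(X x) (push Y) x *m E^T)
    (push (cov G X Y) x *m E^T) (push (cov G (cov G X Y) e) x) => a1 a2 a3 a4 a5.
  by apply/rowP => j; rewrite !mxE; ring.
by apply: addmx_sub; [apply: addmx_sub; [exact: addmx_sub|]|]; rewrite // eqmx_opp.
Qed.

End LinearizedChart.

(** * The four conditions around the point *)

Section Necessity.
Context {R : realType} {m : nat} {Q : manifold R m.+1}.
Local Notation n := m.+1.
Local Notation vec := 'rV[R]_n.
Variables (nabla : symmetric_connection Q) (g e : vector_field Q) (x0 : Q).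

Lemma rank_krylov (E : 'M[R]_n) (b : 'cV[R]_n) : controllable E b -> \rank (krylov E b n) = n.
Proof.
move=> cEb; rewrite -[RHS]cEb -mxrank_tr; congr (\rank _).
by apply/matrixP => i j; rewrite !mxE.
Qed.

(** Differentiating psi o phi = id, read in the chart, gives a right inverse of the Jacobian. *)
Lemma unit_jac_chart (O : set Q) (phi : Q -> vec) (psi : vec -> Q) i x : open O ->
  (forall p, O p -> psi (phi p) = p) ->
  smooth_on (chart_img i O) (phi \o chart_inv i) ->
  smooth_on (phi @` (O `&` chart_dom i)) (chart i \o psi) ->
  chart_img i O x -> 'J (phi \o chart_inv i) x \in unitmx.
Proof.
move=> oO psiK sf sh Vx; have oV : open (chart_img i O) by exact: open_chart_img.
have fx z : chart_img i O z -> (phi @` (O `&` chart_dom i)) ((phi \o chart_inv i) z).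
  by move=> [p [Op ip] <-]; exists p; rewrite //= chartK.
have df := smooth_diff sf Vx; have dh := smooth_diff sh (fx x Vx).
have E1 : 'J (phi \o chart_inv i) x *m 'J (chart i \o psi) ((phi \o chart_inv i) x) = 1%:M.
  apply/row_matrixP => k; rewrite !rowE mulmxA -(derive_jac _ df) -(derive_jac _ dh).
  rewrite -(derive_comp _ df dh) mulmx1 -[RHS](derive_id x); apply: near_eq_derive.
  apply: filterS (open_near oV Vx) => _ [p [Op ip] <-].
  by rewrite /= chartK// psiK.
exact: (proj1 (mulmx1_unit E1)).
Qed.

Lemma MF_conditions_necessary : MF_linearizable_at nabla g e x0 ->
  exists U : set Q,
    [/\ open U, U x0 & [/\ MF1 g e U, MF2 g e U, MF3 nabla g e U & MF4 nabla g e U]].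
Proof.
case=> O [phi [alpha [beta [gamma [E [b [[oO Ox0] [psi [_ psiK _ sphi spsi]]
  [_ _ be0 _] cEb lin]]]]]]].
exists O; split=> //.
have oV i : open (chart_img i O) by exact: open_chart_img.
have VT i : chart_img i O `<=` chart_img i setT.
  by move=> _ [p [_ ip] <-]; exact: chart_img_mem.
have se i : smooth_on (chart_img i O) (e i) by exact: smooth_sub (@VT i) (vf_smooth e i).
have sg i : smooth_on (chart_img i O) (g i) by exact: smooth_sub (@VT i) (vf_smooth g i).
have sG i a c d : @smooth_on R n R^o (chart_img i O) (Gam nabla i a c d).
  exact: smooth_sub (@VT i) (Gam_smooth nabla i a c d).
have Gs i a c d x : chart_img i O x -> Gam nabla i a c d x = Gam nabla i a d c x.
  by move=> /VT; exact: Gam_sym.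
have uJ i x : chart_img i O x -> 'J (phi \o chart_inv i) x \in unitmx.
  exact: (unit_jac_chart oO psiK (sphi i) (spsi i)).
have be0' i x : chart_img i O x -> beta (chart_inv i x) != 0.
  by move=> [p [Op ip] <-]; rewrite chartK//; exact: be0.
have lin' i x y u' : chart_img i O x ->
    let u := quad (gamma i x) y y + alpha (chart_inv i x) + beta (chart_inv i x) * u' in
    'D_y ('D_y (phi \o chart_inv i)) x
    + 'D_((mech_rhs (Gam nabla i) (e i) (g i) u (x, y)).2) (phi \o chart_inv i) x
    = (phi \o chart_inv i) x *m E^T + u' *: b^T.
  move=> Vx; have [p [Op ip] xp] := Vx; rewrite -xp chartK//.
  have Vp : chart_img i O (chart i p) by rewrite xp.
  apply: (lift_linear_rhsP (Gam nabla i) (e i) (g i) _ u' E b y (oV i) (sphi i) Vp).1.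
  exact: lin.
split.
- move=> i x Vx.
  rewrite (@rank_dist _ _ _ _ _ _ _ _ _ _ _ _ (oV i) (se i) (sg i) (sphi i)
    (uJ i) (be0' i) (lin' i) m x Vx).
  exact: rank_krylov.
- move=> k _; split.
    move=> i W X Y oW WV sX sY.
    exact: (@involutive_dist _ _ _ _ _ _ _ _ _ _ _ _ (oV i) (se i) (sg i) (sphi i)
      (uJ i) (be0' i) (lin' i) k W X Y oW WV sX sY).
  exists (\rank (krylov E b k.+1)) => i x Vx.
  exact: (@rank_dist _ _ _ _ _ _ _ _ _ _ _ _ (oV i) (se i) (sg i) (sphi i)
    (uJ i) (be0' i) (lin' i) k x Vx).
- move=> k _ i x Vx.
  exact: (@cov_g_dist _ _ _ _ _ _ _ _ _ _ _ _ (oV i) (se i) (sg i) (sphi i)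
    (Gs i) (uJ i) (be0' i) (lin' i) _ x Vx).
- move=> k l _ _ i x Vx.
  apply: (@cov2_e_dist _ _ _ _ _ _ _ _ _ _ _ _ (oV i) (se i) (sg i) (sphi i) (sG i)
    (Gs i) (uJ i) (be0' i) (lin' i) _ _ x Vx); exact: smooth_ad.
Qed.

End Necessity.

Theorem theorem1 : forall (R : realType) (n : nat) (Q : manifold R n)
    (nabla : symmetric_connection Q) (g e : vector_field Q) (x0 : Q),
  (3 <= n)%N ->
  MF_linearizable_at nabla g e x0 <->
  exists U : set Q,
    [/\ open U, U x0 & [/\ MF1 g e U, MF2 g e U, MF3 nabla g e U & MF4 nabla g e U]].
Proof.
(* For n = m + 1 the hypothesis 3 <= n is 1 < m by conversion. *)
move=> R [//|m] Q nabla g e x0 m2; split; first exact: MF_conditions_necessary.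
by move=> [U [oU Ux0 [mf1 _ mf3 mf4]]]; exact: (MF_conditions_sufficient m2 oU Ux0 mf1 mf3 mf4).
Qed.
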